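(* Let $G\rightrightarrows P$ be a Lie groupoid with source $\mathsf s$, target $\mathsf t$, unit inclusion $\epsilon:P\hookrightarrow G$ and inversion $\mathsf i:G\to G$, and let $S\subseteq TG$ be an involutive, multiplicative subbundle. Let $\mathrm{pr}:G\to G/S$ be the projection onto the space of leaves of $S$ and $\mathrm{pr}_\circ:P\to P/S$ the projection onto the space of leaves of $S\cap TP$ in $P$. (1) If $p,q\in P$ lie in the same leaf of $S\cap TP$, then $p$ and $q$, seen as elements of $G$, lie in the same leaf of $S$. Hence the map $[\epsilon]:P/S\to G/S$ with $\mathrm{pr}\circ\epsilon=[\epsilon]\circ\mathrm{pr}_\circ$ is well-defined. (2) If $g,h\in G$ lie in the same leaf of $S$, then $\mathsf s(g)$ and $\mathsf s(h)$ lie in the same leaf of $S\cap TP$, and $\mathsf t(g)$ and $\mathsf t(h)$ lie in the same leaf of $S\cap TP$. Hence the maps $[\mathsf s],[\mathsf t]:G/S\to P/S$ with $[\mathsf s]\circ\mathrm{pr}=\mathrm{pr}_\circ\circ\mathsf s$ and $[\mathsf t]\circ\mathrm{pr}=\mathrm{pr}_\circ\circ\mathsf t$ are well-defined. (3) If $g,h\in G$ lie in the same leaf of $S$, then $g^{-1}$ and $h^{-1}$ lie in the same leaf of $S$. Hence the map $[\mathsf i]:G/S\to G/S$ with $[\mathsf i]\circ\mathrm{pr}=\mathrm{pr}\circ\mathsf i$ is well-defined.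
   Context: For a Lie groupoid $G\rightrightarrows P$, $G$ and $P$ are smooth Hausdorff manifolds, $\mathsf s,\mathsf t$ are surjective submersions, and the product $g\star h$ is defined if and only if $\mathsf s(g)=\mathsf t(h)$. The unit $1_p=\epsilon(p)$ is identified with $p$, so $P\subseteq G$ and $TP\subseteq TG$. Applying the tangent functor to the structure maps gives the tangent Lie groupoid $TG\rightrightarrows TP$ with source $T\mathsf s$ and target $T\mathsf t$. A distribution $S\subseteq TG$ is multiplicative if it is a (set) subgroupoid of $TG\rightrightarrows TP$. A subbundle is a smooth distribution of constant rank. If $S$ is an involutive multiplicative subbundle, then $S\cap TP$ is an involutive subbundle of $TP$, so both are completely integrable in the sense of Frobenius. *)

(* Defs.v *)
From HB Require Import structures.
From mathcomp Require Import all_boot all_order all_algebra.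
From mathcomp Require Import all_classical all_reals all_analysis.

Set Implicit Arguments.
Unset Strict Implicit.
Unset Printing Implicit Defensive.

Import Order.TTheory GRing.Theory Num.Theory.
Import numFieldNormedType.Exports.

Local Open Scope classical_set_scope.
Local Open Scope ring_scope.

(** * Smooth maps between open subsets of R^m and R^n *)

Fixpoint Ck (R : realType) (m n k : nat) (U : set 'rV[R]_m)
    (f : 'rV[R]_m -> 'rV[R]_n) : Prop :=
  if k is k'.+1 then
    (forall x, U x -> differentiable f x) /\ forall v, Ck k' U ('D_v f)
  else forall x, U x -> {for x, continuous f}.

(* Only used for open U. *)
Definition smooth_on (R : realType) (m n : nat) (U : set 'rV[R]_m)
    (f : 'rV[R]_m -> 'rV[R]_n) : Prop :=
  forall k, Ck k U f.

Definition smooth_near (R : realType) (m n : nat) (x : 'rV[R]_m)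
    (f : 'rV[R]_m -> 'rV[R]_n) : Prop :=
  exists U : set 'rV[R]_m, [/\ open U, U x & smooth_on U f].

(** * Smooth manifolds *)

Record chart (R : realType) (n : nat) (M : topologicalType) := Chart {
  chart_dom : set M;
  chart_cod : set 'rV[R]_n;
  chart_map : M -> 'rV[R]_n;
  chart_inv : 'rV[R]_n -> M;
  chart_dom_open : open chart_dom;
  chart_cod_open : open chart_cod;
  chart_map_cod : forall p, chart_dom p -> chart_cod (chart_map p);
  chart_inv_dom : forall x, chart_cod x -> chart_dom (chart_inv x);
  chart_mapK : forall p, chart_dom p -> chart_inv (chart_map p) = p;
  chart_invK : forall x, chart_cod x -> chart_map (chart_inv x) = x;
  chart_map_continuous :
    forall p, chart_dom p -> {for p, continuous chart_map};
  chart_inv_continuous :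
    forall x, chart_cod x -> {for x, continuous chart_inv}
}.

(* A Hausdorff manifold of dimension n, given by a (not necessarily maximal)
   smooth atlas together with a preferred chart [chart_at p] around each
   point p.  Second countability is not required. *)
Record manifold (R : realType) (n : nat) := Manifold {
  carrier :> topologicalType;
  carrier_hausdorff : hausdorff_space carrier;
  atlas : set (chart R n carrier);
  chart_at : carrier -> chart R n carrier;
  chart_at_atlas : forall p, atlas (chart_at p);
  chart_at_dom : forall p, chart_dom (chart_at p) p;
  atlas_compatible : forall c c', atlas c -> atlas c' ->
    smooth_on (chart_cod c `&` chart_inv c @^-1` chart_dom c')
              (chart_map c' \o chart_inv c)
}.

Definition chart_coord (R : realType) (n : nat) (M : manifold R n) (p : M) :
    'rV[R]_n := chart_map (chart_at p) p.

Definition local_rep (R : realType) (m n : nat) (M : manifold R m)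
    (N : manifold R n) (f : M -> N) (p : M) : 'rV[R]_m -> 'rV[R]_n :=
  chart_map (chart_at (f p)) \o f \o chart_inv (chart_at p).

Definition smooth (R : realType) (m n : nat) (M : manifold R m)
    (N : manifold R n) (f : M -> N) : Prop :=
  continuous f /\ forall p, smooth_near (chart_coord p) (local_rep f p).

(* The tangent space T_pM is identified with R^n by means of the preferred
   chart at p, so that a vector of TM is a pair (p, v) with p : M and
   v : 'rV[R]_n.  In these terms T_pf is the differential at the coordinates
   of p of the representation of f in the preferred charts at p and f p. *)
Definition tangent_map (R : realType) (m n : nat) (M : manifold R m)
    (N : manifold R n) (f : M -> N) (p : M) : 'Hom('rV[R]_m, 'rV[R]_n) :=
  linfun ('d (local_rep f p) (chart_coord p)).

(** * Vector fields and distributions *)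

Definition vector_field (R : realType) (n : nat) (M : manifold R n) : Type :=
  M -> 'rV[R]_n.

(* The components of X in the chart [chart_at p], as a function on R^n; the
   differential changes from the preferred chart at q to that at p. *)
Definition field_rep (R : realType) (n : nat) (M : manifold R n)
    (X : vector_field M) (p : M) : 'rV[R]_n -> 'rV[R]_n :=
  fun x => let q := chart_inv (chart_at p) x in
    'd (chart_map (chart_at p) \o chart_inv (chart_at q)) (chart_coord q) (X q).

Definition smooth_field_on (R : realType) (n : nat) (M : manifold R n)
    (U : set M) (X : vector_field M) : Prop :=
  forall p, U p -> smooth_near (chart_coord p) (field_rep X p).

(* [X, Y] = DY(X) - DX(Y), computed at p in the preferred chart at p. *)
Definition lie_bracket (R : realType) (n : nat) (M : manifold R n)
    (X Y : vector_field M) : vector_field M :=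
  fun p => 'D_(X p) (field_rep Y p) (chart_coord p)
         - 'D_(Y p) (field_rep X p) (chart_coord p).

Definition tangent_distribution (R : realType) (n : nat) (M : manifold R n) :
    Type :=
  M -> {vspace 'rV[R]_n}.

Definition section_on (R : realType) (n : nat) (M : manifold R n)
    (S : tangent_distribution M) (U : set M) (X : vector_field M) : Prop :=
  smooth_field_on U X /\ forall p, U p -> X p \in S p.

Definition smooth_distribution (R : realType) (n : nat) (M : manifold R n)
    (S : tangent_distribution M) : Prop :=
  forall p v, v \in S p ->
    exists (U : set M) (X : vector_field M),
      [/\ open U, U p, section_on S U X & X p = v].

Definition subbundle (R : realType) (n : nat) (M : manifold R n)
    (S : tangent_distribution M) : Prop :=
  smooth_distribution S /\ exists k : nat, forall p, \dim (S p) = k.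

Definition involutive_distribution (R : realType) (n : nat) (M : manifold R n)
    (S : tangent_distribution M) : Prop :=
  forall (U : set M) (X Y : vector_field M), open U ->
    section_on S U X -> section_on S U Y ->
    forall p, U p -> lie_bracket X Y p \in S p.

(** * Leaves *)

(* L is the image of an injective immersion i of a connected manifold N with
   T_x i (T_x N) = S_(i x) for all x in N. *)
Definition connected_integral_manifold (R : realType) (n : nat)
    (M : manifold R n) (S : tangent_distribution M) (L : set M) : Prop :=
  exists (k : nat) (N : manifold R k) (i : N -> M),
    [/\ connected [set: N],
        smooth i,
        injective i,
        (forall x, lker (tangent_map i x) = 0%VS /\
                   limg (tangent_map i x) = S (i x))
      & L = range i].

Definition is_leaf (R : realType) (n : nat) (M : manifold R n)
    (S : tangent_distribution M) (L : set M) : Prop :=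
  connected_integral_manifold S L /\
  forall L', connected_integral_manifold S L' -> L `<=` L' -> L' = L.

Definition same_leaf (R : realType) (n : nat) (M : manifold R n)
    (S : tangent_distribution M) (p q : M) : Prop :=
  exists L, [/\ is_leaf S L, L p & L q].

(* The union of the leaves of S containing p.  If S is an involutive subbundle,
   there is exactly one such leaf by the Frobenius theorem, and this is it. *)
Definition leaf_through (R : realType) (n : nat) (M : manifold R n)
    (S : tangent_distribution M) (p : M) : set M :=
  [set q | same_leaf S p q].

Definition leaf_space (R : realType) (n : nat) (M : manifold R n)
    (S : tangent_distribution M) : Type :=
  {L : set M | exists p, L = leaf_through S p}.

Definition leaf_proj (R : realType) (n : nat) (M : manifold R n)
    (S : tangent_distribution M) (p : M) : leaf_space S :=
  exist _ (leaf_through S p) (ex_intro _ p erefl).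

(** * Lie groupoids *)

(* [F] represents the partial multiplication [mul] of composable arrows near
   the pair (g, h), in preferred charts: the composable pairs form an embedded
   submanifold of G x G, and a map on it is smooth iff it extends locally to a
   smooth map on an open subset of G x G. *)
Definition mul_extension (R : realType) (n m : nat) (G : manifold R n)
    (P : manifold R m) (src tgt : G -> P) (mul : G -> G -> G) (g h : G)
    (F : 'rV[R]_(n + n) -> 'rV[R]_n) : Prop :=
  exists W : set 'rV[R]_(n + n),
    [/\ open W, W (row_mx (chart_coord g) (chart_coord h)), smooth_on W F
      & forall g' h', src g' = tgt h' ->
          chart_dom (chart_at g) g' -> chart_dom (chart_at h) h' ->
          let x := row_mx (chart_map (chart_at g) g')
                          (chart_map (chart_at h) h') in
          W x -> chart_dom (chart_at (mul g h)) (mul g' h') /\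
                 chart_map (chart_at (mul g h)) (mul g' h') = F x].

(* [mul g h] is only meaningful when [src g = tgt h]. *)
Record lie_groupoid (R : realType) (n m : nat) (G : manifold R n)
    (P : manifold R m) := LieGroupoid {
  gpd_src : G -> P;
  gpd_tgt : G -> P;
  gpd_unit : P -> G;
  gpd_inv : G -> G;
  gpd_mul : G -> G -> G;
  gpd_src_smooth : smooth gpd_src;
  gpd_tgt_smooth : smooth gpd_tgt;
  gpd_unit_smooth : smooth gpd_unit;
  gpd_inv_smooth : smooth gpd_inv;
  gpd_mul_smooth : forall g h, gpd_src g = gpd_tgt h ->
    exists F, mul_extension gpd_src gpd_tgt gpd_mul g h F;
  gpd_src_surj : forall p, exists g, gpd_src g = p;
  gpd_tgt_surj : forall p, exists g, gpd_tgt g = p;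
  gpd_src_submersion : forall g, limg (tangent_map gpd_src g) = fullv;
  gpd_tgt_submersion : forall g, limg (tangent_map gpd_tgt g) = fullv;
  gpd_src_mul : forall g h, gpd_src g = gpd_tgt h ->
    gpd_src (gpd_mul g h) = gpd_src h;
  gpd_tgt_mul : forall g h, gpd_src g = gpd_tgt h ->
    gpd_tgt (gpd_mul g h) = gpd_tgt g;
  gpd_mulA : forall g h k, gpd_src g = gpd_tgt h -> gpd_src h = gpd_tgt k ->
    gpd_mul g (gpd_mul h k) = gpd_mul (gpd_mul g h) k;
  gpd_src_unit : forall p, gpd_src (gpd_unit p) = p;
  gpd_tgt_unit : forall p, gpd_tgt (gpd_unit p) = p;
  gpd_mul_unitl : forall g, gpd_mul (gpd_unit (gpd_tgt g)) g = g;
  gpd_mul_unitr : forall g, gpd_mul g (gpd_unit (gpd_src g)) = g;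
  gpd_src_inv : forall g, gpd_src (gpd_inv g) = gpd_tgt g;
  gpd_tgt_inv : forall g, gpd_tgt (gpd_inv g) = gpd_src g;
  gpd_mul_invl : forall g, gpd_mul (gpd_inv g) g = gpd_unit (gpd_src g);
  gpd_mul_invr : forall g, gpd_mul g (gpd_inv g) = gpd_unit (gpd_tgt g)
}.

(* u is the product of v in T_gG and w in T_hG in the groupoid TG => TP, i.e.
   the image of (v, w) under the differential of mul.  For composable v and w,
   (v, w) is tangent to the manifold of composable pairs, so that u does not
   depend on the extension F. *)
Definition tangent_mul (R : realType) (n m : nat) (G : manifold R n)
    (P : manifold R m) (GG : lie_groupoid G P) (g h : G)
    (v w u : 'rV[R]_n) : Prop :=
  exists2 F, mul_extension (gpd_src GG) (gpd_tgt GG) (gpd_mul GG) g h F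
    & u = 'd F (row_mx (chart_coord g) (chart_coord h)) (row_mx v w).

(* S is a (set) subgroupoid of TG => TP. *)
Definition multiplicative (R : realType) (n m : nat) (G : manifold R n)
    (P : manifold R m) (GG : lie_groupoid G P)
    (S : tangent_distribution G) : Prop :=
  [/\ (forall g v, v \in S g ->
         let p := gpd_src GG g in
         tangent_map (gpd_unit GG) p (tangent_map (gpd_src GG) g v)
           \in S (gpd_unit GG p)),
      (forall g v, v \in S g ->
         let p := gpd_tgt GG g in
         tangent_map (gpd_unit GG) p (tangent_map (gpd_tgt GG) g v)
           \in S (gpd_unit GG p)),
      (forall g v, v \in S g ->
         tangent_map (gpd_inv GG) g v \in S (gpd_inv GG g))
    & (forall g h v w u, gpd_src GG g = gpd_tgt GG h ->
         v \in S g -> w \in S h ->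
         tangent_map (gpd_src GG) g v = tangent_map (gpd_tgt GG) h w ->
         tangent_mul GG g h v w u -> u \in S (gpd_mul GG g h))].

(* S \cap TP, where TP is identified with a subset of TG by means of the
   tangent map of the unit inclusion. *)
Definition base_distribution (R : realType) (n m : nat) (G : manifold R n)
    (P : manifold R m) (GG : lie_groupoid G P) (S : tangent_distribution G) :
    tangent_distribution P :=
  fun p => (tangent_map (gpd_unit GG) p @^-1: S (gpd_unit GG p))%VS.

(* Main.v *)
From Pilot Require Import Defs.
From HB Require Import structures.
From mathcomp Require Import all_boot all_order all_algebra.
From mathcomp Require Import all_classical all_reals all_analysis.
From mathcomp Require Import perm ring lra.

Set Implicit Arguments.
Unset Strict Implicit.
Unset Printing Implicit Defensive.

Import Order.TTheory GRing.Theory Num.Theory.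
Import numFieldNormedType.Exports.
(* so that [multiplicative] denotes the property of distributions *)
Import Pilot.Defs.

Local Open Scope classical_set_scope.
Local Open Scope ring_scope.

(** The unit, the source, the target and the inversion are smooth maps, and
multiplicativity says that their tangent maps carry S and S0, the intersection
of S with TP, into one another. So it suffices that a smooth map whose tangent
map carries a distribution into another one sends leaves into leaves
([same_leaf_map]); that it then induces a unique map between the leaf spaces
follows from the surjectivity of the projections ([induced_map_exists_unique]).

Leaves are maximal connected integral manifolds, a notion that does not
obviously behave well under maps, and an image of a leaf need not be an
integral manifold. They are therefore compared with a notion that is visibly
functorial. A map g from an open subset of some R^j into the manifold is
tangent to S if its differential takes values in S; a set is leaf-open if its
preimages under all such maps are open; the quasi-leaf of p is the intersection
of the sets that contain p and that are leaf-open together with their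
complement. Composition with f takes maps tangent to S to maps tangent to S',
hence f maps quasi-leaves into quasi-leaves ([quasi_leaf_map]). A connected
integral manifold lies in a quasi-leaf, because its inclusion is continuous for
the leaf topology. If S is integrable, then a quasi-leaf is itself a connected
integral manifold ([quasi_leaf_integral]), so it is the leaf ([same_leafP]).

Integrability at p ([integrable_at]) is stated in a chart: S is spanned near p
by the rows of a matrix L x which are commuting vector fields and satisfy
L x * Pm = 1 for a constant matrix Pm. For commuting fields, the time-one map u
of the flows of the fields c * L satisfies du_c h = h * L (u c)
([time_one_map_exists]), so that u parametrizes a plaque of S. A curve g that
is tangent to S and starts in the plaque remains in it ([foliated_box]): the
distance between g and u ((g - x0) * Pm) satisfies a linear differential
inequality and vanishes initially. Consequently plaques are leaf-open
([plaque_through]), and they are the charts of the quasi-leaf.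

For S itself, integrability is the classical argument: sections spanning S at p
form a frame B near p, and L = (B * Pm)^-1 * B has commuting rows, because
their brackets lie in S and are annihilated by Pm ([frame_normalize],
[subbundle_integrable]).

For S0 neither the constancy of the rank nor the existence of local sections is
given, and both come from the retraction of G onto P by the source
([base_integrable]). In charts let e and sigma represent the unit and the
source, so that sigma o e = id, let De and Dsigma be their Jacobian matrices,
and let L be a commuting frame of S. The rows of Z = L (e x) * Dsigma span S0.
The matrix E = Z * De * Pm is idempotent and has the same rank as Z; the rank
of a continuous idempotent is locally constant since both E and 1 - E have
lower semicontinuous rank. Finally, e pushes fields in S0 forward to
combinations of the rows of L along e, where the commutation of L shows that
brackets stay in S ([retract_frame]). *)

(** * Differentials *)

Section Differentials.
Context {R : realType}.

Lemma near0_norm_lt {V : normedModType R} (e : R) : 0 < e ->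
  \forall h \near (0 : V), `|h| < e.
Proof.
move=> e0; apply/nbhs_ballP; exists e => //= h.
by rewrite -ball_normE /= sub0r normrN.
Qed.

Lemma differentiable_expansion {V W : normedModType R} (f : V -> W) (x : V) :
  differentiable f x -> forall e, 0 < e ->
  \forall h \near (0 : V), `|f (h + x) - f x - 'd f x h| <= e * `|h|.
Proof.
move=> /diff_locallyP[_ /eqaddoP dfx] e e0.
by apply: filterS (dfx e e0) => h /=; rewrite opprD addrA.
Qed.

(** A differential can be recognised from an explicit linear approximation; the
time-one map of commuting fields is differentiated in this way. *)
Lemma diff_of_expansion {V W : normedModType R} (f : V -> W) (x : V)
    (l : {linear V -> W}) : continuous l ->
  (forall e, 0 < e ->
    \forall h \near (0 : V), `|f (h + x) - f x - l h| <= e * `|h|) ->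
  is_diff x f l.
Proof.
move=> lc fxl.
have fE : f \o shift x = cst (f x) + l +o_ 0 id.
  apply/eqaddoP => e e0; apply: filterS (fxl e e0) => h /=.
  by rewrite -!fctE /= opprD addrA.
have dE := diff_unique lc fE.
apply: DiffDef => //; apply/diff_locallyP; rewrite dE; split => //.
Qed.

Lemma near_eq_is_diff {V W : normedModType R} (f g : V -> W) (x : V) df :
  {near x, f =1 g} -> is_diff x f df -> is_diff x g df.
Proof.
move=> fg [dfx fxE].
have fxg : f x = g x by exact: nbhs_singleton fg.
suff [gx gxE] : is_diff x g ('d f x) by apply: DiffDef => //; rewrite gxE.
apply: diff_of_expansion => [|e e0].
  exact: diff_continuous.
have : \forall h \near (0 : V), f (h + x) = g (h + x).
  by move: fg; rewrite (near_shift 0 x); apply: filterS => h /=; rewrite subr0.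
move=> fgh; near=> h; rewrite -fxg -(near fgh h)//.
by near: h; exact: differentiable_expansion.
Unshelve. all: by end_near. Qed.

Lemma is_diffE {V W : normedModType R} (f : V -> W) (x : V) df :
  is_diff x f df -> 'd f x = df :> (V -> W).
Proof. by move=> [_ ->]. Qed.

Lemma diff_comp_near {U V W : normedModType R} (f : U -> V) (g : V -> W)
    (h : U -> W) (x : U) (y : V) : y = f x ->
  differentiable f x -> differentiable g y -> {near x, g \o f =1 h} ->
  forall v, 'd h x v = 'd g y ('d f x v).
Proof.
move=> -> /differentiableP df /differentiableP dg gfh v.
have := is_diffE (near_eq_is_diff gfh (is_diff_comp df dg)).
exact: (congr1 (fun F : U -> W => F v)).
Qed.

Lemma is_diff_derive {V W : normedModType R} (f : V -> W) (x : V) df v :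
  is_diff x f df -> 'D_v f x = df v.
Proof. by move=> [fx <-]; rewrite deriveE. Qed.

Lemma linear_mx_continuous {a b} {W : normedModType R}
  (f : {linear 'M[R]_(a, b) -> W}) : continuous f.
Proof.
have fE : (f : _ -> _) = \sum_(i < a) \sum_(j < b)
    (fun x : 'M[R]_(a, b) => x i j *: f (delta_mx i j)).
  apply/funext => x; rewrite {1}(matrix_sum_delta x) linear_sum fct_sumE.
  apply: eq_bigr => i _; rewrite linear_sum fct_sumE.
  by apply: eq_bigr => j _; rewrite linearZ.
move=> x; rewrite fE; apply: differentiable_continuous.
apply: differentiable_sum => i; apply: differentiable_sum => j.
by apply: differentiableZl; exact: differentiable_coord.
Qed.

Lemma linear_is_diff {a b} {W : normedModType R} (f : {linear 'M[R]_(a, b) -> W}) x :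
  is_diff x f f.
Proof.
have fc : continuous f by exact: linear_mx_continuous.
by apply: DiffDef; [exact: linear_differentiable|rewrite diff_lin].
Qed.

Lemma diff_sumE {m} {W : normedModType R} (f : 'rV[R]_m -> W) x h :
  'd f x h = \sum_(i < m) h 0 i *: 'd f x 'e_i.
Proof.
by rewrite {1}(row_sum_delta h) linear_sum; apply: eq_bigr => j _; rewrite linearZ.
Qed.

Lemma linfunE {m n} (f : {linear 'rV[R]_m -> 'rV[R]_n}) v : linfun f v = f v.
Proof. by rewrite lfunE. Qed.

Lemma is_diff_sum {V W : normedModType R} n (f df : 'I_n -> V -> W) x :
  (forall i, is_diff x (f i) (df i)) ->
  is_diff x (fun y => \sum_(i < n) f i y) (fun h => \sum_(i < n) df i h).
Proof.
move=> fdf.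
have E (g : 'I_n -> V -> W) : (fun y => \sum_(i < n) g i y) = \sum_(i < n) g i.
  by apply/funext => y; rewrite fct_sumE.
rewrite !E; elim/big_ind2 : _ => [|a b c d ab cd|i _] //.
- exact: is_diff_cst.
- exact: is_diffD.
Qed.

Lemma scale_is_bilinear (W : normedModType R) :
  bilinear_for
    (GRing.Scale.Law.clone _ _ *:%R _) (GRing.Scale.Law.clone _ _ *:%R _)
    (fun (a : R) (w : W) => a *: w).
Proof.
split=> [u'|u] a x y /=.
- by rewrite scalerDl scalerA.
- by rewrite scalerDr !scalerA mulrC.
Qed.

(** Scaling is a bounded bilinear map, so this is the Leibniz rule. *)
Lemma is_diffZ_fun {V W : normedModType R} (f df : V -> R) (g dg : V -> W) x :
  is_diff x f df -> is_diff x g dg ->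
  is_diff x (fun y => f y *: g y) (fun h => f x *: dg h + df h *: g x).
Proof.
move=> dfx dgx.
pose bM := bilinear_isBilinear.Build R R W W _ _ _ (@scale_is_bilinear W).
pose b : {bilinear R -> W -> W} := HB.pack (fun (a : R) (w : W) => a *: w) bM.
have bc : continuous (fun p : R * W => b p.1 p.2).
  by move=> p; exact: scale_continuous.
have bd : is_diff (f x, g x) (fun p : R * W => b p.1 p.2)
    (fun q => f x *: q.2 + q.1 *: g x).
  apply: DiffDef; first exact: differentiable_bilin.
  by rewrite diff_bilin.
exact: (@is_diff_comp _ _ _ _ (fun y => (f y, g y)) _
  (fun p : R * W => b p.1 p.2) _ x _ bd).
Qed.

End Differentials.

(** * Functions of class C^k *)

Section CkCalculus.
Context {R : realType}.

(** The predicate [Ck] for an arbitrary normed target, so that scalars, vectors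
and matrices share one calculus. *)
Fixpoint ck_on (m : nat) (W : normedModType R) (k : nat) (U : set 'rV[R]_m)
    (f : 'rV[R]_m -> W) : Prop :=
  if k is k'.+1 then
    (forall x, U x -> differentiable f x) /\ forall v, ck_on k' U ('D_v f)
  else forall x, U x -> {for x, continuous f}.

Lemma CkE m n k (U : set 'rV[R]_m) (f : 'rV[R]_m -> 'rV[R]_n) :
  Ck k U f <-> ck_on k U f.
Proof.
elim: k f => // k IH f /=; split=> -[df Df]; split=> // v; exact/IH.
Qed.

Definition cinfty_on m (W : normedModType R) (U : set 'rV[R]_m) (f : 'rV[R]_m -> W) :=
  forall k, ck_on k U f.

Lemma smooth_onE m n (U : set 'rV[R]_m) (f : 'rV[R]_m -> 'rV[R]_n) :
  smooth_on U f <-> cinfty_on U f.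
Proof. by split=> fU k; exact/CkE/fU. Qed.

Context {m : nat}.
Implicit Types (U : set 'rV[R]_m) (W : normedModType R).

Lemma ck_sub W k U U' (f : 'rV[R]_m -> W) : U' `<=` U -> ck_on k U f -> ck_on k U' f.
Proof.
move=> UU; elim: k f => [|k IH] f /= => [fc x /UU/fc //|[df Df]].
by split=> [x /UU/df //|v]; exact/IH.
Qed.

Lemma ck_ext W k U (f g : 'rV[R]_m -> W) : open U ->
  (forall x, U x -> f x = g x) -> ck_on k U f -> ck_on k U g.
Proof.
move=> oU; elim: k f g => [|k IH] f g fg /=.
  move=> fc x Ux.
  have nfg : {near x, f =1 g}.
    by apply: filterS (open_nbhs_nbhs (conj oU Ux)) => y /fg.
  rewrite /prop_for /continuous_at -fg//.
  by apply: cvg_trans (near_eq_cvg nfg) _; exact: fc.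
have near_fg x : U x -> {near x, f =1 g}.
  by move=> Ux; apply: filterS (open_nbhs_nbhs (conj oU Ux)) => y /fg.
move=> [df Df]; split=> [x Ux|v].
  by have [] := near_eq_is_diff (near_fg x Ux) (differentiableP (df x Ux)).
apply: IH (Df v) => x Ux.
exact/near_eq_derive/near_fg.
Qed.

Lemma ck_continuous W k U (f : 'rV[R]_m -> W) : ck_on k U f ->
  forall x, U x -> {for x, continuous f}.
Proof.
by case: k => [//|k] [df _] x /df; exact: differentiable_continuous.
Qed.

Lemma ckS W k U (f : 'rV[R]_m -> W) : ck_on k.+1 U f -> ck_on k U f.
Proof.
elim: k f => [|k IH] f; first by move=> /ck_continuous.
by move=> [df Df]; split=> // v; exact/IH/Df.
Qed.

Lemma ckD W k U (f g : 'rV[R]_m -> W) : open U ->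
  ck_on k U f -> ck_on k U g -> ck_on k U (fun x => f x + g x).
Proof.
move=> oU; elim: k f g => [|k IH] f g /=.
  by move=> fc gc x Ux; apply: continuousD; [exact: fc|exact: gc].
move=> [df Df] [dg Dg]; split=> [x Ux|v].
  by apply: differentiableD; [exact: df|exact: dg].
apply: ck_ext (IH _ _ (Df v) (Dg v)) => // x Ux.
by rewrite deriveD//; apply: diff_derivable; [exact: df|exact: dg].
Qed.

Lemma ck_cst W k U (c : W) : open U -> ck_on k U (fun=> c).
Proof.
move=> oU; elim: k c => [|k IH] c; first by move=> x _; exact: cst_continuous.
split=> [x _|v]; first exact: differentiable_cst.
by apply: ck_ext (IH 0) => // x Ux; rewrite derive_cst.
Qed.

Lemma ck_sum W k U n (f : 'I_n -> 'rV[R]_m -> W) : open U ->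
  (forall i, ck_on k U (f i)) -> ck_on k U (fun x => \sum_(i < n) f i x).
Proof.
move=> oU; elim: n f => [|n IH] f fU.
  by apply: ck_ext (ck_cst k 0 oU) => // x _; rewrite big_ord0.
apply: ck_ext (ckD oU (fU ord0) (IH _ (fun i => fU (lift ord0 i)))) => // x _.
by rewrite big_ord_recl.
Qed.

(** The Leibniz rule expresses the derivative through products of functions of
class C^k, which allows the induction on k. *)
Lemma ckZ W k U (f : 'rV[R]_m -> R) (g : 'rV[R]_m -> W) : open U ->
  ck_on k U f -> ck_on k U g -> ck_on k U (fun x => f x *: g x).
Proof.
move=> oU; elim: k f g => [|k IH] f g.
  by move=> fc gc x Ux; exact: cvgZ (fc x Ux) (gc x Ux).
move=> fU gU; have [df Df] := fU; have [dg Dg] := gU; split=> [x Ux|v].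
  by have [] := is_diffZ_fun (differentiableP (df x Ux)) (differentiableP (dg x Ux)).
apply: ck_ext (ckD oU (IH _ _ (ckS fU) (Dg v)) (IH _ _ (Df v) (ckS gU))) => // x Ux.
rewrite (is_diff_derive _ (is_diffZ_fun (differentiableP (df x Ux))
  (differentiableP (dg x Ux)))).
by rewrite !deriveE//; [exact: df|exact: dg].
Qed.

Lemma ckM k U (f g : 'rV[R]_m -> R) : open U ->
  ck_on k U f -> ck_on k U g -> ck_on k U (fun x => f x * g x).
Proof. exact: (@ckZ R). Qed.

Lemma ck_prod k U n (f : 'I_n -> 'rV[R]_m -> R) : open U ->
  (forall i, ck_on k U (f i)) -> ck_on k U (fun x => \prod_(i < n) f i x).
Proof.
move=> oU; elim: n f => [|n IH] f fU.
  by apply: ck_ext (@ck_cst R k U 1 oU) => // x _; rewrite big_ord0.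
apply: ck_ext (ckM oU (fU ord0) (IH _ (fun i => fU (lift ord0 i)))) => // x _.
by rewrite big_ord_recl.
Qed.

Lemma ck_lin W W' k U (l : {linear W -> W'}) (f : 'rV[R]_m -> W) : open U ->
  continuous l -> ck_on k U f -> ck_on k U (fun x => l (f x)).
Proof.
move=> oU lc; elim: k f => [|k IH] f.
  by move=> fc x Ux; apply: continuous_comp; [exact: fc|exact: lc].
move=> [df Df].
have lx y : is_diff y l l.
  by apply: DiffDef; [exact: linear_differentiable|rewrite diff_lin].
have dlf x : U x -> is_diff x (l \o f) (l \o 'd f x).
  by move=> Ux; have fx := differentiableP (df x Ux); exact: is_diff_comp.
split=> [x /dlf[]//|v].
apply: ck_ext (IH _ (Df v)) => // x Ux.
by rewrite (is_diff_derive _ (dlf x Ux)) /= deriveE//; exact: df.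
Qed.

(** Induction on k through (1/f)' = - (1/f)^2 f'. *)
Lemma ck_inv k U (f : 'rV[R]_m -> R) : open U -> (forall x, U x -> f x != 0) ->
  ck_on k U f -> ck_on k U (fun x => (f x)^-1).
Proof.
move=> oU f0; elim: k => [|k IH].
  by move=> fc x Ux; exact: cvgV (f0 x Ux) (fc x Ux).
move=> fU; have [df Df] := fU; have := IH (ckS fU) => iU.
split=> [x Ux|v].
  by apply: differentiableV; [exact: df|exact: f0].
have := ckM oU (@ck_cst R k U (-1) oU) (ckM oU (ckM oU iU iU) (Df v)).
apply: ck_ext => // x Ux.
have dfv : derivable f x v by exact/diff_derivable/df.
rewrite (@deriveV _ _ f x v (f0 x Ux) dfv) mulN1r scaleNr; congr (- _).
by rewrite -exprVn expr2.
Qed.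

Lemma ck_entry a b k U (f : 'rV[R]_m -> 'M[R]_(a, b)) i j : open U ->
  ck_on k U f -> ck_on k U (fun x => f x i j).
Proof.
move=> oU fU.
have @l : {linear 'M[R]_(a, b) -> R}.
  by exists (fun N : 'M[R]_(_, _) => N i j); do 2![eexists]; do ?[constructor];
     rewrite ?mxE// => ? *; rewrite ?mxE//; move=> ?; rewrite !mxE.
apply: (@ck_lin _ _ _ _ l) => //.
exact: coord_continuous.
Qed.

Lemma ck_mx a b k U (f : 'rV[R]_m -> 'M[R]_(a, b)) : open U ->
  (forall i j, ck_on k U (fun x => f x i j)) -> ck_on k U f.
Proof.
move=> oU fU.
have := ck_sum oU (fun i => ck_sum oU (fun j =>
  ckZ oU (fU i j) (ck_cst k (delta_mx i j) oU))).
by apply: ck_ext => // x _; rewrite [RHS]matrix_sum_delta.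
Qed.

Lemma ck_mulmx a b c k U (f : 'rV[R]_m -> 'M[R]_(a, b))
    (g : 'rV[R]_m -> 'M[R]_(b, c)) : open U ->
  ck_on k U f -> ck_on k U g -> ck_on k U (fun x => f x *m g x).
Proof.
move=> oU fU gU; apply: ck_mx => // i j.
have := ck_sum oU (fun l => ckM oU (ck_entry i l oU fU) (ck_entry l j oU gU)).
by apply: ck_ext => // x _; rewrite mxE.
Qed.

Lemma ck_det a k U (f : 'rV[R]_m -> 'M[R]_a) : open U ->
  ck_on k U f -> ck_on k U (fun x => \det (f x)).
Proof.
move=> oU fU.
have := ck_sum oU (fun i : 'I_#|{: 'S_a}| =>
  ckM oU (@ck_cst R k U ((-1) ^+ (enum_val i : 'S_a)) oU)
    (ck_prod oU (fun l => ck_entry l ((enum_val i : 'S_a) l) oU fU))).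
apply: ck_ext => // x _; rewrite /determinant.
by rewrite [RHS](reindex _ (onW_bij _ (enum_val_bij _))).
Qed.

(** Cramer's rule: the entries are cofactors divided by the determinant. *)
Lemma ck_invmx a k U (f : 'rV[R]_m -> 'M[R]_a) : open U ->
  (forall x, U x -> \det (f x) != 0) ->
  ck_on k U f -> ck_on k U (fun x => invmx (f x)).
Proof.
move=> oU f0 fU; apply: ck_mx => // i j.
have cU : ck_on k U (fun x => cofactor (f x) j i).
  have sgn := @ck_cst R k U ((-1) ^+ (j + i)) oU.
  apply: (ckM oU sgn); apply: ck_det => //; apply: ck_mx => // a1 a2.
  apply: ck_ext (ck_entry (lift j a1) (lift i a2) oU fU) => // x _.
  by rewrite !mxE.
apply: ck_ext (ckM oU (ck_inv oU f0 (ck_det oU fU)) cU) => // x Ux.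
by rewrite /invmx unitmxE unitfE f0// !mxE.
Qed.

Lemma ck_id k U : open U -> ck_on k U (@id 'rV[R]_m).
Proof.
move=> oU; case: k => [|k]; first by move=> x _; exact: cvg_id.
split=> // v; apply: ck_ext (ck_cst k v oU) => // x _.
by rewrite derive_id.
Qed.

End CkCalculus.

Section CkComp.
Context {R : realType} {m n : nat}.

(** By the chain rule, the derivative of f o g along v is the sum over i of
(D_v g)_i * (D_i f o g), to which the induction hypothesis applies. *)
Lemma ck_comp (W : normedModType R) k (U : set 'rV[R]_m) (V : set 'rV[R]_n)
    (g : 'rV[R]_m -> 'rV[R]_n) (f : 'rV[R]_n -> W) : open U ->
  (forall x, U x -> V (g x)) -> ck_on k U g -> ck_on k V f -> ck_on k U (f \o g).
Proof.
move=> oU UV; elim: k f => [|k IH] f.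
  move=> gc fc x Ux; apply: continuous_comp; first exact: gc.
  by apply: fc; exact: UV.
move=> gU fV; have [dg Dg] := gU; have [df Df] := fV.
have dfg x : U x -> is_diff x (f \o g) ('d f (g x) \o 'd g x).
  move=> Ux; have gx := differentiableP (dg x Ux).
  by have fx := differentiableP (df _ (UV x Ux)); exact: is_diff_comp.
split=> [x /dfg[]//|v].
have := ck_sum oU (fun i => ckZ oU (ck_entry 0 i oU (Dg v))
                            (IH _ (ckS gU) (Df 'e_i))).
apply: ck_ext => // x Ux; rewrite (is_diff_derive _ (dfg x Ux)) /=.
rewrite [RHS]diff_sumE; apply: eq_bigr => i _.
by rewrite !deriveE//; [exact: (df _ (UV x Ux))|exact: dg].
Qed.

End CkComp.

(** * Mean value estimates, symmetry of second derivatives, the Gronwall inequality *)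

Section MeanValue.
Context {R : realType}.

Lemma mx_norm_le a b (x : 'M[R]_(a, b)) M : 0 <= M ->
  (forall i j, `|x i j| <= M) -> `|x| <= M.
Proof.
move=> M0 xM; rewrite [leLHS]/Num.Def.normr/= mx_normrE.
by apply: bigmax_le => // -[i j] _ /=.
Qed.

Lemma rV_norm_le n (x : 'rV[R]_n) M : 0 <= M ->
  (forall j, `|x 0 j| <= M) -> `|x| <= M.
Proof. by move=> M0 xM; apply: mx_norm_le => // i j; rewrite ord1. Qed.

Lemma mx_entry_le a b (x : 'M[R]_(a, b)) i j : `|x i j| <= `|x|.
Proof.
rewrite [leRHS]/Num.Def.normr/= mx_normrE.
exact: (le_bigmax _ (fun i => `|x i.1 i.2|) (i, j)).
Qed.

Lemma mulmx_norm_le a b c (x : 'M[R]_(a, b)) (y : 'M[R]_(b, c)) :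
  `|x *m y| <= b%:R * `|x| * `|y|.
Proof.
apply: mx_norm_le => [|i j]; first by rewrite !mulr_ge0.
rewrite mxE; apply: le_trans (ler_norm_sum _ _ _) _.
apply: (@le_trans _ _ (\sum_(l < b) `|x| * `|y|)).
  by apply: ler_sum => l _; rewrite normrM ler_pM ?mx_entry_le.
by rewrite sumr_const card_ord -[leLHS]mulr_natl -mulrA.
Qed.

Lemma is_derive_entry {V : normedModType R} a b (c : V -> 'M[R]_(a, b)) t v dc
    i j :
  is_derive t v c dc -> is_derive t v (fun s => c s i j) (dc i j).
Proof.
move=> [ct <-]; apply: DeriveDef; first by move/derivable_mxP: ct; exact.
by rewrite (derive_mx ct) mxE.
Qed.

Lemma is_derive_mx {V : normedModType R} a b (c : V -> 'M[R]_(a, b)) t v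
    (dc : 'M[R]_(a, b)) :
  (forall i j, is_derive t v (fun s => c s i j) (dc i j)) -> is_derive t v c dc.
Proof.
move=> cd; have ct : derivable c t v.
  by apply/derivable_mxP => i j; have [] := cd i j.
apply: DeriveDef => //; rewrite (derive_mx ct); apply/matrixP => i j.
by rewrite mxE; have [_ ->] := cd i j.
Qed.

Lemma is_derive_mulmx2 {W : normedModType R} p q r (f : W -> 'M[R]_(p, q))
    (g : W -> 'M[R]_(q, r)) x z df dg :
  is_derive x z f df -> is_derive x z g dg ->
  is_derive x z (fun y => f y *m g y) (df *m g x + f x *m dg).
Proof.
move=> fd gd; apply: is_derive_mx => i j.
have -> : (fun y => (f y *m g y) i j) =
    \sum_(l < q) ((fun y => f y i l) * (fun y => g y l j)).
  by apply/funext => y; rewrite fct_sumE mxE.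
have -> : (df *m g x + f x *m dg) i j =
    \sum_(l < q) (f x i l *: dg l j + g x l j *: df i l).
  rewrite !mxE -big_split /=; apply: eq_bigr => l _.
  by rewrite addrC; congr (_ + _); rewrite mulrC.
by apply: is_derive_sum => l; apply: is_deriveM; exact: is_derive_entry.
Qed.

Lemma is_derive_mulmx p q r (A : 'M[R]_(p, q)) (c : R -> 'M[R]_(q, r)) (t : R) dc :
  is_derive t (1 : R) c dc ->
  is_derive t (1 : R) (fun s => A *m c s) (A *m dc).
Proof.
move=> cd; have := is_derive_mulmx2 (is_derive_cst A t (1 : R)) cd.
by rewrite mul0mx add0r.
Qed.

Lemma is_derive_mulmxr p q r (c : R -> 'M[R]_(p, q)) (A : 'M[R]_(q, r)) (t : R) dc :
  is_derive t (1 : R) c dc ->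
  is_derive t (1 : R) (fun s => c s *m A) (dc *m A).
Proof.
move=> cd; have := is_derive_mulmx2 cd (is_derive_cst A t (1 : R)).
by rewrite mulmx0 addr0.
Qed.

Lemma is_derive1_continuous {W : normedModType R} (f : R -> W) (t : R) df :
  is_derive t (1 : R) f df -> {for t, continuous f}.
Proof. by move=> [/derivable1_diffP/differentiable_continuous]. Qed.

Lemma is_derive1_within (f df : R -> R) (a b : R) :
  (forall t : R, a <= t <= b -> is_derive t (1 : R) f (df t)) ->
  {within `[a, b], continuous f}.
Proof.
move=> fd; apply: derivable_within_continuous => t; rewrite in_itv /= => tab.
by have [] := fd t tab.
Qed.

(** The norm is the maximum of the entries, so the scalar mean value theorem
applies to each entry separately. *)
Lemma curve_mean_value p q (c dc : R -> 'M[R]_(p, q)) (a b M : R) : a <= b ->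
  (forall t : R, a <= t <= b -> is_derive t (1 : R) c (dc t)) ->
  (forall t, a <= t <= b -> `|dc t| <= M) ->
  `|c b - c a| <= M * (b - a).
Proof.
move=> ab cd dcM.
have M0 : 0 <= M by apply: le_trans (dcM a _); rewrite ?lexx.
apply: mx_norm_le; first by rewrite mulr_ge0 ?subr_ge0.
move=> i j; have cdj t (tab : a <= t <= b) := is_derive_entry i j (cd t tab).
have [|t tab] := @MVT_segment R (fun s => c s i j) (fun s => dc s i j) a b ab _
    (is_derive1_within cdj).
  by move=> t; rewrite in_itv /= => /andP[at_ tb]; apply: cdj; rewrite !ltW.
rewrite !mxE => ->; rewrite normrM [`|b - a|]ger0_norm ?subr_ge0//.
rewrite ler_wpM2r ?subr_ge0//; apply: le_trans (mx_entry_le _ _ _) _.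
by apply: dcM; move: tab; rewrite in_itv.
Qed.

Lemma is_derive_scalel {W : normedModType R} (w : W) (t : R) :
  is_derive t (1 : R) (fun s : R => s *: w) w.
Proof.
have [dl dlE] := is_diff_scalel t w.
by apply: DeriveDef; [exact/derivable1_diffP|rewrite deriveE// dlE scale1r].
Qed.

Lemma is_derive_line {V W : normedModType R} (f : V -> W) x h (t : R) :
  differentiable f (x + t *: h) ->
  is_derive t 1 (fun s : R => f (x + s *: h)) ('d f (x + t *: h) h).
Proof.
move=> /differentiableP fd.
have ld : is_diff t (fun s : R => x + s *: h) (fun s : R => s *: h).
  have -> : (fun s : R => x + s *: h) = cst x + (fun s : R => s *: h) by [].
  have -> : (fun s : R => s *: h) = 0 + (fun s : R => s *: h) by rewrite add0r.
  apply: is_diffD; rewrite add0r; exact: is_diff_scalel.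
have [cd cE] : is_diff t (f \o (fun s : R => x + s *: h)) _ :=
  is_diff_comp ld fd.
apply: DeriveDef; first exact/derivable1_diffP.
by rewrite deriveE// cE /= scale1r.
Qed.

Lemma ball_segment {V : normedModType R} (x0 x y : V) r (t : R) :
  ball x0 r x -> ball x0 r y -> 0 <= t <= 1 -> ball x0 r (x + t *: (y - x)).
Proof.
rewrite -ball_normE /= => xr yr /andP[t0 t1].
have -> : x0 - (x + t *: (y - x)) = (1 - t) *: (x0 - x) + t *: (x0 - y).
  have -> : y - x = (x0 - x) - (x0 - y) by rewrite opprB [RHS]addrC subrKA.
  by rewrite opprD addrA scalerBr opprB scalerBl scale1r addrA addrAC.
apply: le_lt_trans (ler_normD _ _) _; rewrite !normrZ !ger0_norm ?subr_ge0//.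
case: (ltgtP t 0) t0 => // [t0|->] _; last by rewrite mul0r addr0 subr0 mul1r.
have -> : r = (1 - t) * r + t * r by rewrite -mulrDl subrK mul1r.
by rewrite ler_ltD// ?ltr_pM2l// ler_wpM2l ?subr_ge0// ltW.
Qed.

Lemma ball_mean_value m p q (f : 'rV[R]_m -> 'M[R]_(p, q)) x0 r M :
  (forall x, ball x0 r x -> differentiable f x) ->
  (forall x, ball x0 r x -> forall h, `|'d f x h| <= M * `|h|) ->
  forall x y, ball x0 r x -> ball x0 r y -> `|f y - f x| <= M * `|y - x|.
Proof.
move=> fd fM x y xr yr.
have := @curve_mean_value _ _ (fun s : R => f (x + s *: (y - x)))
  (fun s => 'd f (x + s *: (y - x)) (y - x)) 0 1 (M * `|y - x|) ler01.
rewrite scale0r addr0 scale1r subrKC subr0 mulr1; apply.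
- by move=> t t01; apply: is_derive_line; apply: fd; exact: ball_segment.
- by move=> t t01; apply: fM; exact: ball_segment.
Qed.

(** The partial derivatives are continuous, hence locally bounded, and the
differential is their linear combination. *)
Lemma ck1_diff_bounded m p q (U : set 'rV[R]_m) (f : 'rV[R]_m -> 'M[R]_(p, q)) x0 :
  open U -> U x0 -> ck_on 1 U f ->
  exists2 M, 0 <= M &
    \forall x \near x0, forall h, `|'d f x h| <= M * `|h|.
Proof.
move=> oU Ux0 [df Df].
have bnd (i : 'I_m) : \forall x \near x0,
    `|'D_('e_i) f x| <= `|'D_('e_i) f x0| + 1.
  have /cvgrPdist_le/(_ 1 ltr01) := Df 'e_i x0 Ux0.
  apply: filterS => x; rewrite distrC => dx.
  by rewrite -lerBlDl; apply: le_trans (lerB_dist _ _) dx.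
exists (\sum_(i < m) (`|'D_('e_i) f x0| + 1)).
  by apply: sumr_ge0 => i _; rewrite addr_ge0.
near=> x => h; rewrite diff_sumE.
have Ux : U x by near: x; exact: open_nbhs_nbhs.
have xM (i : 'I_m) : `|'d f x 'e_i| <= `|'D_('e_i) f x0| + 1.
  have : forall i : 'I_m, `|'D_('e_i) f x| <= `|'D_('e_i) f x0| + 1.
    by near: x; exact: filter_forall bnd.
  by move=> /(_ i); rewrite deriveE//; exact: df.
apply: le_trans (ler_norm_sum _ _ _) _; rewrite mulr_suml.
apply: ler_sum => i _; rewrite normrZ mulrC ler_pM ?mx_entry_le//.
Unshelve. all: by end_near. Qed.

(** The first derivative is Lipschitz on a small ball because its own partial
derivatives are bounded there; the mean value theorem along the segment from x
to y then bounds the remainder quadratically. *)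
Lemma ck2_taylor m p q (U : set 'rV[R]_m) (f : 'rV[R]_m -> 'M[R]_(p, q)) x0 :
  open U -> U x0 -> ck_on 2 U f ->
  exists M r, [/\ 0 <= M, 0 < r, ball x0 r `<=` U,
    (forall x, ball x0 r x -> forall h, `|'d f x h| <= M * `|h|) &
    (forall x y, ball x0 r x -> ball x0 r y ->
      `|f y - f x - 'd f x (y - x)| <= M * `|y - x| ^+ 2)].
Proof.
move=> oU Ux0 fU; have [df Df] := fU.
have [M0 M00 fM0] := ck1_diff_bounded oU Ux0 (ckS fU).
have /choice[M2 M2P] : forall i : 'I_m, exists M, 0 <= M /\
    \forall x \near x0, forall h, `|'d ('D_'e_i f) x h| <= M * `|h|.
  by move=> i; have [M ? ?] := ck1_diff_bounded oU Ux0 (Df 'e_i); exists M.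
pose M1 := \sum_(i < m) M2 i.
have M10 : 0 <= M1 by apply: sumr_ge0 => i _; have [] := M2P i.
have : \forall x \near x0, [/\ U x, forall h, `|'d f x h| <= M0 * `|h| &
    forall i h, `|'d ('D_'e_i f) x h| <= M2 i * `|h| ].
  near=> x; split.
  - by near: x; exact: open_nbhs_nbhs.
  - by near: x.
  - by near: x; exact: filter_forall (fun i => (M2P i).2).
move=> /nbhs_ballP[r r0 rP].
have rU x : ball x0 r x -> U x by move=> /rP[].
have dlip x y h : ball x0 r x -> ball x0 r y ->
    `|'d f y h - 'd f x h| <= M1 * `|y - x| * `|h|.
  move=> xr yr; rewrite [X in `|X - _|]diff_sumE [X in `|_ - X|]diff_sumE -sumrB.
  apply: le_trans (ler_norm_sum _ _ _) _; rewrite !mulr_suml.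
  apply: ler_sum => i _; rewrite -scalerBr normrZ mulrC ler_pM ?mx_entry_le//.
  have : `|'D_('e_i) f y - 'D_('e_i) f x| <= M2 i * `|y - x|; last first.
    by rewrite !deriveE//; [exact/df/rU|exact/df/rU].
  apply: (@ball_mean_value _ _ _ ('D_'e_i f) x0 r (M2 i)) => // z zr.
    by have [dDf _] := Df 'e_i; exact/dDf/rU.
  by have [_ _ +] := rP z zr; exact.
exists (M0 + M1), r; split=> //; first by rewrite addr_ge0.
  move=> x xr h; have [_ fx _] := rP x xr.
  by apply: le_trans (fx h) _; rewrite ler_wpM2r// lerDl.
move=> x y xr yr.
pose c (s : R) := f (x + s *: (y - x)) - s *: 'd f x (y - x).
have cd (t : R) : 0 <= t <= 1 -> is_derive t (1 : R) c
    ('d f (x + t *: (y - x)) (y - x) - 'd f x (y - x)).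
  move=> t01; apply: is_deriveB.
    by apply: is_derive_line; apply/df/rU; exact: ball_segment.
  exact: is_derive_scalel.
have := curve_mean_value ler01 cd.
move=> /(_ ((M0 + M1) * `|y - x| ^+ 2)); rewrite /c subr0 mulr1 !scale1r !scale0r.
rewrite addr0 subr0 subrKC addrAC; apply=> t t01.
apply: le_trans (dlip _ _ _ xr (ball_segment xr yr t01)) _.
rewrite [x + _]addrC addrK expr2 mulrA ler_wpM2r// ler_pM ?lerDr//.
rewrite normrZ; have /andP[t0 t1] := t01; rewrite ger0_norm//.
by rewrite -[leRHS]mul1r ler_wpM2r.
Unshelve. all: by end_near. Qed.

(** The second difference is the increment over [0, s] of
t |-> f (x + s u + t v) - f (x + t v); its derivative in t is estimated by the
differentiability of D_v f at x. *)
Lemma second_difference m p q (U : set 'rV[R]_m) (f : 'rV[R]_m -> 'M[R]_(p, q)) (x u v : 'rV[R]_m) :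
  open U -> U x -> (forall y, U y -> differentiable f y) ->
  differentiable ('D_v f) x -> forall e, 0 < e ->
  exists2 d, 0 < d & forall s, 0 < s < d ->
   `|f (x + s *: u + s *: v) - f (x + s *: u) - f (x + s *: v) + f x
      - s ^+ 2 *: 'd ('D_v f) x u| <= e * s ^+ 2.
Proof.
move=> oU Ux df dF e e0.
have /nbhs_ballP[r /= r0 rU] : nbhs x U by exact: open_nbhs_nbhs.
pose C := `|u| + `|v| + 1.
have C0 : 0 < C by rewrite /C ltr_wpDl// addr_ge0.
have e'0 : 0 < e / (2 * C) by rewrite divr_gt0// mulr_gt0.
have /nbhs_ballP[d1 /= d10 Fexp] := differentiable_expansion dF e'0.
exists (Num.min r d1 / C); first by rewrite divr_gt0// lt_min r0.
move=> s /andP[s0]; rewrite ltr_pdivlMr// lt_min => /andP[sr sd].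
have small (a b : R) : 0 <= a <= s -> 0 <= b <= s -> `|a *: u + b *: v| <= s * C.
  move=> /andP[a0 as_] /andP[b0 bs].
  apply: le_trans (ler_normD _ _) _; rewrite !normrZ !ger0_norm// /C !mulrDr.
  by rewrite mulr1 -[leLHS]addr0; apply: lerD (ltW s0); rewrite lerD// ler_wpM2r.
have bx (a b : R) : 0 <= a <= s -> 0 <= b <= s -> ball x r (x + (a *: u + b *: v)).
  move=> ha hb; rewrite -ball_normE /= opprD addrA subrr sub0r normrN.
  exact: le_lt_trans (small _ _ ha hb) sr.
have ss : 0 <= s <= s by apply/andP; split; [exact: ltW|exact: lexx].
have s0s : (0 : R) <= 0 <= s by apply/andP; split; [exact: lexx|exact: ltW].
pose c (t : R) := f ((x + s *: u) + t *: v) - f (x + t *: v)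
                  - t *: (s *: 'd ('D_v f) x u).
pose dc (t : R) := 'd f ((x + s *: u) + t *: v) v - 'd f (x + t *: v) v
                  - (s *: 'd ('D_v f) x u).
have U1 t : 0 <= t <= s -> U (x + s *: u + t *: v).
  by move=> ts; apply: rU; rewrite -addrA; exact: bx.
have U2 t : 0 <= t <= s -> U (x + t *: v).
  by move=> ts; apply: rU; have := bx 0 t s0s ts; rewrite scale0r add0r.
have cd (t : R) : 0 <= t <= s -> is_derive t (1 : R) c (dc t).
  move=> ts; apply: is_deriveB; first apply: is_deriveB.
  - by apply: is_derive_line; exact/df/U1.
  - by apply: is_derive_line; exact/df/U2.
  exact: is_derive_scalel.
have := curve_mean_value (ltW s0) cd; move=> /(_ (e * s)).
rewrite /c subr0 scale0r !addr0 scale0r subr0 scalerA -expr2 -mulrA -expr2.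
set A := f (x + s *: u + s *: v); set B := f (x + s *: u).
set D := f (x + s *: v); set L := _ *: _.
have -> : A - D - L - (B - f x) = A - B - D + f x - L.
  by apply/matrixP => i j; rewrite !mxE; ring.
apply=> t ts.
have F1 := Fexp (s *: u + t *: v); have F2 := Fexp (t *: v).
suff : `|'D_v f (x + s *: u + t *: v) - 'D_v f (x + t *: v)
    - s *: 'd ('D_v f) x u| <= e * s.
  by rewrite !(deriveE v)//; [exact/df/U2|exact/df/U1].
have E1 : x + s *: u + t *: v = s *: u + t *: v + x by rewrite -addrA addrC.
have E2 : x + t *: v = t *: v + x by rewrite addrC.
have L1 : 'd ('D_v f) x (s *: u + t *: v)
    = s *: 'd ('D_v f) x u + 'd ('D_v f) x (t *: v).
  by rewrite linearD linearZ.
rewrite L1 in F1; rewrite E1 E2.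
have split_le (a b z l1 l2 : 'M[R]_(p, q)) : `|a - b - l1| <=
    `|a - z - (l1 + l2)| + `|b - z - l2|.
  have -> : a - b - l1 = (a - z - (l1 + l2)) - (b - z - l2).
    by apply/matrixP => i j; rewrite !mxE; ring.
  exact: ler_normB.
have sb : `|s *: u + t *: v| <= s * C by apply: small.
have tb : `|t *: v| <= s * C by have := small 0 t s0s ts; rewrite scale0r add0r.
apply: le_trans (split_le _ _ ('D_v f x) _ ('d ('D_v f) x (t *: v))) _.
have -> : e * s = e / (2 * C) * (s * C) + e / (2 * C) * (s * C).
  by field; rewrite gt_eqF.
apply: lerD.
  apply: le_trans (F1 _) _; last by rewrite ler_wpM2l// ltW.
  by rewrite -ball_normE /= sub0r normrN (le_lt_trans sb).
apply: le_trans (F2 _) _; last by rewrite ler_wpM2l// ltW.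
by rewrite -ball_normE /= sub0r normrN (le_lt_trans tb).
Qed.

(** The second difference is symmetric in u and v, and divided by s^2 it tends to
either mixed derivative. *)
Lemma derive_schwarz m p q (U : set 'rV[R]_m) (f : 'rV[R]_m -> 'M[R]_(p, q)) (x u v : 'rV[R]_m) :
  open U -> U x -> ck_on 2 U f -> 'D_u ('D_v f) x = 'D_v ('D_u f) x.
Proof.
move=> oU Ux [df Df].
have dDf w : differentiable ('D_w f) x by have [+ _] := Df w; exact.
rewrite !deriveE//; apply/eqP; rewrite -subr_eq0 -normr_le0.
apply/ler_addgt0Pl => e e0; rewrite addr0.
have e20 : 0 < e / 2 by rewrite divr_gt0.
have [d1 d10 H1] := @second_difference _ _ _ U f x u v oU Ux df (dDf v) _ e20.
have [d2 d20 H2] := @second_difference _ _ _ U f x v u oU Ux df (dDf u) _ e20.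
pose s := Num.min d1 d2 / 2.
have s0 : 0 < s by rewrite divr_gt0// lt_min d10.
have s1 : 0 < s < d1.
  by rewrite s0 ltr_pdivrMr// (@le_lt_trans _ _ d1) ?ge_min ?lexx// ltr_pMr// ltr1n.
have s2 : 0 < s < d2.
  by rewrite s0 ltr_pdivrMr// (@le_lt_trans _ _ d2) ?ge_min ?lexx ?orbT// ltr_pMr// ltr1n.
have s20 : 0 < s ^+ 2 by rewrite exprn_gt0.
(* the inequality is multiplied by s^2 to match the second differences *)
rewrite -(ler_pM2l s20) -[X in X * `|_|](ger0_norm (ltW s20)) -normrZ.
have h1 := H1 s s1; have := H2 s s2; rewrite [x + _ + s *: u]addrAC => h2.
have diff_le (A B : 'M[R]_(p, q)) :
    `|f (x + s *: u + s *: v) - f (x + s *: u) - f (x + s *: v) + f x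
      - s ^+ 2 *: A| <= e / 2 * s ^+ 2 ->
    `|f (x + s *: u + s *: v) - f (x + s *: v) - f (x + s *: u) + f x
      - s ^+ 2 *: B| <= e / 2 * s ^+ 2 -> `|s ^+ 2 *: (A - B)| <= s ^+ 2 * e.
  move=> hA hB; have -> : s ^+ 2 *: (A - B) =
      (f (x + s *: u + s *: v) - f (x + s *: v) - f (x + s *: u) + f x
        - s ^+ 2 *: B) -
      (f (x + s *: u + s *: v) - f (x + s *: u) - f (x + s *: v) + f x
        - s ^+ 2 *: A).
    by apply/matrixP => i j; rewrite !mxE; ring.
  apply: le_trans (ler_normB _ _) _; apply: le_trans (lerD hB hA) _.
  by rewrite -mulrDl -splitr mulrC.
exact: diff_le h1 h2.
Qed.

End MeanValue.

Section Gronwall.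
Context {R : realType}.

(** The function (g + c) exp (- a t) is nonincreasing. *)
Lemma gronwall_real (g dg : R -> R) (a c : R) :
  (forall t : R, 0 <= t <= 1 -> is_derive t (1 : R) g (dg t)) ->
  (forall t, 0 <= t <= 1 -> dg t <= a * (g t + c)) ->
  g 0 = 0 -> forall t, 0 <= t <= 1 -> g t + c <= c * expR (a * t).
Proof.
move=> gd dgle g0 t /andP[t0 t1].
pose p (s : R) := (g s + c) * expR (- a * s).
have pd (s : R) : 0 <= s <= 1 ->
    is_derive s (1 : R) p ((dg s - a * (g s + c)) * expR (- a * s)).
  move=> s01; have gs := gd s s01.
  have ms : is_derive s (1 : R) (fun s => - a * s) (- a).
    have := @is_deriveZ R R R id (- a) s (1 : R) 1 (is_derive_id _ _).
    by rewrite [_ *: 1]mulr1.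
  have es : is_derive s (1 : R) (fun s => expR (- a * s)) (- a * expR (- a * s)).
    have := @is_derive1_comp R expR (fun s => - a * s) s _ _ (is_derive_expR _) ms.
    by rewrite mulrC.
  have cs : is_derive s (1 : R) (fun s => g s + c) (dg s).
    by have := is_deriveD gs (is_derive_cst c s (1 : R)); rewrite addr0.
  have := is_deriveM cs es.
  move=> H; apply: is_derive_eq H _; rewrite /GRing.scale /=; ring.
have pc : {within `[0, t], continuous p}.
  apply: is_derive1_within => s /andP[s0 st]; apply: pd.
  by rewrite s0 (le_trans st).
have [|s st] := @MVT_segment R p
    (fun s => (dg s - a * (g s + c)) * expR (- a * s)) 0 t t0 _ pc.
  move=> s; rewrite in_itv /= => /andP[s0 st]; apply: pd.
  by rewrite (ltW s0) (le_trans (ltW st)).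
rewrite subr0 => pE; move: st; rewrite in_itv /= => /andP[s0 st].
have : p t <= p 0.
  rewrite -subr_le0 pE mulr_le0_ge0// mulr_le0_ge0 ?expR_ge0//.
  by rewrite subr_le0 dgle// s0 (le_trans st).
rewrite /p g0 add0r mulr0 expR0 mulr1 mulNr expRN => H.
by rewrite -ler_pdivrMr ?expR_gt0.
Qed.

(** The norm is not differentiable, hence the passage through the sum of the
squares of the coordinates, which dominates the square of the norm. *)
Lemma gronwall n (D dD : R -> 'rV[R]_n) (K e : R) : 0 <= K -> 0 <= e ->
  (forall t : R, 0 <= t <= 1 -> is_derive t (1 : R) D (dD t)) ->
  (forall t, 0 <= t <= 1 -> `|dD t| <= K * `|D t| + e) ->
  D 0 = 0 ->
  forall t, 0 <= t <= 1 -> `|D t| <= e * expR (n%:R * (2 * K + 1) + 1).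
Proof.
move=> K0 e0 Dd dDle D0 t t01.
set a := n%:R * (2 * K + 1) + 1.
pose g (s : R) : R := \sum_(j < n) (D s 0 j) ^+ 2.
pose dg (s : R) : R := \sum_(j < n) 2 * (D s 0 j * dD s 0 j).
have a0 : 0 <= a by rewrite addr_ge0// mulr_ge0// addr_ge0// mulr_ge0.
have g0 s : 0 <= g s by apply: sumr_ge0 => j _; rewrite sqr_ge0.
have Dg s : `|D s| ^+ 2 <= g s.
  rewrite -[leRHS]sqr_sqrtr// lerXn2r ?nnegrE ?sqrtr_ge0//.
  apply: rV_norm_le => [|j]; first exact: sqrtr_ge0.
  rewrite -sqrtr_sqr ler_wsqrtr// /g (bigD1 j)//= lerDl.
  by apply: sumr_ge0 => i _; rewrite sqr_ge0.
have gd (s : R) : 0 <= s <= 1 -> is_derive s (1 : R) g (dg s).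
  move=> s01.
  have -> : g = \sum_(j < n) (fun s => (D s 0 j) ^+ 2).
    by apply/funext => z; rewrite fct_sumE.
  apply: is_derive_sum => j; have Dj := is_derive_entry 0 j (Dd s s01).
  have H := is_deriveX 2 Dj.
  apply: is_derive_eq H _; rewrite /GRing.scale /=; ring.
have dgle s : 0 <= s <= 1 -> dg s <= a * (g s + e ^+ 2).
  move=> s01.
  apply: (@le_trans _ _ (\sum_(j < n) ((2 * K + 1) * g s + e ^+ 2))).
    apply: ler_sum => j _; apply: le_trans (ler_norm _) _.
    rewrite !normrM (ger0_norm (ler0n _ 2)).
    apply: (@le_trans _ _ (2 * (`|D s| * (K * `|D s| + e)))).
      rewrite ler_pM2l// ler_pM// ?mx_entry_le//.
      by apply: le_trans (mx_entry_le _ _ _) (dDle s s01).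
    have H := Dg s; have H2 := sqr_ge0 (`|D s| - e).
    have H3 := ler_wpM2l K0 H; nra.
  rewrite sumr_const card_ord -mulr_natl /a.
  have H1 := g0 s; have H2 := sqr_ge0 e; have H3 : 0 <= n%:R :> R by [].
  have H4 : 0 <= n%:R * K * e ^+ 2 by rewrite !mulr_ge0.
  nra.
have gz : g 0 = 0 by rewrite /g big1// => j _; rewrite D0 mxE expr0n.
have gt := gronwall_real gd dgle gz t01.
have e1 : 1 <= expR a by rewrite -expR0 ler_expR.
have et : expR (a * t) <= expR a.
  by rewrite ler_expR -[leRHS]mulr1 ler_wpM2l//; case/andP: t01.
rewrite -(@ler_pXn2r _ 2) ?nnegrE ?mulr_ge0 ?expR_ge0//.
apply: le_trans (Dg t) _; rewrite exprMn.
apply: (@le_trans _ _ (e ^+ 2 * expR (a * t))).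
  by apply: le_trans gt; rewrite lerDl sqr_ge0.
rewrite ler_wpM2l ?sqr_ge0// expr2; apply: le_trans et _.
by rewrite -[leLHS]mulr1 ler_wpM2l// expR_ge0.
Qed.

End Gronwall.

(** * Picard iteration *)

Section Clamp.
Context {R : realType}.

(** Truncation makes a vector field given on a box globally Lipschitz, so that
Picard iteration need not keep track of domains. *)
Definition clamp (a b x : R) : R := Num.max a (Num.min b x).

Lemma clamp_lipschitz a b x y : `|clamp a b x - clamp a b y| <= `|x - y|.
Proof.
have [N NE] : exists N : R, N = `|x - y| by exists `|x - y|.
rewrite -NE; have h1 : x - y <= N by rewrite NE ler_norm.
have h2 : y - x <= N by rewrite NE distrC ler_norm.
rewrite ler_norml /clamp !maxEle !minEle.
by case: (leP b x) => ?; case: (leP b y) => ?; do ![case: (leP a _) => ?];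
  apply/andP; split; lra.
Qed.

Lemma clamp_in a b x : a <= b -> a <= clamp a b x <= b.
Proof.
move=> ab; rewrite /clamp le_max lexx /= ge_max ab /= ge_min lexx //.
Qed.

Lemma clamp_id a b x : a <= x <= b -> clamp a b x = x.
Proof.
by move=> /andP[ax xb]; rewrite /clamp (min_idPr xb) (max_idPr ax).
Qed.

End Clamp.

Section Primitive.
Context {R : realType}.

Lemma local_primitive (f : R -> R) : continuous f -> forall a t : R, - a < t < a ->
  is_derive t (1 : R) (parameterized_integral lebesgue_measure (- a) ^~ f) (f t).
Proof.
move=> fc a t /andP[at_ ta].
have fi : lebesgue_measure.-integrable `[- a, a] (EFin \o f).
  apply: continuous_compact_integrable; first exact: segment_compact.
  exact: continuous_subspaceT.
have [fd fE] := continuous_FTC1_closed ta fi at_ (fc t).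
apply: DeriveDef; first exact: fd.
by rewrite -derive1E; exact: fE.
Qed.

Lemma zero_derive_eq (h : R -> R) (a b : R) : a <= b ->
  (forall t : R, a <= t <= b -> is_derive t (1 : R) h 0) -> h b = h a.
Proof.
move=> ab hd; have [|t _] := @MVT_segment R h (fun=> 0) a b ab _
    (@is_derive1_within R h (fun=> 0) a b hd).
  by move=> t; rewrite in_itv /= => /andP[? ?]; apply: hd; rewrite !ltW.
by rewrite mul0r => /eqP; rewrite subr_eq0 => /eqP.
Qed.

(** Integration from a fixed lower bound only reaches to one side, so integrals
from - a to t are used for growing a; they differ by constants. *)
Lemma primitive (f : R -> R) : continuous f ->
  exists2 F : R -> R, F 0 = 0 & forall t, is_derive t (1 : R) F (f t).
Proof.
move=> fc.
pose G a t := parameterized_integral lebesgue_measure (- a) t f.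
have Gd (a t : R) : - a < t < a -> is_derive t (1 : R) (G a) (f t).
  exact: local_primitive.
have Geq (a b t : R) : - a < t < a -> a <= b -> G a t - G a 0 = G b t - G b 0.
  move=> /andP[at_ ta] ab.
  have a0 : 0 < a by lra.
  have hd (s : R) : - a < s < a -> is_derive s (1 : R) (fun s => G a s - G b s) 0.
    move=> /andP[s1 s2]; have g1 : is_derive s (1 : R) (G a) (f s).
      by apply: Gd; rewrite s1.
    have g2 : is_derive s (1 : R) (G b) (f s) by apply: Gd; lra.
    by apply: is_derive_eq (is_deriveB g1 g2) _; rewrite subrr.
  suff : G a t - G b t = G a 0 - G b 0 by lra.
  have [t0|t0] := leP 0 t.
    by apply: (zero_derive_eq (h := fun s => G a s - G b s)) => // s /andP[? ?]; apply: hd; lra.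
  by apply/esym; apply: (zero_derive_eq (h := fun s => G a s - G b s)) => [|s /andP[? ?]]; [exact: ltW|apply: hd; lra].
exists (fun t => G (`|t| + 1) t - G (`|t| + 1) 0); first by rewrite subrr.
move=> t; pose a := `|t| + 2.
apply: (@near_eq_is_derive _ _ _ (fun s => G a s - G a 0)) => //.
  near=> s; apply/esym; apply: Geq.
    by have := ler_norm s; have := ler_norm (- s); rewrite normrN; lra.
  have : `|s - t| < 1.
    near: s; apply/nbhs_ballP; exists 1 => //= s; rewrite -ball_normE /=.
    by rewrite distrC.
  have := ler_dist_dist s t; have := ler_norm (`|s| - `|t|); rewrite /a; lra.
have at_ : - a < t < a.
  by have := ler_norm t; have := ler_norm (- t); rewrite /a normrN; lra.
have := is_deriveB (Gd _ _ at_) (is_derive_cst (G a 0) t (1 : R)).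
by rewrite subr0.
Unshelve. all: by end_near. Qed.

Lemma primitive_rV n (f : R -> 'rV[R]_n) : continuous f ->
  exists2 F : R -> 'rV[R]_n, F 0 = 0 & forall t, is_derive t (1 : R) F (f t).
Proof.
move=> fc.
have /choice[F FP] : forall j : 'I_n, exists F : R -> R, F 0 = 0 /\
    forall t, is_derive t (1 : R) F (f t 0 j).
  move=> j; have [|F F0 Fd] := @primitive (fun t => f t 0 j).
    move=> t; apply: (@continuous_comp _ _ _ f (fun M : 'rV[R]_n => M 0 j)).
      exact: fc.
    exact: coord_continuous.
  by exists F.
exists (fun t => \row_j F j t).
  by apply/rowP => j; rewrite !mxE; have [] := FP j.
move=> t; apply: is_derive_mx => i j; rewrite ord1.
have -> : (fun s => (\row_j0 F j0 s) 0 j) = F j by apply/funext => s; rewrite mxE.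
by have [] := FP j.
Qed.

End Primitive.

Section Picard.
Context {R : realType}.

Lemma curve_mean_value_abs n (c dc : R -> 'rV[R]_n) (T M : R) :
  (forall t : R, `|t| <= T -> is_derive t (1 : R) c (dc t)) ->
  (forall t, `|t| <= T -> `|dc t| <= M) ->
  forall t, `|t| <= T -> `|c t - c 0| <= M * `|t|.
Proof.
move=> cd dcM t tT; have [t0|t0] := leP 0 t.
  rewrite ger0_norm// -[X in M * X](subr0 t).
  apply: curve_mean_value => // s /andP[s0 st]; [apply: cd|apply: dcM];
  by rewrite ger0_norm// (le_trans st)// -(ger0_norm t0).
rewrite distrC ltr0_norm// -[X in M * X]sub0r.
have sT s : t <= s <= 0 -> `|s| <= T.
  by move=> /andP[ts s0]; apply: le_trans tT; rewrite !ler0_norm ?lerN2// ltW.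
apply: curve_mean_value => [|s /sT|s /sT]; [exact: ltW|exact: cd|exact: dcM].
Qed.

Lemma half_expr_le0 (x C : R) : (forall j, x <= C * 2^-1 ^+ j) -> x <= 0.
Proof.
move=> xC; rewrite leNgt; apply/negP => x0.
have h1 : `|2^-1 : R| < 1 by rewrite ger0_norm// invf_lt1// ltr1n.
have /cvgrPdist_lt/(_ x x0)[N _ /(_ N (leqnn N))] := cvg_geometric C h1.
rewrite /= sub0r normrN => /(le_lt_trans (ler_norm _)).
by rewrite ltNge xC.
Qed.

(** The sequence is Cauchy since its increments are bounded by a geometric
series. *)
Lemma geometric_cvg n (u : nat -> 'rV[R]_n) (A : R) :
  (forall j, `|u j.+1 - u j| <= A * 2^-1 ^+ j) ->
  exists l, forall j, `|u j - l| <= 2 * A * 2^-1 ^+ j.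
Proof.
move=> uA.
have A0 : 0 <= A by have := uA 0%N; rewrite expr0 mulr1; exact: le_trans.
have uB j p : `|u (j + p)%N - u j| <= 2 * A * (2^-1 ^+ j - 2^-1 ^+ (j + p)).
  elim: p => [|p IH]; first by rewrite addn0 !subrr normr0 mulr0.
  rewrite addnS -(subrKA (u (j + p)%N)).
  apply: le_trans (ler_normD _ _) _; apply: le_trans (lerD (uA _) IH) _.
  by rewrite exprS le_eqVlt; apply/orP; left; apply/eqP; field.
have uC j i : (j <= i)%N -> `|u i - u j| <= 2 * A * 2^-1 ^+ j.
  move=> /subnKC <-; apply: le_trans (uB _ _) _.
  by rewrite ler_wpM2l ?mulr_ge0// gerBl exprn_ge0.
have small e : 0 < e -> exists j, 2 * A * 2^-1 ^+ j < e.
  move=> e0; apply/not_existsP => H.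
  suff : e <= 0 by rewrite leNgt e0.
  by apply: (@half_expr_le0 e (2 * A)) => j; rewrite leNgt; apply/negP/H.
have /cauchy_cvgP/cvg_ex[l ul] : cauchy (u @ \oo).
  apply: cauchy_exP => e /small[j je]; exists (u j); exists j => // i /= ji.
  by rewrite -ball_normE /= distrC; exact: le_lt_trans (uC _ _ ji) je.
exists l => j; apply/ler_addgt0Pr => e e0.
have /cvgrPdist_lt/(_ e e0)[N _ ulN] := ul.
have := ulN (maxn N j) (leq_maxl _ _); rewrite distrC => /ltW /= h.
rewrite -(subrKA (u (maxn N j))); apply: le_trans (ler_normD _ _) _.
by apply: lerD h; rewrite distrC; apply: uC; exact: leq_maxr.
Qed.

Lemma lipschitz_continuous n m (F : 'rV[R]_n -> 'rV[R]_m) (K : R) :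
  (forall x y, `|F x - F y| <= K * `|x - y|) -> continuous F.
Proof.
move=> FK x; apply: (@cvgrPdist_lt _ _ _ (nbhs x) _ F (F x)).2 => e e0.
have K1 : 0 < `|K| + 1 by rewrite ltr_wpDl.
have d0 : 0 < e / (`|K| + 1) by rewrite divr_gt0.
apply/nbhs_ballP; exists (e / (`|K| + 1)) => //= y; rewrite -ball_normE /=.
rewrite ltr_pdivlMr// mulrC => xy; apply: le_lt_trans (FK x y) _.
apply: le_lt_trans xy; rewrite ler_wpM2r//.
by apply: le_trans (ler_norm K) _; rewrite lerDl.
Qed.

(** Each Picard step integrates F along the previous curve. With a Lipschitz
constant 1/4 and |t| <= 2 the step contracts by 1/2, so the iterates converge
uniformly and the limit satisfies the integral equation. *)
Lemma picard n (F : 'rV[R]_n -> 'rV[R]_n) (y0 : 'rV[R]_n) :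
  (forall x y, `|F x - F y| <= 4^-1 * `|x - y|) ->
  exists2 w : R -> 'rV[R]_n, w 0 = y0 &
    forall t : R, `|t| <= 2 -> is_derive t (1 : R) w (F (w t)).
Proof.
move=> Flip; have Fc := lipschitz_continuous Flip.
have /choice[prim primP] : forall f : R -> 'rV[R]_n, exists G : R -> 'rV[R]_n,
    continuous f -> G 0 = 0 /\ forall t : R, is_derive t (1 : R) G (f t).
  move=> f; have [fc|nfc] := pselect (continuous f); last by exists f.
  by have [G G0 Gd] := primitive_rV fc; exists G.
pose step (f : R -> 'rV[R]_n) (t : R) := y0 + prim (F \o f) t.
have stepP f : continuous f -> step f 0 = y0 /\
    forall t : R, is_derive t (1 : R) (step f) (F (f t)).
  move=> fc; have [|G0 Gd] := primP (F \o f).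
    by move=> t; apply: continuous_comp; [exact: fc|exact: Fc].
  split=> [|t]; first by rewrite /step G0 addr0.
  have := is_deriveD (is_derive_cst y0 t (1 : R)) (Gd t).
  by rewrite add0r.
pose w j := iter j step (cst y0).
have wc j : continuous (w j).
  elim: j => [|j IH]; first exact: cst_continuous.
  move=> t; have [_ /(_ t)] := stepP _ IH.
  exact: is_derive1_continuous.
have w0 j : w j 0 = y0 by case: j => [//|j]; have [] := stepP _ (wc j).
have wd j (t : R) : is_derive t (1 : R) (w j.+1) (F (w j t)).
  by have [_] := stepP _ (wc j); exact.
pose A := 2 * `|F y0|.
have wA j (t : R) : `|t| <= 2 -> `|w j.+1 t - w j t| <= A * 2^-1 ^+ j.
  elim: j t => [|j IH] t t2.
    rewrite expr0 mulr1 (_ : w 0%N t = w 1%N 0); last by rewrite w0.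
    apply: le_trans (curve_mean_value_abs (fun s _ => wd 0%N s) (M := `|F y0|) _ t2) _.
      by [].
    by rewrite mulrC /A ler_wpM2r.
  have dd (s : R) : `|s| <= 2 -> is_derive s (1 : R) (fun s => w j.+2 s - w j.+1 s)
      (F (w j.+1 s) - F (w j s)).
    by move=> _; exact: is_deriveB.
  have := curve_mean_value_abs dd (M := 4^-1 * (A * 2^-1 ^+ j)) _ t2.
  rewrite !w0 subrr subr0 => H; apply: le_trans (H _) _.
    by move=> s s2; apply: le_trans (Flip _ _) _; rewrite ler_wpM2l// IH.
  rewrite exprS; have A0 : 0 <= A * 2^-1 ^+ j by rewrite !mulr_ge0.
  have : 4^-1 * (A * 2^-1 ^+ j) * `|t| <= 4^-1 * (A * 2^-1 ^+ j) * 2.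
    by rewrite ler_wpM2l// mulr_ge0.
  by lra.
have /choice[l lP] : forall t : R, exists l, `|t| <= 2 ->
    forall j, `|w j t - l| <= 2 * A * 2^-1 ^+ j.
  move=> t; have [t2|nt2] := pselect (`|t| <= 2); last by exists 0.
  by have [l lP] := geometric_cvg (fun j => wA j t t2); exists l.
pose cl (t : R) := clamp (-2) 2 t.
have cl2 t : `|cl t| <= 2 by rewrite ler_norml; apply: clamp_in; lra.
pose wl (t : R) := l (cl t).
have wlc : continuous wl.
  move=> t; apply/cvgrPdist_lt => e e0.
  have [j je] : exists j, 2 * A * 2^-1 ^+ j < e / 3.
    apply/not_existsP => H; suff : e / 3 <= 0 by rewrite leNgt divr_gt0.
    by apply: (@half_expr_le0 _ (2 * A)) => j; rewrite leNgt; apply/negP/H.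
  have clc : {for t, continuous cl}.
    apply/cvgrPdist_lt => d d0; apply/nbhs_ballP; exists d => //= s.
    exact/le_lt_trans/clamp_lipschitz.
  have e30 : 0 < e / 3 by rewrite divr_gt0.
  have wjc : {for t, continuous (w j \o cl)}.
    by apply: continuous_comp; [exact: clc|exact: wc].
  have /cvgrPdist_lt/(_ _ e30) := wjc; apply: filterS => s /= ts.
  have := lP (cl t) (cl2 t) j; have := lP (cl s) (cl2 s) j.
  rewrite -/(wl t) -/(wl s) => ws; rewrite distrC => wt.
  have -> : wl t - wl s = (wl t - w j (cl t)) + (w j (cl t) - w j (cl s))
                          + (w j (cl s) - wl s).
    by rewrite subrKA subrKA.
  apply: le_lt_trans (ler_normD _ _) _.
  have := ler_normD (wl t - w j (cl t)) (w j (cl t) - w j (cl s)).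
  by lra.
have [s0 sd] := stepP _ wlc.
exists (step wl) => // t t2.
suff E : step wl t = wl t by rewrite E; exact: sd.
have clt : cl t = t by apply: clamp_id; rewrite -ler_norml.
have wlE (s : R) : `|s| <= 2 -> wl s = l s.
  by move=> s2; rewrite /wl /cl clamp_id// -ler_norml.
apply/eqP; rewrite -subr_eq0 -normr_le0.
apply: (@half_expr_le0 _ (2 * A)) => j.
have dd (s : R) : `|s| <= 2 ->
    is_derive s (1 : R) (fun s => step wl s - w j.+1 s)
      (F (wl s) - F (w j s)).
  by move=> _; exact: is_deriveB.
have := curve_mean_value_abs dd (M := 4^-1 * (2 * A * 2^-1 ^+ j)) _ t2.
rewrite !s0 w0 subrr subr0 => H.
have {}H : `|step wl t - w j.+1 t| <= 4^-1 * (2 * A * 2^-1 ^+ j) * `|t|.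
  apply: H => s s2; apply: le_trans (Flip _ _) _; rewrite ler_wpM2l//.
  by rewrite distrC wlE//; exact: lP.
have wt := lP t t2 j.+1; rewrite -wlE// in wt.
rewrite -(subrKA (w j.+1 t)); apply: le_trans (ler_normD _ _) _.
apply: le_trans (lerD H wt) _.
have A0 : 0 <= A by rewrite /A mulr_ge0.
have B0 : 0 <= A * 2^-1 ^+ j by rewrite mulr_ge0// exprn_ge0.
have : (A * 2^-1 ^+ j) * `|t| <= (A * 2^-1 ^+ j) * 2 by rewrite ler_wpM2l.
rewrite exprS; lra.
Qed.

End Picard.

(** * The exponential chart of commuting vector fields *)

Section CommutingFields.
Context {R : realType}.

Lemma is_derive_comp_diff {V W : normedModType R} (f : V -> W) (c : R -> V)
    (t : R) dc : differentiable f (c t) -> is_derive t (1 : R) c dc ->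
  is_derive t (1 : R) (f \o c) ('d f (c t) dc).
Proof.
move=> /differentiableP df [ct cE].
have cd : is_diff t c ('d c t) by apply/differentiableP/derivable1_diffP.
have [fc fcE] : is_diff t (f \o c) _ := is_diff_comp cd df.
have dcE : 'd c t 1 = dc by rewrite -deriveE ?cE//; exact/derivable1_diffP.
apply: DeriveDef; first exact/derivable1_diffP.
by rewrite deriveE// fcE /= dcE.
Qed.

Variables (k n : nat) (V : set 'rV[R]_n) (L : 'rV[R]_n -> 'M[R]_(k, n)).
Variable x0 : 'rV[R]_n.
Hypothesis oV : open V.
Hypothesis Vx0 : V x0.
Hypothesis L2 : ck_on 2 V L.
Hypothesis commL : forall x, V x -> forall v w : 'rV[R]_k,
  w *m 'd L x (v *m L x) = v *m 'd L x (w *m L x).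

Definition box_proj (rho : R) (x : 'rV[R]_n) : 'rV[R]_n :=
  \row_j clamp (x0 0 j - rho) (x0 0 j + rho) (x 0 j).

Lemma box_proj_lipschitz rho x y : `|box_proj rho x - box_proj rho y| <= `|x - y|.
Proof.
apply: rV_norm_le => // j; rewrite !mxE; apply: le_trans (clamp_lipschitz _ _ _ _) _.
by have := mx_entry_le (x - y) 0 j; rewrite !mxE.
Qed.

Lemma box_proj_in rho x : 0 <= rho -> `|box_proj rho x - x0| <= rho.
Proof.
move=> r0; apply: rV_norm_le => // j; rewrite !mxE ler_norml.
have := @clamp_in _ (x0 0 j - rho) (x0 0 j + rho) (x 0 j).
move=> /(_ _)/andP[]; first lra.
by move=> h1 h2; apply/andP; split; lra.
Qed.

Lemma box_proj_id rho x : `|x - x0| <= rho -> box_proj rho x = x.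
Proof.
move=> xr; apply/rowP => j; rewrite mxE clamp_id//.
have := le_trans (mx_entry_le (x - x0) 0 j) xr; rewrite !mxE ler_norml => /andP[h1 h2].
by apply/andP; split; lra.
Qed.

(** The fields c * L, precomposed with the projection onto a box, have Lipschitz
constant at most 1/4 for small c. Their integral curves are too slow to leave
the box within time 1, so the projection has no effect on them. *)
Lemma flow_exists : exists r rho M B : R, exists w : 'rV[R]_k -> R -> 'rV[R]_n,
  [/\ [/\ 0 < r, 0 < rho, 0 <= M, 0 <= B & ball x0 rho `<=` V],
      [/\ (forall x, ball x0 rho x -> forall h, `|'d L x h| <= M * `|h|),
        (forall x y, ball x0 rho x -> ball x0 rho y ->
           `|L y - L x - 'd L x (y - x)| <= M * `|y - x| ^+ 2),
        (forall x y, ball x0 rho x -> ball x0 rho y ->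
           `|L y - L x| <= M * `|y - x|) &
        (forall x, ball x0 rho x -> `|L x| <= B) ] &
      forall c, `|c| < r -> [/\ w c 0 = x0,
        (forall t : R, `|t| <= 1 -> ball x0 rho (w c t)) &
        (forall t : R, `|t| <= 1 -> is_derive t (1 : R) (w c) (c *m L (w c t)))]].
Proof.
have [M [r0 [M0 r00 r0V dLM taylorL]]] := ck2_taylor oV Vx0 L2.
have [dL _] := L2.
have lipL x y : ball x0 r0 x -> ball x0 r0 y -> `|L y - L x| <= M * `|y - x|.
  by apply: ball_mean_value => // z /r0V; exact: dL.
pose B := `|L x0| + M * r0.
have B0 : 0 <= B by rewrite addr_ge0// mulr_ge0// ltW.
have bndL x : ball x0 r0 x -> `|L x| <= B.
  move=> xr; rewrite -[L x](subrK (L x0)) addrC; apply: le_trans (ler_normD _ _) _.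
  rewrite /B lerD2l; apply: le_trans (lipL _ _ (ballxx _ r00) xr) _.
  by rewrite ler_wpM2l// -(distrC x0) ltW//; move: xr; rewrite -ball_normE.
pose rho := r0 / 2.
have rho0 : 0 < rho by rewrite divr_gt0.
have rhor : rho < r0 by rewrite /rho; lra.
pose kM := k%:R * M; pose kB := k%:R * B.
have kM0 : 0 <= kM by rewrite mulr_ge0.
have kB0 : 0 <= kB by rewrite mulr_ge0.
(* the first bound on |c| makes the field contracting for Picard iteration, the
second keeps its speed below rho / 2 *)
pose r := Num.min (4^-1 / (kM + 1)) ((rho / 2) / (kB + 1)).
have r_gt0 : 0 < r.
  by rewrite lt_min !divr_gt0// ltr_wpDl.
have rM c : `|c| < r -> k%:R * `|c| * M <= 4^-1.
  move=> cr; have : `|c| < 4^-1 / (kM + 1) by rewrite (lt_le_trans cr)// ge_min lexx.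
  rewrite ltr_pdivlMr ?ltr_wpDl// => h.
  by have := normr_ge0 c; rewrite /kM in h; lra.
have rB c : `|c| < r -> k%:R * `|c| * B <= rho / 2.
  move=> cr; have : `|c| < (rho / 2) / (kB + 1).
    by rewrite (lt_le_trans cr)// ge_min lexx orbT.
  rewrite ltr_pdivlMr ?ltr_wpDl// => h.
  by have := normr_ge0 c; rewrite /kB in h; lra.
have inb x : ball x0 r0 (box_proj rho x).
  rewrite -ball_normE /= distrC; apply: le_lt_trans rhor.
  by apply: box_proj_in; exact: ltW.
have /choice[w wP] : forall c, exists w : R -> 'rV[R]_n, `|c| < r -> w 0 = x0 /\
    forall t : R, `|t| <= 2 ->
      is_derive t (1 : R) w (c *m L (box_proj rho (w t))).
  move=> c; have [cr|] := pselect (`|c| < r); last by exists (cst 0).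
  have [|w w0 wd] := @picard R n (fun x => c *m L (box_proj rho x)) x0.
    move=> x y; rewrite -mulmxBr; apply: le_trans (mulmx_norm_le _ _) _.
    apply: (@le_trans _ _ (k%:R * `|c| * (M * `|x - y|))).
      rewrite ler_wpM2l ?mulr_ge0//; apply: le_trans (lipL _ _ (inb _) (inb _)) _.
      by rewrite ler_wpM2l//; exact: box_proj_lipschitz.
    by rewrite mulrA ler_wpM2r//; exact: rM.
  by exists w.
have win c (t : R) : `|c| < r -> `|t| <= 1 -> `|w c t - x0| <= rho / 2.
  move=> cr t1; have [w0 wd] := wP c cr; rewrite -w0.
  have wd1 (s : R) : `|s| <= 1 ->
      is_derive s (1 : R) (w c) (c *m L (box_proj rho (w c s))).
    by move=> s1; apply: wd; apply: le_trans s1 _; rewrite ler1n.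
  have := curve_mean_value_abs wd1 (M := rho / 2) _ t1.
  move=> /(_ _)/le_trans; apply.
    move=> s s1; apply: le_trans (mulmx_norm_le _ _) _;
    apply: (@le_trans _ _ (k%:R * `|c| * B)); last exact: rB.
    by rewrite ler_wpM2l ?mulr_ge0//; exact: bndL.
  by rewrite -[leRHS]mulr1 ler_wpM2l// divr_ge0// ltW.
exists r, rho, M, B, w; split.
- split=> // x xr; apply: r0V; apply: le_ball xr; exact: ltW.
- split.
  + by move=> x xr; apply: dLM; apply: le_ball xr; exact: ltW.
  + by move=> x y xr yr; apply: taylorL; [apply: le_ball xr|apply: le_ball yr]; exact: ltW.
  + by move=> x y xr yr; apply: lipL; [apply: le_ball xr|apply: le_ball yr]; exact: ltW.
  + by move=> x xr; apply: bndL; apply: le_ball xr; exact: ltW.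
- move=> c cr; have [w0 wd] := wP c cr; split=> //.
    move=> t t1; rewrite -ball_normE /= distrC; apply: le_lt_trans (win _ _ cr t1) _.
    by rewrite ltr_pdivrMr// ltr_pMr// ltr1n.
  move=> t t1; rewrite -[X in L X](@box_proj_id rho).
    by apply: wd; apply: le_trans t1 _; rewrite ler1n.
  apply: le_trans (win _ _ cr t1) _.
  by rewrite ler_pdivrMr// ler_pMr// ler1n.
Qed.

(** Let w c be the integral curve of c * L and compare w (c + h) t with
w c t + t h * L (w c t). The derivative of the second curve contains
t h * 'd L (c * L), which commutation turns into c * 'd L (t h * L), so that
both curves solve the same linearised equation up to O(|h|^2). By the Gronwall
inequality they differ by O(|h|^2), and t = 1 gives the differential. *)
Lemma time_one_map_exists : exists r rho M, exists u : 'rV[R]_k -> 'rV[R]_n,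
  [/\ [/\ 0 < r, 0 < rho & ball x0 rho `<=` V],
      (forall x y, ball x0 rho x -> ball x0 rho y ->
           `|L y - L x| <= M * `|y - x|),
      u 0 = x0,
      (forall c, ball 0 r c -> ball x0 rho (u c)) &
      (forall c, ball 0 r c -> is_diff c u (fun h => h *m L (u c)))].
Proof.
have [r [rho [M [B [w [[r0 rho0 M0 B0 rhoV] [dLM taylorL lipL bndL] wP]]]]]] :=
  flow_exists.
have [dL _] := L2.
have b0r c : ball 0 r c -> `|c| < r by rewrite -ball_normE /= sub0r normrN.
pose kk : R := k%:R.
have kk0 : 0 <= kk by [].
pose K1 := kk * r * M.
have K10 : 0 <= K1 by rewrite !mulr_ge0// ltW.
pose E := expR (n%:R * (2 * K1 + 1) + 1).
have E0 : 0 <= E by exact: expR_ge0.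
have t01 (t : R) : 0 <= t <= 1 -> `|t| <= 1.
  by move=> /andP[t0 t1]; rewrite ger0_norm.
exists r, rho, M, (fun c => w c 1); split=> //.
- have [] := wP 0; first by rewrite normr0.
  move=> w0 _ wd; rewrite -w0.
  have H := curve_mean_value_abs wd (M := 0).
  apply/eqP; rewrite -subr_eq0 -normr_le0; have := H _ 1.
  rewrite normr1 mul0r; apply=> // t _.
  by rewrite mul0mx normr0.
- by move=> c /b0r cr; have [_ + _] := wP c cr; apply; rewrite normr1.
move=> c /b0r cr.
have [wc0 wcb wcd] := wP c cr.
pose l := mulmxr (L (w c 1)) : {linear 'rV[R]_k -> 'rV[R]_n}.
suff [C C0 HC] : exists2 C, 0 <= C & forall h, `|h + c| < r ->
    `|w (h + c) 1 - w c 1 - h *m L (w c 1)| <= C * `|h| ^+ 2.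
  apply: (@diff_of_expansion _ _ _ _ _ l); first exact: linear_mx_continuous.
  move=> e e0.
  have d1 : 0 < r - `|c| by rewrite subr_gt0.
  have d2 : 0 < e / (C + 1) by rewrite divr_gt0// ltr_wpDl.
  apply: filterS2 (near0_norm_lt d1) (near0_norm_lt d2) => h hc.
  have hr : `|h + c| < r by apply: le_lt_trans (ler_normD _ _) _; lra.
  rewrite ltr_pdivlMr ?ltr_wpDl// => hh.
  apply: le_trans (HC h hr) _; rewrite expr2 mulrA ler_wpM2r//.
  by have := normr_ge0 h; lra.
pose C1 := kk * B * E.
have C10 : 0 <= C1 by rewrite !mulr_ge0.
pose C3 := kk * M * C1 + K1 * C1 ^+ 2.
have C30 : 0 <= C3 by apply: addr_ge0; [rewrite !mulr_ge0|rewrite mulr_ge0// exprn_ge0].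
exists (C3 * E); first by rewrite mulr_ge0.
move=> h hcr; have [wh0 whb whd] := wP _ hcr.
pose a t := w (h + c) t - w c t.
have cM : kk * `|c| * M <= K1 by rewrite /K1 ler_wpM2r// ler_wpM2l// ltW.
have ad (t : R) : 0 <= t <= 1 -> is_derive t (1 : R) a
    ((h + c) *m L (w (h + c) t) - c *m L (w c t)).
  by move=> /t01 t1; apply: is_deriveB; [exact: whd|exact: wcd].
have a_le t : 0 <= t <= 1 -> `|a t| <= C1 * `|h|.
  have -> : C1 * `|h| = (kk * `|h| * B) * E by rewrite /C1; ring.
  apply: (gronwall K10 _ ad); first by rewrite !mulr_ge0.
    move=> s /t01 s1; rewrite mulmxDl -addrA -mulmxBr addrC.
    apply: le_trans (ler_normD _ _) _; apply: lerD.
      apply: le_trans (mulmx_norm_le _ _) _; rewrite -/kk.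
      apply: (@le_trans _ _ (kk * `|c| * (M * `|a s|))).
        by rewrite ler_wpM2l ?mulr_ge0//; apply: lipL; [exact: wcb|exact: whb].
      by rewrite mulrA ler_wpM2r.
    apply: le_trans (mulmx_norm_le _ _) _; rewrite -/kk ler_wpM2l ?mulr_ge0//.
    exact/bndL/whb.
  by rewrite /a wh0 wc0 subrr.
pose D t := a t - t *: (h *m L (w c t)).
pose dD t := (h + c) *m L (w (h + c) t) - c *m L (w c t)
  - (h *m L (w c t) + t *: (h *m 'd L (w c t) (c *m L (w c t)))).
have Dd (t : R) : 0 <= t <= 1 -> is_derive t (1 : R) D (dD t).
  move=> tt; have t1 := t01 t tt; apply: is_deriveB; first exact: ad.
  have Lt : is_derive t (1 : R) (fun s => L (w c s)) ('d L (w c t) (c *m L (w c t))).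
    apply: (@is_derive_comp_diff _ _ L (w c)); last exact: wcd.
    exact/dL/rhoV/wcb.
  have hLt := is_derive_mulmx h Lt.
  have idd : is_derive t (1 : R) (fun s : R => s) 1 := is_derive_id t (1 : R).
  apply: is_derive_mx => i j.
  have hij := is_derive_entry i j hLt.
  have := is_deriveM idd hij.
  rewrite (_ : (fun s => s) * _ = fun s => (s *: (h *m L (w c s))) i j); last first.
    by apply/funext => s; rewrite mxE.
  move=> H; apply: is_derive_eq H _.
  by rewrite !mxE /GRing.scale /= mulr1 addrC.
have := @gronwall R n D dD K1 (C3 * `|h| ^+ 2) K10 _ Dd _ _ 1.
rewrite /D /a scale1r => G.
have -> : C3 * E * `|h| ^+ 2 = C3 * `|h| ^+ 2 * E by ring.
apply: G; rewrite ?ler01 ?lexx//.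
- by rewrite mulr_ge0 ?sqr_ge0//.
- move=> t tt; have t1 := t01 t tt.
  have xb := wcb t t1; have yb := whb t t1; have at_ := a_le t tt.
  set x := w c t in xb *; set y := w (h + c) t in yb *.
  have aE : a t = y - x by [].
  rewrite -/(D t).
  (* the terms of first order in h that do not involve D cancel by commutation *)
  have -> : dD t = h *m (L y - L x) + c *m (L y - L x - 'd L x (a t))
      + c *m 'd L x (D t).
    have E2 : c *m 'd L x (D t) =
        c *m 'd L x (a t) - t *: (h *m 'd L x (c *m L x)).
      by rewrite /D linearB linearZ /= mulmxBr -scalemxAr (commL (rhoV _ xb) h c).
    rewrite E2 /dD -/x -/y !mulmxBr mulmxDl.
    by apply/rowP => j; rewrite !mxE; ring.
  apply: le_trans (ler_normD _ _) _; rewrite addrC; apply: lerD.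
    apply: le_trans (mulmx_norm_le _ _) _.
    apply: (@le_trans _ _ (kk * `|c| * (M * `|D t|))).
      by rewrite ler_wpM2l ?mulr_ge0//; exact: dLM.
    by rewrite mulrA ler_wpM2r.
  apply: le_trans (ler_normD _ _) _; rewrite /C3 mulrDl; apply: lerD.
    apply: le_trans (mulmx_norm_le _ _) _; rewrite -/kk.
    have -> : kk * M * C1 * `|h| ^+ 2 = kk * `|h| * (M * (C1 * `|h|)) by ring.
    rewrite ler_wpM2l ?mulr_ge0//; apply: le_trans (lipL _ _ xb yb) _.
    by rewrite ler_wpM2l.
  apply: le_trans (mulmx_norm_le _ _) _; rewrite -/kk.
  apply: (@le_trans _ _ (kk * `|c| * (M * `|a t| ^+ 2))).
    by rewrite ler_wpM2l ?mulr_ge0//; exact: taylorL.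
  have -> : K1 * C1 ^+ 2 * `|h| ^+ 2 = K1 * (C1 * `|h|) ^+ 2 by ring.
  rewrite mulrA; apply: ler_pM => //; rewrite ?exprn_ge0 ?mulr_ge0//.
  by rewrite ler_sqr ?nnegrE// mulr_ge0.
- by rewrite wh0 wc0 subrr scale0r subrr.
Qed.

End CommutingFields.

(** * Plaques and commuting frames in Euclidean space *)

Section FoliatedBox.
Context {R : realType}.

Variables (k n : nat) (V : set 'rV[R]_n) (L : 'rV[R]_n -> 'M[R]_(k, n)).
Variables (x0 : 'rV[R]_n) (Pm : 'M[R]_(n, k)).
Hypothesis oV : open V.
Hypothesis Vx0 : V x0.
Hypothesis Loo : cinfty_on V L.
Hypothesis LP : forall x, V x -> L x *m Pm = 1%:M.
Hypothesis commL : forall x, V x -> forall v w : 'rV[R]_k,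
  w *m 'd L x (v *m L x) = v *m 'd L x (w *m L x).

(** Smoothness of u follows by bootstrapping from du_c h = h * L (u c). Since
L x * Pm = 1, the function (u c - x0) * Pm has derivative the identity, whence
the coordinate formula. For the last clause, D = g - u ((g - x0) * Pm) has
derivative dg * Pm * (L g - L (u ((g - x0) * Pm))), of norm at most a constant
times |D|, so D = 0. *)
Lemma foliated_box : exists r rho, exists u : 'rV[R]_k -> 'rV[R]_n,
  [/\ [/\ 0 < r, 0 < rho & ball x0 rho `<=` V],
      u 0 = x0 /\ (forall c, ball 0 r c -> ball x0 rho (u c)),
      cinfty_on (ball 0 r) u /\
      (forall c, ball 0 r c -> is_diff c u (fun h => h *m L (u c))),
      (forall c, ball 0 r c -> (u c - x0) *m Pm = c) &
      (forall (g dg : R -> 'rV[R]_n) (B : R),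
        (forall t : R, 0 <= t <= 1 -> is_derive t (1 : R) g (dg t)) ->
        (forall t, 0 <= t <= 1 -> [/\ `|dg t| <= B, ball x0 rho (g t),
           ball 0 r ((g t - x0) *m Pm) & dg t = dg t *m Pm *m L (g t)]) ->
        g 0 = u ((g 0 - x0) *m Pm) -> g 1 = u ((g 1 - x0) *m Pm))].
Proof.
have [r [rho [M [u [[r0 rho0 rhoV] lipL u0 urho ud]]]]] :=
  time_one_map_exists oV Vx0 (Loo 2) commL.
exists r, rho, u; split=> //.
- split=> // j; elim: j => [|j IH].
    move=> c /ud[uc _]; exact: differentiable_continuous.
  split=> [c /ud[]//|v].
  have oB : open (ball (0 : 'rV[R]_k) r) by exact: ball_open.
  have Lu : ck_on j (ball 0 r) (L \o u).
    apply: (ck_comp (V := V)) => // c cr; exact/rhoV/urho.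
  apply: ck_ext (ck_mulmx oB (ck_cst j v oB) Lu) => // c cr.
  by rewrite (is_diff_derive _ (ud c cr)).
- move=> c cr.
  pose f (c : 'rV[R]_k) := u c *m Pm - c.
  have fd c1 : ball 0 r c1 -> is_diff c1 f (fun=> 0).
    move=> c1r; have uc := ud c1 c1r.
    pose l := mulmxr Pm : {linear 'rV[R]_n -> 'rV[R]_k}.
    have lu := linear_is_diff l (u c1).
    have H := is_diffB (is_diff_comp uc lu) (is_diff_id c1).
    apply: is_diff_eq H _; apply/funext => h /=.
    rewrite -[LHS]/(h *m L (u c1) *m Pm - h) -mulmxA LP ?mulmx1 ?subrr//.
    exact/rhoV/urho.
  have := @ball_mean_value _ _ _ _ f 0 r 0 _ _ 0 c (ballxx _ r0) cr.
  rewrite mul0r /f subr0 u0 mulmxBl => H.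
  apply/eqP; rewrite -subr_eq0 -normr_le0 addrAC.
  apply: H => [z /fd[]//|z /fd/is_diffE zE h].
  by rewrite zE normr0 mul0r.
move=> g dg B gd gP g0.
have B0 : 0 <= B.
  by have [|/(le_trans _) h _ _ _] := gP 0; [rewrite lexx ler01|exact: h].
pose c t := (g t - x0) *m Pm.
have M0 : 0 <= `|M| by [].
pose K := k%:R * (n%:R * B * `|Pm|) * `|M|.
have K0 : 0 <= K by rewrite !mulr_ge0.
pose D t := g t - u (c t).
pose dD t := dg t *m Pm *m (L (g t) - L (u (c t))).
have Dd (t : R) : 0 <= t <= 1 -> is_derive t (1 : R) D (dD t).
  move=> tt; have [_ _ cr dgE] := gP t tt.
  have gt := gd t tt.
  have ct : is_derive t (1 : R) c (dg t *m Pm).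
    have := is_deriveB gt (is_derive_cst x0 t (1 : R)); rewrite subr0.
    exact: is_derive_mulmxr.
  have [uc ucE] := ud _ cr.
  have := is_derive_comp_diff uc ct; rewrite ucE => uct.
  apply: is_derive_eq (is_deriveB gt uct) _.
  by rewrite /dD mulmxBr -dgE.
have := @gronwall R n D dD K 0 K0 (lexx _) Dd _ _ 1.
rewrite mul0r ler01 lexx => H.
apply/eqP; rewrite -subr_eq0 -normr_le0; apply: H => //; last first.
  by rewrite /D -g0 subrr.
move=> t tt; rewrite addr0; have [dgB gr cr _] := gP t tt.
apply: le_trans (mulmx_norm_le _ _) _; rewrite /K -[leRHS]mulrA.
apply: ler_pM; rewrite ?mulr_ge0//.
  rewrite ler_wpM2l//; apply: le_trans (mulmx_norm_le _ _) _.
  by rewrite ler_wpM2r// ler_wpM2l.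
apply: le_trans (lipL _ _ (urho _ cr) gr) _.
by rewrite ler_wpM2r// ler_norm.
Qed.

End FoliatedBox.

Section FrameNormalization.
Context {R : realType}.

Lemma mem_mulmx_rows k n (T : {vspace 'rV[R]_n}) (B : 'M[R]_(k, n)) (a : 'rV[R]_k) :
  (forall i, row i B \in T) -> a *m B \in T.
Proof. by move=> BT; rewrite mulmx_sum_row; apply: memv_suml => i _; apply: memvZ. Qed.

Lemma mem_bracket k n (T : {vspace 'rV[R]_n}) (B : 'M[R]_(k, n))
    (d : {linear 'rV[R]_n -> 'M[R]_(k, n)}) (a b : 'rV[R]_k) :
  (forall i j, row j (d (row i B)) - row i (d (row j B)) \in T) ->
  b *m d (a *m B) - a *m d (b *m B) \in T.
Proof.
move=> BT.
have E (a1 b1 : 'rV[R]_k) : b1 *m d (a1 *m B) =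
    \sum_i \sum_j (a1 0 i * b1 0 j) *: row j (d (row i B)).
  rewrite [a1 *m B]mulmx_sum_row linear_sum mulmx_sumr; apply: eq_bigr => i _.
  rewrite linearZ -scalemxAr mulmx_sum_row scaler_sumr; apply: eq_bigr => j _.
  by rewrite scalerA.
rewrite !E [X in _ - X]exchange_big -sumrB; apply: memv_suml => i _.
rewrite -sumrB; apply: memv_suml => j _.
by rewrite [X in _ - X *: _]mulrC -scalerBr; apply: memvZ.
Qed.

Lemma frame_span k n (T : {vspace 'rV[R]_n}) (L : 'M[R]_(k, n)) (Pm : 'M[R]_(n, k)) :
  (forall i, row i L \in T) -> \dim T = k -> L *m Pm = 1%:M ->
  forall v, v \in T -> v = v *m Pm *m L.
Proof.
move=> LT dT LP v vT.
pose l : 'Hom('rV[R]_k, 'rV[R]_n) := linfun (mulmxr L).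
have lE c : l c = c *m L by rewrite lfunE.
have lT : (limg l <= T)%VS.
  by apply/subvP => _ /memv_imgP[c _ ->]; rewrite lE; exact: mem_mulmx_rows.
have l0 : lker l == 0%VS.
  apply/lker0P => c1 c2; rewrite !lE => H.
  by have := congr1 (mulmx^~ Pm) H; rewrite -!mulmxA LP !mulmx1.
have dl : \dim (limg l) = k.
  by rewrite limg_dim_eq ?dimvf ?/dim/= ?mul1n// (eqP l0) capv0.
have /eqP lTE : limg l == T by rewrite eqEdim lT dT dl leqnn.
move: vT; rewrite -lTE => /memv_imgP[c _ ->]; rewrite lE.
by rewrite -[c *m L *m Pm]mulmxA LP mulmx1.
Qed.

(** When both sides of the bracket of two rows of B = Q L are expanded by
the Leibniz rule, the part in the span of L is removed by
x |-> x - x * Pm * L, and what remains is the bracket of the rows of L. *)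
Lemma bracket_cancel k n (X Y X' Y' L : 'M[R]_(k, n)) (Q : 'M[R]_k)
    (Pm : 'M[R]_(n, k)) (a b : 'rV[R]_k) :
  X = X *m Pm *m L + Q *m X' -> Y = Y *m Pm *m L + Q *m Y' ->
  b *m X - a *m Y = (b *m X - a *m Y) *m Pm *m L ->
  b *m Q *m X' = a *m Q *m Y'.
Proof.
move=> XE YE E.
have QX : Q *m X' = X - X *m Pm *m L by apply/eqP; rewrite eq_sym subr_eq addrC -XE.
have QY : Q *m Y' = Y - Y *m Pm *m L by apply/eqP; rewrite eq_sym subr_eq addrC -YE.
move: E; rewrite -!mulmxA QX QY !mulmxBl !mulmxBr !mulmxA.
move: (b *m X) (a *m Y) (b *m X *m Pm *m L) (a *m Y *m Pm *m L) => p q r s E.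
by apply/rowP => j; have /rowP/(_ j) := E; rewrite !mxE; lra.
Qed.

(** The normalisation L * Pm = 1 forces the derivatives of L, hence the
brackets of its rows, into the kernel of Pm. These brackets also lie in the
distribution, on which Pm is injective, so they vanish. *)
Lemma frame_normalize k n (V : set 'rV[R]_n) (x0 : 'rV[R]_n)
    (B : 'rV[R]_n -> 'M[R]_(k, n)) (T : 'rV[R]_n -> {vspace 'rV[R]_n}) :
  open V -> V x0 -> cinfty_on V B -> row_free (B x0) ->
  (forall x, V x -> \dim (T x) = k) ->
  (forall x, V x -> forall i, row i (B x) \in T x) ->
  (forall x, V x -> forall i j,
     row j ('d B x (row i (B x))) - row i ('d B x (row j (B x))) \in T x) ->
  exists (W : set 'rV[R]_n) (L : 'rV[R]_n -> 'M[R]_(k, n)) (Pm : 'M[R]_(n, k)),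
  [/\ [/\ open W, W x0 & W `<=` V], cinfty_on W L,
      (forall x, W x -> L x *m Pm = 1%:M),
      (forall x, W x -> forall v, v \in T x <-> v = v *m Pm *m L x) &
      (forall x, W x -> forall v w : 'rV[R]_k,
        w *m 'd L x (v *m L x) = v *m 'd L x (w *m L x))].
Proof.
move=> oV Vx0 Boo /row_freeP[Pm BP] dT BT brT.
pose Q x := B x *m Pm.
have Qoo : cinfty_on V Q by move=> j; apply: ck_mulmx => //; exact: ck_cst.
have detc : {for x0, continuous (fun x => \det (Q x))}.
  by apply: (ck_continuous (k := 0) (U := V)) => //; apply: ck_det => //; exact: Qoo.
have : \forall x \near x0, V x /\ \det (Q x) != 0.
  have det0 : \det (Q x0) = 1 by rewrite /Q BP det1.
  have /cvgrPdist_lt/(_ 1 ltr01) := detc; rewrite det0 => det1.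
  apply: filterS2 (open_nbhs_nbhs (conj oV Vx0)) det1 => x Vx.
  by move=> h; split=> //; apply: contraTneq h => ->; rewrite subr0 normr1 ltxx.
move=> /nbhs_ballP[r /= r0 rP].
pose W := ball x0 r; have oW : open W by exact: ball_open.
have WV : W `<=` V by move=> x /rP[].
have Q0 x : W x -> \det (Q x) != 0 by move=> /rP[].
have Qu x : W x -> Q x \in unitmx by move=> /Q0; rewrite unitmxE unitfE.
have Qi x : W x -> invmx (Q x) *m Q x = 1%:M by move=> /Qu; exact: mulVmx.
pose L x := invmx (Q x) *m B x.
have Loo : cinfty_on W L.
  move=> j; apply: ck_mulmx => //; last exact: ck_sub (Boo j).
  by apply: ck_invmx => //; exact: ck_sub (Qoo j).
have LP x : W x -> L x *m Pm = 1%:M by move=> Wx; rewrite /L -mulmxA Qi.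
have LT x : W x -> forall i, row i (L x) \in T x.
  by move=> Wx i; rewrite row_mul; apply: mem_mulmx_rows; exact/BT/WV.
have QL x : W x -> Q x *m L x = B x by move=> Wx; rewrite /L mulKVmx// Qu.
exists W, L, Pm; split=> //.
- by split=> //; exact: ballxx.
- move=> x Wx v; split; last by move=> ->; apply: mem_mulmx_rows; exact: LT.
  by apply: frame_span (LT _ Wx) _ (LP _ Wx) _; exact/dT/WV.
move=> x Wx.
have dfB : differentiable B x by have [+ _] := Boo 1%N; apply; exact: WV.
have dfQ : differentiable Q x by have [+ _] := Qoo 1%N; apply; exact: WV.
have dfL : differentiable L x by have [+ _] := Loo 1%N; exact.
have dB z : 'd B x z = 'd B x z *m Pm *m L x + Q x *m 'd L x z.
  have Qz : is_derive x z Q ('d B x z *m Pm).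
    have Bz : is_derive x z B ('d B x z).
      by apply: DeriveDef; [exact: diff_derivable|rewrite deriveE].
    have := is_derive_mulmx2 Bz (is_derive_cst Pm x z).
    by rewrite mulmx0 addr0.
  have Lz : is_derive x z L ('d L x z).
    by apply: DeriveDef; [exact: diff_derivable|rewrite deriveE].
  have [_ <-] := is_derive_mulmx2 Qz Lz.
  rewrite -(deriveE z dfB); apply: near_eq_derive.
  by apply: filterS (open_nbhs_nbhs (conj oW Wx)) => y Wy; rewrite QL.
have comm (a b : 'rV[R]_k) :
    b *m Q x *m 'd L x (a *m B x) = a *m Q x *m 'd L x (b *m B x).
  have := mem_bracket a b (brT x (WV x Wx)).
  have dTx := dT x (WV x Wx).
  move=> /(frame_span (LT _ Wx) dTx (LP _ Wx)).
  exact: bracket_cancel (dB _) (dB _).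
move=> v w; have := comm (v *m invmx (Q x)) (w *m invmx (Q x)).
by rewrite !(mulmxKV (Qu x Wx)) -!mulmxA.
Qed.

End FrameNormalization.

(** * Change of charts *)

Section SmoothNear.
Context {R : realType}.

Lemma open_setI_preimage {X Y : topologicalType} (A : set X) (B : set Y) (f : X -> Y) :
  open A -> open B -> (forall x, A x -> {for x, continuous f}) ->
  open (A `&` f @^-1` B).
Proof.
move=> oA oB fc; rewrite openE => x [Ax Bfx].
apply: filterI; first exact: open_nbhs_nbhs.
by apply: (fc x Ax); exact: open_nbhs_nbhs.
Qed.

Lemma smooth_nearP m n (x : 'rV[R]_m) (f : 'rV[R]_m -> 'rV[R]_n) :
  smooth_near x f -> forall N : set 'rV[R]_m, nbhs x N ->
  exists r, [/\ 0 < r, ball x r `<=` N & cinfty_on (ball x r) f].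
Proof.
move=> [U [oU Ux /smooth_onE fU]] N xN.
have /nbhs_ballP[r /= r0 rP] : nbhs x (U `&` N).
  by apply: filterI => //; exact: open_nbhs_nbhs.
exists r; split=> // [y /rP[]//|k].
by apply: ck_sub (fU k) => y /rP[].
Qed.

Lemma smooth_near_ball m n (x : 'rV[R]_m) r (f : 'rV[R]_m -> 'rV[R]_n) :
  0 < r -> cinfty_on (ball x r) f -> smooth_near x f.
Proof.
move=> r0 fr; exists (ball x r); split; [exact: ball_open|exact: ballxx|].
exact/smooth_onE.
Qed.

Lemma smooth_near_diff m n (x : 'rV[R]_m) (f : 'rV[R]_m -> 'rV[R]_n) :
  smooth_near x f -> differentiable f x.
Proof. by move=> [U [oU Ux /(_ 1%N)[df _]]]; exact: df. Qed.

Lemma smooth_near_ext m n (x : 'rV[R]_m) (f g : 'rV[R]_m -> 'rV[R]_n) :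
  {near x, f =1 g} -> smooth_near x f -> smooth_near x g.
Proof.
move=> fg /smooth_nearP/(_ _ fg)[r [r0 rfg fr]].
apply: (smooth_near_ball r0) => k; apply: ck_ext (fr k) => //.
exact: ball_open.
Qed.

Lemma smooth_near_comp m n p (x : 'rV[R]_m) (f : 'rV[R]_m -> 'rV[R]_n)
    (g : 'rV[R]_n -> 'rV[R]_p) :
  smooth_near x f -> smooth_near (f x) g -> smooth_near x (g \o f).
Proof.
move=> fx [V [oV Vfx /smooth_onE gV]].
have fc : {for x, continuous f}.
  exact/differentiable_continuous/smooth_near_diff.
have xN : nbhs x (f @^-1` V) by apply: fc; exact: open_nbhs_nbhs.
have [r [r0 rN fr]] := smooth_nearP fx xN.
apply: (smooth_near_ball r0) => k.
by apply: ck_comp (fr k) (gV k) => //; exact: ball_open.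
Qed.

End SmoothNear.

Lemma memv_eq {R : realType} {n} (T : {vspace 'rV[R]_n}) v w :
  v = w -> w \in T -> v \in T.
Proof. by move=> ->. Qed.

Section ChartCalculus.
Context {R : realType} {n : nat} (M : manifold R n).
Implicit Types (c : chart R n M) (q : M).

Lemma near_chart_inv c q (U : set M) : chart_dom c q -> nbhs q U ->
  \forall x \near chart_map c q, chart_cod c x /\ U (chart_inv c x).
Proof.
move=> cq Uq; have cx := chart_map_cod cq; apply: filterI.
  by apply: open_nbhs_nbhs; split=> //; exact: chart_cod_open.
by apply: (chart_inv_continuous cx); rewrite chart_mapK.
Qed.

Lemma nbhs_chart_dom c q : chart_dom c q -> nbhs q (chart_dom c).
Proof. by move=> cq; exact: open_nbhs_nbhs (conj (chart_dom_open c) cq). Qed.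

Lemma nbhs_chart_at q : nbhs q (chart_dom (chart_at q)).
Proof. exact/nbhs_chart_dom/chart_at_dom. Qed.

Lemma transition_smooth c c' q : atlas c -> atlas c' ->
  chart_dom c q -> chart_dom c' q ->
  smooth_near (chart_map c q) (chart_map c' \o chart_inv c).
Proof.
move=> ac ac' cq c'q.
exists (chart_cod c `&` chart_inv c @^-1` chart_dom c'); split.
- apply: open_setI_preimage; [exact: chart_cod_open|exact: chart_dom_open|].
  exact: chart_inv_continuous.
- by split; [exact: chart_map_cod|rewrite /= chart_mapK].
- exact: atlas_compatible.
Qed.

Lemma transition_comp c c' c'' q : chart_dom c q -> chart_dom c' q ->
  {near chart_map c q, chart_map c'' \o chart_inv c'
    \o (chart_map c' \o chart_inv c) =1 chart_map c'' \o chart_inv c}.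
Proof.
move=> cq c'q; apply: filterS (near_chart_inv cq (nbhs_chart_dom c'q)).
by move=> x [_ xc'] /=; rewrite chart_mapK.
Qed.

Lemma transition_diff_comp c c' c'' q v : atlas c -> atlas c' -> atlas c'' ->
  chart_dom c q -> chart_dom c' q -> chart_dom c'' q ->
  'd (chart_map c'' \o chart_inv c') (chart_map c' q)
    ('d (chart_map c' \o chart_inv c) (chart_map c q) v)
  = 'd (chart_map c'' \o chart_inv c) (chart_map c q) v.
Proof.
move=> ac ac' ac'' cq c'q c''q.
apply/esym/(diff_comp_near _ _ _ (transition_comp c'' cq c'q)).
- by rewrite /= chart_mapK.
- exact/smooth_near_diff/transition_smooth.
- exact/smooth_near_diff/transition_smooth.
Qed.

Lemma transition_diff_id c q v : chart_dom c q ->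
  'd (chart_map c \o chart_inv c) (chart_map c q) v = v.
Proof.
move=> cq; have idd := @is_diff_id R _ (chart_map c q).
have near_id : {near chart_map c q, id =1 chart_map c \o chart_inv c}.
  apply: filterS (near_chart_inv cq filterT) => x [cx _] /=.
  by rewrite chart_invK.
exact: (congr1 (fun F : _ -> _ => F v) (is_diffE (near_eq_is_diff near_id idd))).
Qed.

Lemma transition_diffK c c' q v : atlas c -> atlas c' ->
  chart_dom c q -> chart_dom c' q ->
  'd (chart_map c \o chart_inv c') (chart_map c' q)
    ('d (chart_map c' \o chart_inv c) (chart_map c q) v) = v.
Proof.
move=> ac ac' cq c'q; apply: etrans (transition_diff_id v cq).
exact: transition_diff_comp.
Qed.

Definition chart_dist (S : tangent_distribution M) c (x : 'rV[R]_n) :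
    {vspace 'rV[R]_n} :=
  let q := chart_inv c x in
  (linfun ('d (chart_map c \o chart_inv (chart_at q)) (chart_coord q)) @: S q)%VS.

Lemma mem_chart_dist S c q w : atlas c -> chart_dom c q ->
  w \in chart_dist S c (chart_map c q) <->
  'd (chart_map (chart_at q) \o chart_inv c) (chart_map c q) w \in S q.
Proof.
move=> ac cq; rewrite /chart_dist chart_mapK//.
have [aq dq] := (chart_at_atlas q, chart_at_dom q).
split=> [/memv_imgP[v vS ->]|wS].
  rewrite lfunE; apply: memv_eq vS; exact: transition_diffK.
apply/memv_imgP; exists ('d (chart_map (chart_at q) \o chart_inv c) (chart_map c q) w) => //.
by rewrite lfunE; apply/esym; exact: transition_diffK.
Qed.

Lemma mem_chart_dist_T (S : tangent_distribution M) c q v : atlas c -> chart_dom c q -> v \in S q ->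
  'd (chart_map c \o chart_inv (chart_at q)) (chart_coord q) v
    \in chart_dist S c (chart_map c q).
Proof.
move=> ac cq vS; apply/mem_chart_dist => //.
have [aq dq] := (chart_at_atlas q, chart_at_dom q).
apply: memv_eq vS; exact: transition_diffK.
Qed.

Lemma dim_chart_dist S c q : atlas c -> chart_dom c q ->
  \dim (chart_dist S c (chart_map c q)) = \dim (S q).
Proof.
move=> ac cq; rewrite /chart_dist chart_mapK//; apply: limg_dim_eq.
have [aq dq] := (chart_at_atlas q, chart_at_dom q).
suff /eqP -> : lker (linfun ('d (chart_map c \o chart_inv (chart_at q)) (chart_coord q))) == 0%VS.
  by rewrite capv0.
apply/lker0P => v w; rewrite !lfunE.
apply: (can_inj (g := 'd (chart_map (chart_at q) \o chart_inv c) (chart_map c q))) => u.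
exact: transition_diffK.
Qed.

Lemma chart_dist_at S q : chart_dist S (chart_at q) (chart_coord q) = S q.
Proof.
have [aq dq] := (chart_at_atlas q, chart_at_dom q).
apply/vspaceP => v; apply/idP/idP => [/mem_chart_dist|vS].
  by move=> /(_ aq dq); apply: memv_eq; apply/esym; exact: transition_diff_id.
apply/mem_chart_dist => //; apply: memv_eq vS.
exact: transition_diff_id.
Qed.

Lemma curve_in_chart j (g : 'rV[R]_j -> M) x c c' : atlas c -> atlas c' ->
  chart_dom c (g x) -> chart_dom c' (g x) -> {for x, continuous g} ->
  smooth_near x (chart_map c \o g) ->
  smooth_near x (chart_map c' \o g) /\
  forall h, 'd (chart_map c' \o g) x h =
    'd (chart_map c' \o chart_inv c) (chart_map c (g x)) ('d (chart_map c \o g) x h).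
Proof.
move=> ac ac' cgx c'gx gc cg.
have ts := transition_smooth ac ac' cgx c'gx.
have nE : {near x, chart_map c' \o chart_inv c \o (chart_map c \o g)
           =1 chart_map c' \o g}.
  have gN : nbhs x (g @^-1` chart_dom c) by exact/gc/nbhs_chart_dom.
  apply: filterS gN => y cgy /=.
  by rewrite chart_mapK.
split; first by apply: smooth_near_ext nE _; exact: smooth_near_comp.
move=> h; apply: (diff_comp_near _ _ _ nE) => //; exact: smooth_near_diff.
Qed.

End ChartCalculus.

Section MapCalculus.
Context {R : realType} {m n : nat} (M : manifold R m) (N : manifold R n).

Lemma local_rep_chart (f : M -> N) q c : {for q, continuous f} ->
  atlas c -> chart_dom c q -> smooth_near (chart_coord q) (local_rep f q) ->
  smooth_near (chart_map c q) (chart_map (chart_at (f q)) \o f \o chart_inv c) /\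
  forall h, 'd (chart_map (chart_at (f q)) \o f \o chart_inv c) (chart_map c q) h =
   'd (local_rep f q) (chart_coord q)
     ('d (chart_map (chart_at q) \o chart_inv c) (chart_map c q) h).
Proof.
move=> fc ac cq sf.
have [aq dq] := (chart_at_atlas q, chart_at_dom q).
have ts := transition_smooth ac aq cq dq.
have nE : {near chart_map c q, local_rep f q \o (chart_map (chart_at q) \o chart_inv c)
           =1 chart_map (chart_at (f q)) \o f \o chart_inv c}.
  apply: filterS (near_chart_inv cq (nbhs_chart_at q)) => y [_ cgy] /=.
  by rewrite /local_rep /= chart_mapK.
have E : (chart_map (chart_at q) \o chart_inv c) (chart_map c q) = chart_coord q.
  by rewrite /= chart_mapK.
split; first by apply: smooth_near_ext nE _; apply: smooth_near_comp => //; rewrite E.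
move=> h; apply: (diff_comp_near _ _ _ nE) => //; exact: smooth_near_diff.
Qed.

End MapCalculus.

(** * The leaf topology *)

Section LeafTopology.
Context {R : realType} {n : nat} (M : manifold R n) (S : tangent_distribution M).

Definition tangent_on j (W : set 'rV[R]_j) (g : 'rV[R]_j -> M) : Prop :=
  forall x, W x -> [/\ {for x, continuous g},
    smooth_near x (chart_map (chart_at (g x)) \o g) &
    forall h, 'd (chart_map (chart_at (g x)) \o g) x h \in S (g x)].

(** Openness in the finest topology for which all maps tangent to S are
continuous. *)
Definition leaf_open (U : set M) : Prop :=
  forall j (W : set 'rV[R]_j) (g : 'rV[R]_j -> M), open W -> tangent_on W g ->
    open (W `&` g @^-1` U).

Definition leaf_clopen (U : set M) : Prop := leaf_open U /\ leaf_open (~` U).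

(** The quasi-component of p in the leaf topology. It is preserved by continuous
maps at once, and agrees with the component when the topology is locally
connected. *)
Definition quasi_leaf (p : M) : set M :=
  [set q | forall C, leaf_clopen C -> C p -> C q].

Lemma leaf_openT : leaf_open setT.
Proof. by move=> j W g oW _; rewrite preimage_setT setIT. Qed.

Lemma leaf_openI U V : leaf_open U -> leaf_open V -> leaf_open (U `&` V).
Proof.
move=> oU oV j W g oW gW; rewrite preimage_setI -{1}(setIid W) setIACA.
by apply: openI; [exact: oU|exact: oV].
Qed.

Lemma leaf_open_bigcup (I : Type) (F : I -> set M) :
  (forall i, leaf_open (F i)) -> leaf_open (\bigcup_i F i).
Proof.
move=> oF j W g oW gW; rewrite preimage_bigcup setI_bigcupr.
by apply: bigcup_open => i _; exact: oF.
Qed.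

Lemma open_leaf_open U : open U -> leaf_open U.
Proof.
move=> oU j W g oW gW; apply: open_setI_preimage => // x /gW[].
by [].
Qed.

Lemma quasi_leaf_refl p : quasi_leaf p p.
Proof. by move=> C. Qed.

Lemma leaf_clopenC C : leaf_clopen C -> leaf_clopen (~` C).
Proof. by move=> [oC cC]; split=> //; rewrite setCK. Qed.

Lemma quasi_leaf_sym p q : quasi_leaf p q -> quasi_leaf q p.
Proof.
move=> pq C hC Cq; apply: contrapT => nCp.
by have := pq _ (leaf_clopenC hC) nCp.
Qed.

Lemma quasi_leaf_trans p q r : quasi_leaf p q -> quasi_leaf q r -> quasi_leaf p r.
Proof. by move=> pq qr C hC Cp; apply: qr => //; exact: pq. Qed.

(** A segment in the ball is connected and is mapped continuously for the leaf
topology, so its image cannot leave a leaf-clopen set. *)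
Lemma tangent_segment j r (g : 'rV[R]_j -> M) C : tangent_on (ball 0 r) g ->
  leaf_clopen C -> C (g 0) -> forall c, ball 0 r c -> C (g c).
Proof.
move=> gr [oC cC] C0 c cr.
have oB : open (ball (0 : 'rV[R]_j) r) by exact: ball_open.
have o1 := oC _ _ _ oB gr; have o2 := cC _ _ _ oB gr.
pose l (t : R) : 'rV[R]_j := t *: c.
have lc : continuous l by exact: scalel_continuous.
have lr t : `[0, 1]%classic t -> ball 0 r (l t).
  rewrite /= in_itv /= => t01; have r0 : 0 < r.
    by move: cr; rewrite -ball_normE /= sub0r normrN; exact/le_lt_trans.
  have := ball_segment (ballxx (0 : 'rV[R]_j) r0) cr t01.
  by rewrite subr0 add0r.
pose B := `[0, 1]%classic `&` [set t | C (g (l t))].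
have BE : B = `[0, 1]%classic.
  apply: segment_connected.
  - exists 0; split; first by rewrite /= in_itv /= lexx ler01.
    by rewrite /= /l scale0r.
  - exists (l @^-1` (ball 0 r `&` g @^-1` C)).
      by apply: open_comp => // t _; exact: lc.
    by apply/seteqP; split=> t [t01]; [move=> Ct; split=> //; split=> //; exact: lr|move=> [_ ?]].
  - exists (~` (l @^-1` (ball 0 r `&` g @^-1` (~` C)))).
      by apply: open_closedC; apply: open_comp => // t _; exact: lc.
    apply/seteqP; split=> t [t01]; first by move=> Ct; split=> // -[_].
    by move=> nt; split=> //; apply: contrapT => nC; apply: nt; split=> //; exact: lr.
have : `[0, 1]%classic (1 : R) by rewrite /= in_itv /= lexx ler01.
by rewrite -BE => -[_ /=]; rewrite /l scale1r.
Qed.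

End LeafTopology.

Section TangentMaps.
Context {R : realType} {k n : nat} (N : manifold R k) (M : manifold R n).
Variable S : tangent_distribution M.

Lemma tangent_map_subP (f : N -> M) q (T : {vspace 'rV[R]_n}) :
  (limg (tangent_map f q) <= T)%VS <->
  forall v, 'd (local_rep f q) (chart_coord q) v \in T.
Proof.
split=> [fT v|fT].
  apply: (subvP fT); apply: memv_eq (memv_img (tangent_map f q) (memvf v)).
  exact/esym/linfunE.
by apply/subvP => _ /memv_imgP[v _ ->]; apply: memv_eq (fT v); exact: linfunE.
Qed.

Lemma tangent_on_chart (f : N -> M) c : smooth f ->
  (forall q, (limg (tangent_map f q) <= S (f q))%VS) -> atlas c ->
  tangent_on S (chart_cod c) (f \o chart_inv c).
Proof.
move=> [fc fs] fS ac x cx.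
have cq := chart_inv_dom cx.
have fcq : {for chart_inv c x, continuous f} by exact: fc.
have [sm dE] := local_rep_chart fcq ac cq (fs _).
rewrite chart_invK// in sm dE; split=> //.
  by apply: continuous_comp; [exact: chart_inv_continuous|exact: fc].
move=> h; apply: memv_eq (dE h) _.
by move/tangent_map_subP: (fS (chart_inv c x)); apply.
Qed.

Lemma leaf_open_preimage (f : N -> M) U : smooth f ->
  (forall q, (limg (tangent_map f q) <= S (f q))%VS) ->
  leaf_open S U -> open (f @^-1` U).
Proof.
move=> fs fS oU; rewrite openE => q fqU.
have [aq dq] := (chart_at_atlas q, chart_at_dom q).
have := oU _ _ _ (@chart_cod_open _ _ _ (chart_at q)) (tangent_on_chart fs fS aq).
rewrite openE => /(_ (chart_coord q)).
have hx : (chart_cod (chart_at q) `&` (f \o chart_inv (chart_at q)) @^-1` U) (chart_coord q).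
  by split; [exact: chart_map_cod|rewrite /= chart_mapK].
move=> /(_ hx) H.
have := chart_map_continuous dq H.
apply: filterS2 (nbhs_chart_at q) => y dy /= [_ ]; rewrite chart_mapK//.
Qed.

Lemma tangent_map_quasi_leaf (f : N -> M) : connected [set: N] -> smooth f ->
  (forall q, (limg (tangent_map f q) <= S (f q))%VS) ->
  forall x y, quasi_leaf S (f x) (f y).
Proof.
move=> cN fs fS x y C [oC cC] Cx.
have oA := leaf_open_preimage fs fS oC.
have oA' := leaf_open_preimage fs fS cC.
suff : (f @^-1` C) y by [].
rewrite (cN (f @^-1` C)) //; first by exists x.
- by exists (f @^-1` C) => //; rewrite setTI.
- by exists (f @^-1` C); rewrite ?setTI// -openC.
Qed.

End TangentMaps.

(** * Plaques in a manifold *)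

Section Plaques.
Context {R : realType} {n : nat} (M : manifold R n) (S : tangent_distribution M).

(** The conclusion of the analytic part of the Frobenius theorem: near p the
distribution is spanned by k commuting vector fields, the rows of L, normalised
by a constant matrix Pm of coordinates along the plaques. *)
Definition integrable_at (k : nat) (p : M) : Prop :=
  exists (V : set 'rV[R]_n) (L : 'rV[R]_n -> 'M[R]_(k, n)) (Pm : 'M[R]_(n, k)),
  [/\ [/\ open V, V (chart_coord p), V `<=` chart_cod (chart_at p) &
        forall x, V x -> \dim (chart_dist S (chart_at p) x) = k],
      cinfty_on V L, (forall x, V x -> L x *m Pm = 1%:M),
      (forall x, V x -> forall v, v \in chart_dist S (chart_at p) x <-> v = v *m Pm *m L x) &
      (forall x, V x -> forall v w : 'rV[R]_k,
        w *m 'd L x (v *m L x) = v *m 'd L x (w *m L x))].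

Lemma integrable_dim_near k p : integrable_at k p ->
  \forall q \near p, \dim (S q) = k.
Proof.
move=> [V [L [Pm [[oV Vx VC dV] _ _ _ _]]]].
have [ap dp] := (chart_at_atlas p, chart_at_dom p).
have VN : nbhs p (chart_map (chart_at p) @^-1` V).
  by apply: (chart_map_continuous dp); exact: open_nbhs_nbhs.
apply: filterS2 VN (nbhs_chart_at p) => q Vq dq.
by rewrite -(dim_chart_dist S ap dq); exact: dV.
Qed.

(** For leaf-openness, let g be tangent to S with g x in the plaque. Near x the
segments from x to y are mapped by g to curves tangent to S, and these remain in
the plaque by [foliated_box]. *)
Lemma plaque_through k p : integrable_at k p ->
  exists r (u : 'rV[R]_k -> 'rV[R]_n) (Pm : 'M[R]_(n, k)),
  [/\ 0 < r /\ u 0 = chart_coord p,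
      (forall v, ball 0 r v -> chart_cod (chart_at p) (u v)) /\ cinfty_on (ball 0 r) u,
      (forall v, ball 0 r v -> (u v - chart_coord p) *m Pm = v) /\
      (exists L0, [/\ is_diff 0 u (mulmx^~ L0), L0 *m Pm = 1%:M &
         forall v, v \in S p <-> v = v *m Pm *m L0]),
      tangent_on S (ball 0 r) (chart_inv (chart_at p) \o u) &
      leaf_open S ((chart_inv (chart_at p) \o u) @` ball 0 r)].
Proof.
move=> [V [L [Pm [[oV Vx VC _] Loo LP memS commL]]]].
have [ap dp] := (chart_at_atlas p, chart_at_dom p).
set c := chart_at p in ap dp *; set x0 := chart_coord p in Vx *.
have [r [rho [u [[r0 rho0 rhoV] [u0 urho] [uoo ud] uP curve]]]] :=
  foliated_box oV Vx Loo LP commL.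
have uV v : ball 0 r v -> V (u v) by move=> vr; exact/rhoV/urho.
have ucod v : ball 0 r v -> chart_cod c (u v) by move=> vr; exact/VC/uV.
have oB : open (ball (0 : 'rV[R]_k) r) by exact: ball_open.
exists r, u, Pm; split=> //.
- split=> //; exists (L x0); split; last 2 first.
  + exact: LP.
  + by move=> v; rewrite -(memS x0)// chart_dist_at.
  by have := ud 0 (ballxx _ r0); rewrite u0.
- move=> v vr.
  have cuv := ucod v vr; have duv := chart_inv_dom cuv.
  have uc : {for v, continuous u} by have [/differentiable_continuous] := ud v vr.
  have gc : {for v, continuous (chart_inv c \o u)}.
    by apply: continuous_comp => //; exact: chart_inv_continuous.
  have nE : {near v, u =1 chart_map c \o (chart_inv c \o u)}.
    by apply: filterS (open_nbhs_nbhs (conj oB vr)) => w wr /=; rewrite chart_invK//; exact: ucod.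
  have us : smooth_near v u.
    by exists (ball 0 r); split=> //; exact/smooth_onE.
  have cgs := smooth_near_ext nE us.
  have [aq dq] := (chart_at_atlas (chart_inv c (u v)), chart_at_dom (chart_inv c (u v))).
  have [sm dE] := @curve_in_chart _ _ _ _ (chart_inv c \o u) v _ _ ap aq duv dq gc cgs.
  split=> // h; apply: memv_eq (dE h) _.
  apply/mem_chart_dist => //=; rewrite chart_invK//.
  have dcg := is_diffE (near_eq_is_diff nE (ud v vr)).
  rewrite dcg; apply/memS; first exact: uV.
  by rewrite -[h *m _ *m Pm]mulmxA LP ?mulmx1//; exact: uV.
move=> j W g oW gW; rewrite openE => x [Wx [v0 v0r gx]].
have cgx : chart_dom c (g x) by rewrite -gx; apply: chart_inv_dom; exact: ucod.
have [gc gs _] := gW x Wx.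
have [aq dq] := (chart_at_atlas (g x), chart_at_dom (g x)).
have [Gs _] := curve_in_chart aq ap dq cgx gc gs.
pose G := chart_map c \o g.
have GxE : G x = u v0 by rewrite /G /= -gx /= chart_invK//; exact: ucod.
have Gc : {for x, continuous G} by exact/differentiable_continuous/smooth_near_diff.
pose prj (y : 'rV[R]_n) := (y - x0) *m Pm.
have prjc : continuous prj.
  move=> y; have -> : prj = (mulmxr Pm : {linear _ -> _}) \o (fun z => z - x0).
    by apply/funext.
  apply: continuous_comp; last exact: linear_mx_continuous.
  by apply: continuousB; [exact: cvg_id|exact: cst_continuous].
have xN : nbhs x [set y | [/\ W y, chart_dom c (g y), ball x0 rho (G y) & ball 0 r (prj (G y))]].
  have n1 : nbhs x W by exact: open_nbhs_nbhs.
  have n2 : nbhs x (g @^-1` chart_dom c) by exact/gc/nbhs_chart_dom.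
  have n3 : nbhs x (G @^-1` ball x0 rho).
    apply: Gc; apply: open_nbhs_nbhs; split; first exact: ball_open.
    by rewrite GxE; exact: urho.
  have n4 : nbhs x ((prj \o G) @^-1` ball 0 r).
    have pGc : {for x, continuous (prj \o G)}.
      by apply: continuous_comp; [exact: Gc|exact: prjc].
    apply: pGc; apply: open_nbhs_nbhs; split; first exact: ball_open.
    by rewrite /= GxE /prj uP.
  by apply: filterS2 (filterI n1 n2) (filterI n3 n4) => y [? ?] [].
have [d1 [d10 d1N Goo]] := smooth_nearP Gs xN.
have oB1 : open (ball x d1) by exact: ball_open.
have [B B0 GB] := ck1_diff_bounded oB1 (ballxx _ d10) (Goo 1%N).
have /nbhs_ballP[d /= d0 dP] : nbhs x [set y | ball x d1 y /\ forall h, `|'d G y h| <= B * `|h|].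
  by apply: filterS2 (open_nbhs_nbhs (conj oB1 (ballxx _ d10))) GB => y.
apply/nbhs_ballP; exists d => //= y yd.
have [y1 _] := dP y yd; have [Wy cgy _ pry] := d1N y y1.
split=> //; exists (prj (G y)) => //=.
suff <- : G y = u (prj (G y)) by rewrite /G /= chart_mapK.
pose l (t : R) := x + t *: (y - x).
have lin t : 0 <= t <= 1 -> ball x d (l t) by move=> t01; exact: ball_segment (ballxx _ d0) yd t01.
have dG z : ball x d z -> differentiable G z.
  by move=> /dP[z1 _]; have [+ _] := Goo 1%N; apply.
have := curve (fun t => G (l t)) (fun t => 'd G (l t) (y - x)) (B * `|y - x|).
rewrite /l scale0r addr0 scale1r subrKC; apply.
- by move=> t t01; apply: is_derive_line; apply: dG; exact: lin.
- move=> t t01; have [z1 zB] := dP _ (lin t t01).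
  have [Wz cgz Gz prz] := d1N _ z1; split=> //.
  have [gcz gsz gSz] := gW _ Wz.
  have [az dz] := (chart_at_atlas (g (l t)), chart_at_dom (g (l t))).
  have [_ dE] := curve_in_chart az ap dz cgz gcz gsz.
  apply/(memS (G (l t))); first exact: rhoV.
  apply: memv_eq (dE _) _.
  by apply: mem_chart_dist_T => //; exact: gSz.
- by rewrite GxE uP.
Qed.

End Plaques.

(** * Quasi-components of the leaf topology *)

Section LeafManifold.
Context {R : realType} {n : nat} (M : manifold R n) (S : tangent_distribution M).

Lemma ck_local m (W : normedModType R) k (U : set 'rV[R]_m) (f : 'rV[R]_m -> W) :
  (forall x, U x -> exists V : set 'rV[R]_m, V x /\ ck_on k V f) -> ck_on k U f.
Proof.
elim: k f => [|k IH] f H.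
  by move=> x /H[V [Vx fV]]; exact: fV.
split=> [x /H[V [Vx [df _]]]|v]; first exact: df.
by apply: IH => x /H[V [Vx [_ Df]]]; exists V; split=> //; exact: Df.
Qed.

Lemma smooth_near_on a b (U : set 'rV[R]_a) (f : 'rV[R]_a -> 'rV[R]_b) :
  (forall x, U x -> smooth_near x f) -> smooth_on U f.
Proof.
move=> H; apply/smooth_onE => k; apply: ck_local => x /H[V [oV Vx /smooth_onE fV]].
by exists V; split=> //; exact: fV.
Qed.

Lemma affine_smooth_near a b (x x0 : 'rV[R]_a) (Pm : 'M[R]_(a, b)) :
  smooth_near x (fun y => (y - x0) *m Pm).
Proof.
exists setT; split; [exact: openT|by []|].
apply/smooth_onE => k; apply: ck_mulmx; [exact: openT| |exact/ck_cst/openT].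
by apply: ckD; [exact: openT|exact/ck_id/openT|exact/ck_cst/openT].
Qed.

Lemma leaf_open_local (U : set M) :
  (forall q, U q -> exists Y, [/\ leaf_open S Y, Y q & Y `<=` U]) -> leaf_open S U.
Proof.
move=> H j W g oW gW; rewrite openE => x [Wx Ugx].
have [Y [oY Ygx YU]] := H _ Ugx.
have := oY _ _ _ oW gW; rewrite openE => /(_ x (conj Wx Ygx)).
by apply: filterS => y [? /YU ?].
Qed.

Hypothesis integ : forall q, integrable_at S (\dim (S q)) q.

(** A plaque is the tangent image of a ball, hence lies in one quasi-leaf. *)
Lemma plaque_nbhd q : exists Y, [/\ leaf_open S Y, Y q & Y `<=` quasi_leaf S q].
Proof.
have [r [u [Pm [[r0 u0] _ _ tg oY]]]] := plaque_through (integ q).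
have g0 : (chart_inv (chart_at q) \o u) 0 = q.
  by rewrite /= u0 chart_mapK//; exact: chart_at_dom.
eexists; split; [exact: oY|by exists 0 => //; exact: ballxx|].
by move=> _ [v vr <-] C hC Cq; apply: (tangent_segment tg hC) => //; rewrite g0.
Qed.

Lemma quasi_leaf_open p : leaf_open S (quasi_leaf S p).
Proof.
apply: leaf_open_local => q pq; have [Y [oY Yq YU]] := plaque_nbhd q.
by exists Y; split=> // z /YU; exact: quasi_leaf_trans.
Qed.

Lemma quasi_leafC_open p : leaf_open S (~` quasi_leaf S p).
Proof.
apply: leaf_open_local => q npq; have [Y [oY Yq YU]] := plaque_nbhd q.
exists Y; split=> // z /YU qz pz; apply: npq.
exact: quasi_leaf_trans pz (quasi_leaf_sym qz).
Qed.

(** The dimension is locally constant in M, so its level sets are leaf-clopen. *)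
Lemma quasi_leaf_dim p q : quasi_leaf S p q -> \dim (S q) = \dim (S p).
Proof.
move=> /(_ [set z | \dim (S z) = \dim (S p)]); apply=> //; split.
- apply: open_leaf_open; rewrite openE => z /= zp.
  by have := integrable_dim_near (integ z); rewrite zp.
- apply: open_leaf_open; rewrite openE => z /= zp.
  by apply: filterS (integrable_dim_near (integ z)) => y /= ->.
Qed.

End LeafManifold.

Section LeafType.
Context {R : realType} {n : nat} {M : manifold R n}.

(** A quasi-leaf as a space of its own: it carries the leaf topology, in general
finer than the topology induced from M. *)
Definition leaf_type (S : tangent_distribution M) (p : M) : Type :=
  {q : M | quasi_leaf S p q}.

Variables (S : tangent_distribution M) (p : M).

Definition leaf_val (x : leaf_type S p) : M := proj1_sig x.

Lemma leaf_valP (x : leaf_type S p) : quasi_leaf S p (leaf_val x).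
Proof. exact: proj2_sig. Qed.

Lemma leaf_val_inj : injective leaf_val.
Proof.
move=> [x hx] [y hy]; rewrite /leaf_val /= => xy.
by move: hx hy; rewrite xy => hx hy; congr exist; exact: Prop_irrelevance.
Qed.

HB.instance Definition _ := gen_eqMixin (leaf_type S p).
HB.instance Definition _ := gen_choiceMixin (leaf_type S p).

Definition leaf_type_open (U : set (leaf_type S p)) : Prop :=
  exists2 Y, leaf_open S Y & U = leaf_val @^-1` Y.

Lemma leaf_type_openT : leaf_type_open setT.
Proof. by exists setT => //; exact: leaf_openT. Qed.

Lemma leaf_type_openI : setI_closed leaf_type_open.
Proof.
move=> _ _ [Y1 o1 ->] [Y2 o2 ->]; exists (Y1 `&` Y2) => //.
exact: leaf_openI.
Qed.

Lemma leaf_type_open_bigcup (I : Type) (f : I -> set (leaf_type S p)) :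
  (forall i, leaf_type_open (f i)) -> leaf_type_open (\bigcup_i f i).
Proof.
move=> /= H; have /choice[Y YP] : forall i, exists Y, leaf_open S Y /\
    f i = leaf_val @^-1` Y by move=> i; have [Y] := H i; exists Y.
exists (\bigcup_i Y i); first by apply: leaf_open_bigcup => i; have [] := YP i.
by rewrite preimage_bigcup; apply: eq_bigcupr => i _; have [] := YP i.
Qed.

HB.instance Definition _ := isOpenTopological.Build (leaf_type S p)
  leaf_type_openT leaf_type_openI leaf_type_open_bigcup.

Lemma leaf_type_openE (U : set (leaf_type S p)) : open U = leaf_type_open U.
Proof. by []. Qed.

Lemma leaf_val_continuous : continuous leaf_val.
Proof.
apply/continuousP => A oA; rewrite leaf_type_openE; exists A => //.
exact: open_leaf_open.
Qed.

Lemma leaf_type_hausdorff : hausdorff_space (leaf_type S p).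
Proof.
move=> x y xy; apply: leaf_val_inj; apply: (@carrier_hausdorff _ _ M).
move=> A B xA yB.
have [z [Az Bz]] := xy _ _ (leaf_val_continuous xA) (leaf_val_continuous yB).
by exists (leaf_val z).
Qed.

Hypothesis integ : forall q, integrable_at S (\dim (S q)) q.

(** A clopen subset of the quasi-leaf is leaf-clopen in M, as the quasi-leaf
itself is; such a set contains the whole quasi-leaf of each of its points. *)
Lemma leaf_type_connected : connected [set: leaf_type S p].
Proof.
move=> B [b Bb] [C1 + E1] [C2 + E2].
rewrite setTI in E1; rewrite setTI in E2; rewrite -E1 -E2 -openC.
rewrite !leaf_type_openE => -[Y1 o1 B1] [Y2 o2 B2].
apply/seteqP; split=> // z _.
pose A := Y1 `&` quasi_leaf S p.
have hA : leaf_clopen S A.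
  split; first by apply: leaf_openI => //; exact: quasi_leaf_open.
  apply: leaf_open_local => q nAq; have [pq|npq] := pselect (quasi_leaf S p q).
    have Y2q : Y2 q.
      have : (~` B) (exist _ q pq) by rewrite B1 => Y1q; apply: nAq; split.
      by rewrite B2.
    exists (Y2 `&` quasi_leaf S p); split=> //.
      by apply: leaf_openI => //; exact: quasi_leaf_open.
    move=> w [Y2w pw] [Y1w _].
    have : (~` B) (exist _ w pw) by rewrite B2.
    by rewrite B1; apply.
  exists (~` quasi_leaf S p); split=> //; first exact: quasi_leafC_open.
  by move=> w npw [_].
have Ab : A (leaf_val b) by split; [have := Bb; rewrite B1|exact: leaf_valP].
have [Y1z _] : A (leaf_val z).
  by apply: (quasi_leaf_trans (quasi_leaf_sym (leaf_valP b)) (leaf_valP z)).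
by rewrite B1.
Qed.

End LeafType.

(** * Leaves, and maps between spaces of leaves *)

Section LeafIntegralManifold.
Context {R : realType} {n : nat} (M : manifold R n) (S : tangent_distribution M).
Hypothesis integ : forall q, integrable_at S (\dim (S q)) q.

(** The chart is the inverse of the plaque parametrization; since
(u v - x0) * Pm = v, it is the restriction of a map that is affine in the chart
of M. *)
Lemma leaf_chart k (p : M) (q : leaf_type S p) : integrable_at S k (leaf_val q) ->
  exists (ch : chart R k (leaf_type S p)) (u : 'rV[R]_k -> 'rV[R]_n) (Pm : 'M[R]_(n, k)) r,
  [/\ [/\ 0 < r, u 0 = chart_coord (leaf_val q), chart_dom ch q & chart_cod ch = ball 0 r],
      (forall v, ball 0 r v -> chart_cod (chart_at (leaf_val q)) (u v)) /\ cinfty_on (ball 0 r) u,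
      (exists L0, [/\ is_diff 0 u (mulmx^~ L0), L0 *m Pm = 1%:M &
         forall v, v \in S (leaf_val q) <-> v = v *m Pm *m L0]),
      (forall v, ball 0 r v -> leaf_val (chart_inv ch v) = chart_inv (chart_at (leaf_val q)) (u v)) &
      (forall z, chart_dom ch z -> chart_dom (chart_at (leaf_val q)) (leaf_val z)) /\
      (forall z, chart_map ch z =
         (chart_map (chart_at (leaf_val q)) (leaf_val z) - chart_coord (leaf_val q)) *m Pm)].
Proof.
move=> /plaque_through[r [u [Pm [[r0 u0] [ucod uoo] [uP L0P] tg oY]]]].
set c := chart_at (leaf_val q) in ucod tg oY *.
have dq : chart_dom c (leaf_val q) := chart_at_dom (leaf_val q).
pose g := chart_inv c \o u.
have g0 : g 0 = leaf_val q by rewrite /g /= u0 chart_mapK.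
have gq v : ball 0 r v -> quasi_leaf S (leaf_val q) (g v).
  by move=> vr C hC Cq; apply: (tangent_segment tg hC) => //; rewrite -/g g0.
have /choice[inv invP] : forall v, exists z : leaf_type S p, ball 0 r v -> leaf_val z = g v.
  move=> v; have [vr|nvr] := pselect (ball 0 r v); last by exists q.
  have pv : quasi_leaf S p (g v) := quasi_leaf_trans (leaf_valP q) (gq v vr).
  by exists (exist _ (g v) pv).
pose dom := [set z : leaf_type S p | (g @` ball 0 r) (leaf_val z)].
pose mp (z : leaf_type S p) := (chart_map c (leaf_val z) - chart_coord (leaf_val q)) *m Pm.
have oB : open (ball (0 : 'rV[R]_k) r) by exact: ball_open.
have mg z v : ball 0 r v -> leaf_val z = g v -> mp z = v.
  by move=> vr zv; rewrite /mp zv /g /= chart_invK ?uP//; exact: ucod.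
have domc z : dom z -> chart_dom c (leaf_val z).
  by move=> [v vr <-]; apply: chart_inv_dom; exact: ucod.
have od : open dom by rewrite leaf_type_openE; exists (g @` ball 0 r).
have mcod z : dom z -> ball 0 r (mp z).
  by move=> [v vr zv]; rewrite (mg z v).
have invd v : ball 0 r v -> dom (inv v).
  by move=> vr; exists v => //; rewrite invP.
have mK z : dom z -> inv (mp z) = z.
  move=> [v vr zv]; rewrite (mg z v)//; apply: leaf_val_inj.
  by rewrite invP.
have iK v : ball 0 r v -> mp (inv v) = v.
  by move=> vr; apply: mg => //; exact: invP.
have mc z : dom z -> {for z, continuous mp}.
  move=> dz; have sm := smooth_near_diff (affine_smooth_near (chart_map c (leaf_val z)) (chart_coord (leaf_val q)) Pm).
  have cc : {for z, continuous (chart_map c \o @leaf_val _ _ _ S p)}.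
    apply: continuous_comp; first exact: leaf_val_continuous.
    by apply: chart_map_continuous; exact: domc.
  exact: (continuous_comp cc (differentiable_continuous sm)).
have ic v : ball 0 r v -> {for v, continuous inv}.
  move=> vr A; rewrite nbhsE => -[B [+ Bv] BA]; rewrite leaf_type_openE => -[Y oY1 BY].
  have := oY1 _ _ _ oB tg; rewrite openE => /(_ v).
  have hv : (ball 0 r `&` g @^-1` Y) v.
    by split=> //=; have := Bv; rewrite BY /= invP.
  move=> /(_ hv); apply: filterS => w [wr Yw]; apply: BA.
  by rewrite BY /= invP.
exists (Chart od oB mcod invd mK iK mc ic), u, Pm, r; split=> //.
- by split=> //; exists 0 => //; exact: ballxx.
Qed.

(** Transition maps of plaques are smooth: they are compositions of a plaque
parametrization, a transition map of M and an affine map. *)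
Lemma quasi_leaf_integral p : connected_integral_manifold S (quasi_leaf S p).
Proof.
set k := \dim (S p).
have ik (q : leaf_type S p) : integrable_at S k (leaf_val q).
  by rewrite /k -(quasi_leaf_dim integ (leaf_valP q)); exact: integ.
have /choice[ch chP] := fun q => leaf_chart (ik q).
have chd q : chart_dom (ch q) q by have [u [Pm [r [[]]]]] := chP q.
have compat d d' : range ch d -> range ch d' ->
    smooth_on (chart_cod d `&` chart_inv d @^-1` chart_dom d') (chart_map d' \o chart_inv d).
  move=> [q _ <-] [q' _ <-]; apply: smooth_near_on => v [vc dv].
  have [u [Pm [r [[r0 u0 _ codE] [ucod uoo] _ invE _]]]] := chP q.
  have [u' [Pm' [r' [_ _ _ _ [dom' map']]]]] := chP q'.
  rewrite codE in vc.
  have oB : open (ball (0 : 'rV[R]_k) r) by exact: ball_open.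
  set c := chart_at (leaf_val q) in ucod invE *.
  set c' := chart_at (leaf_val q') in dom' map' *.
  have [ac ac'] := (chart_at_atlas (leaf_val q), chart_at_atlas (leaf_val q')).
  have cv := ucod v vc; have d1 := chart_inv_dom cv.
  have d2 : chart_dom c' (chart_inv c (u v)) by rewrite -invE//; exact: dom'.
  have us : smooth_near v u by exists (ball 0 r); split=> //; exact/smooth_onE.
  have ts : smooth_near (u v) (chart_map c' \o chart_inv c).
    by have := transition_smooth ac ac' d1 d2; rewrite chart_invK.
  have as_ := affine_smooth_near ((chart_map c' \o chart_inv c) (u v)) (chart_coord (leaf_val q')) Pm'.
  have := smooth_near_comp us (smooth_near_comp ts as_).
  apply: smooth_near_ext.
  apply: filterS (open_nbhs_nbhs (conj oB vc)) => w wr /=.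
  by rewrite map' invE.
pose N := @Manifold R k (leaf_type S p) (@leaf_type_hausdorff _ _ _ S p)
  (range ch) ch (fun q => ex_intro2 _ _ q I erefl) chd compat.
have vals : @smooth R k n N M (@leaf_val _ _ _ S p) /\ forall q : N,
    lker (@tangent_map R k n N M (@leaf_val _ _ _ S p) q) = 0%VS /\
    limg (@tangent_map R k n N M (@leaf_val _ _ _ S p) q) = S (leaf_val q).
  suff H (q : N) : smooth_near (@chart_coord R k N q) (@local_rep R k n N M (@leaf_val _ _ _ S p) q) /\
    exists L0 Pm, [/\ is_diff (@chart_coord R k N q) (@local_rep R k n N M (@leaf_val _ _ _ S p) q) (mulmx^~ L0),
      L0 *m Pm = 1%:M & forall v, v \in S (leaf_val q) <-> v = v *m Pm *m L0].
    split; first by split; [exact: leaf_val_continuous|move=> q; have [] := H q].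
    move=> q; have [_ [L0 [Pm [dE LP memS]]]] := H q.
    have tE v : @tangent_map R k n N M (@leaf_val _ _ _ S p) q v = v *m L0.
      apply: etrans (linfunE _ _) _.
      exact: (congr1 (fun F : _ -> _ => F v) (is_diffE dE)).
    split.
      apply/eqP/lker0P => v w; rewrite !tE => E.
      by have := congr1 (mulmx^~ Pm) E; rewrite -!mulmxA LP !mulmx1.
    apply/vspaceP => w; apply/idP/idP.
      move=> /memv_imgP[v _ ->]; apply: memv_eq (tE v) _; apply/memS.
      by rewrite -[v *m L0 *m Pm]mulmxA LP mulmx1.
    move=> /memS wE; apply/memv_imgP; exists (w *m Pm); first exact: memvf.
    by rewrite tE.
  have [u [Pm [r [[r0 u0 dq codE] [ucod uoo] [L0 [uL LP memS]] invE [_ mapE]]]]] := chP q.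
  have q0 : @chart_coord R k N q = 0.
    by rewrite /chart_coord [LHS]mapE subrr mul0mx.
  have oB : open (ball (0 : 'rV[R]_k) r) by exact: ball_open.
  have nE : {near (0 : 'rV[R]_k), u =1 @local_rep R k n N M (@leaf_val _ _ _ S p) q}.
    apply: filterS (open_nbhs_nbhs (conj oB (ballxx _ r0))) => v vr.
    by rewrite /local_rep /= invE// chart_invK//; exact: ucod.
  rewrite q0; split.
    by apply: smooth_near_ext nE _; exact: smooth_near_ball r0 uoo.
  exists L0, Pm; split=> //.
  exact: near_eq_is_diff nE uL.
have [vs vt] := vals.
exists k, N, (@leaf_val _ _ _ S p); split=> //.
- exact: leaf_type_connected.
- exact: leaf_val_inj.
- apply/seteqP; split=> [q pq|_ [x _ <-]]; last exact: leaf_valP.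
  by exists (exist _ q pq).
Qed.

Lemma integral_manifold_sub_quasi_leaf L p :
  connected_integral_manifold S L -> L p -> L `<=` quasi_leaf S p.
Proof.
move=> [k [N [i [cN si _ ti ->]]]] [x _ <-] _ [y _ <-].
apply: tangent_map_quasi_leaf => // q.
by have [_ ->] := ti q.
Qed.

Lemma quasi_leaf_is_leaf p : is_leaf S (quasi_leaf S p).
Proof.
split; first exact: quasi_leaf_integral.
move=> L' intL' pL'; apply/seteqP; split=> //.
by apply: integral_manifold_sub_quasi_leaf => //; apply: pL'; exact: quasi_leaf_refl.
Qed.

Lemma same_leafP p q : same_leaf S p q <-> quasi_leaf S p q.
Proof.
split=> [[L [[intL _] Lp Lq]]|pq].
  exact: integral_manifold_sub_quasi_leaf intL Lp _ Lq.
by exists (quasi_leaf S p); split=> //; exact: quasi_leaf_is_leaf.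
Qed.

Lemma leaf_through_eq p q : leaf_through S p = leaf_through S q <-> same_leaf S p q.
Proof.
split=> [E|pq].
  have : leaf_through S q q by apply/same_leafP; exact: quasi_leaf_refl.
  by rewrite -E.
have {}pq := (same_leafP p q).1 pq.
apply/seteqP; split=> z /same_leafP pz; apply/same_leafP.
  exact: quasi_leaf_trans (quasi_leaf_sym pq) pz.
exact: quasi_leaf_trans pq pz.
Qed.

(** Points of the leaf space carry a proof, so equality uses proof
irrelevance. *)
Lemma leaf_proj_eq p q : leaf_proj S p = leaf_proj S q <-> same_leaf S p q.
Proof.
rewrite -leaf_through_eq; split=> [|E]; first by move=> /(congr1 (@proj1_sig _ _)).
rewrite /leaf_proj; move: (ex_intro _ p _) (ex_intro _ q _); rewrite E => h1 h2.
by congr exist; exact: Prop_irrelevance.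
Qed.

End LeafIntegralManifold.

Section InducedMaps.
Context {R : realType} {n n' : nat} (M : manifold R n) (M' : manifold R n').
Variables (S : tangent_distribution M) (S' : tangent_distribution M') (f : M -> M').
Hypothesis fs : smooth f.
Hypothesis fS : forall q v, v \in S q -> tangent_map f q v \in S' (f q).

Lemma tangent_on_comp j (W : set 'rV[R]_j) g :
  tangent_on S W g -> tangent_on S' W (f \o g).
Proof.
have [fc fsm] := fs.
move=> gW x Wx; have [gc gs gS] := gW x Wx.
have fgc : {for x, continuous (f \o g)} by apply: continuous_comp => //; exact: fc.
have nE : {near x, local_rep f (g x) \o (chart_map (chart_at (g x)) \o g)
    =1 chart_map (chart_at (f (g x))) \o (f \o g)}.
  have gN : nbhs x (g @^-1` chart_dom (chart_at (g x))) by exact/gc/nbhs_chart_at.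
  by apply: filterS gN => y dy; rewrite /local_rep /= chart_mapK.
split=> //.
  by apply: smooth_near_ext nE _; apply: smooth_near_comp => //; exact: fsm.
move=> h.
have dE := @diff_comp_near _ _ _ _ _ _ _ x (chart_coord (g x)) erefl
  (smooth_near_diff gs) (smooth_near_diff (fsm _)) nE h.
apply: memv_eq dE _; apply: memv_eq (fS (gS h)).
exact/esym/linfunE.
Qed.

Lemma quasi_leaf_map p q : quasi_leaf S p q -> quasi_leaf S' (f p) (f q).
Proof.
have pre U : leaf_open S' U -> leaf_open S (f @^-1` U).
  by move=> oU j W g oW gW; exact: oU oW (tangent_on_comp gW).
move=> pq C [oC cC]; apply: (pq (f @^-1` C)).
by split; [exact: pre|exact: (pre (~` C))].
Qed.

Hypothesis integ : forall q, integrable_at S (\dim (S q)) q.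
Hypothesis integ' : forall q, integrable_at S' (\dim (S' q)) q.

Lemma same_leaf_map p q : same_leaf S p q -> same_leaf S' (f p) (f q).
Proof.
by move=> /(same_leafP integ) pq; apply/(same_leafP integ'); exact: quasi_leaf_map.
Qed.

(** Existence chooses a representative of each leaf; uniqueness holds since every
point of the leaf space is a projection. *)
Lemma induced_map_exists_unique :
  exists! F : leaf_space S -> leaf_space S', F \o leaf_proj S = leaf_proj S' \o f.
Proof.
have /choice[F FP] : forall L : leaf_space S, exists L', forall p, L = leaf_proj S p ->
    L' = leaf_proj S' (f p).
  move=> [L [p Lp]]; exists (leaf_proj S' (f p)) => q E.
  apply/(leaf_proj_eq integ'); apply: same_leaf_map.
  apply/(leaf_through_eq integ); rewrite -Lp.
  exact: (congr1 (@proj1_sig _ _) E).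
exists F; split; first by apply/funext => p /=; exact: FP.
move=> F' E; apply/funext => -[L [p Lp]].
have -> : exist _ L (ex_intro _ p Lp) = leaf_proj S p.
  by rewrite /leaf_proj; move: Lp => Lp'; subst L; congr exist; exact: Prop_irrelevance.
rewrite (FP _ p erefl).
exact: (congr1 (fun G : M -> _ => G p) (esym E)).
Qed.

End InducedMaps.

(** * Involutive subbundles are integrable *)

Section SecondOrder.
Context {R : realType}.

(** The Leibniz rule for y |-> 'd f y (Y y), obtained by expanding in the partial
derivatives of f. *)
Lemma is_derive_diff_field m n (U : set 'rV[R]_m) (f : 'rV[R]_m -> 'rV[R]_n)
    (Y : 'rV[R]_m -> 'rV[R]_m) x w : open U -> U x -> ck_on 2 U f ->
  differentiable Y x ->
  is_derive x w (fun y => 'd f y (Y y)) ('d f x ('d Y x w) + 'D_w ('D_(Y x) f) x).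
Proof.
move=> oU Ux [df Df] dY.
have dDf i : differentiable ('D_('e_i) f) x by have [+ _] := Df 'e_i; exact.
have xU : nbhs x U by exact: open_nbhs_nbhs.
have E1 : {near x, (fun y => \sum_(i < m) Y y 0 i *: 'D_('e_i) f y) =1
                   (fun y => 'd f y (Y y))}.
  apply: filterS xU => y Uy; rewrite [RHS]diff_sumE.
  by apply: eq_bigr => i _; rewrite deriveE//; exact: df.
have E2 : 'D_w ('D_(Y x) f) x = \sum_(i < m) Y x 0 i *: 'D_w ('D_('e_i) f) x.
  have nE : {near x, (fun y => \sum_(i < m) Y x 0 i *: 'D_('e_i) f y) =1 'D_(Y x) f}.
    apply: filterS xU => y Uy; rewrite [RHS]deriveE; last exact: df.
    rewrite [RHS]diff_sumE; apply: eq_bigr => i _; rewrite deriveE//; exact: df.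
  rewrite -(near_eq_derive _ nE).
  have H : is_diff x (fun y => \sum_(i < m) Y x 0 i *: 'D_('e_i) f y)
      (fun h => \sum_(i < m) Y x 0 i *: 'd ('D_('e_i) f) x h).
    apply: is_diff_sum => i; have di := differentiableP (dDf i).
    exact: is_diffZ.
  rewrite (is_diff_derive _ H); apply: eq_bigr => i _.
  by rewrite deriveE.
have Yi i : is_diff x (fun y => Y y 0 i) (fun h => 'd Y x h 0 i).
  have dY' := differentiableP dY.
  have c := differentiable_coord (Y x) 0 i.
  have [cd cE] : is_diff (Y x) (fun N : 'rV[R]_m => N 0 i) (fun N : 'rV[R]_m => N 0 i).
    have @l : {linear 'rV[R]_m -> R}.
      by exists (fun N : 'rV[R]_m => N 0 i); do 2![eexists]; do ?[constructor];
         rewrite ?mxE// => ? *; rewrite ?mxE//; move=> ?; rewrite !mxE.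
    exact: (linear_is_diff l).
  have cd' : is_diff (Y x) (fun N : 'rV[R]_m => N 0 i) (fun N : 'rV[R]_m => N 0 i).
    exact: DiffDef.
  exact: (is_diff_comp dY' cd').
have H : is_diff x (fun y => \sum_(i < m) Y y 0 i *: 'D_('e_i) f y)
   (fun h => \sum_(i < m) (Y x 0 i *: 'd ('D_('e_i) f) x h + 'd Y x h 0 i *: 'D_('e_i) f x)).
  apply: is_diff_sum => i; have di := differentiableP (dDf i).
  exact: is_diffZ_fun.
have H' := near_eq_is_diff E1 H.
apply: DeriveDef; first by have [Hd _] := H'; exact: diff_derivable.
apply: etrans (is_diff_derive w H') _.
rewrite E2 big_split /= addrC; congr (_ + _); last first.
  by apply: eq_bigr => i _; rewrite deriveE.
apply/esym; apply: etrans (diff_sumE _ _ _) _.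
by apply: eq_bigr => i _; rewrite deriveE//; exact: df.
Qed.

(** Naturality of the bracket: in the difference the second derivatives of f
cancel, by [derive_schwarz]. *)
Lemma bracket_push m n (U : set 'rV[R]_m) (f : 'rV[R]_m -> 'rV[R]_n)
    (X Y : 'rV[R]_m -> 'rV[R]_m) x :
  open U -> U x -> ck_on 2 U f -> differentiable X x -> differentiable Y x ->
  'D_(X x) (fun y => 'd f y (Y y)) x - 'D_(Y x) (fun y => 'd f y (X y)) x =
  'd f x ('d Y x (X x) - 'd X x (Y x)).
Proof.
move=> oU Ux f2 dX dY.
have [_ ->] := is_derive_diff_field (X x) oU Ux f2 dY.
have [_ ->] := is_derive_diff_field (Y x) oU Ux f2 dX.
by rewrite (derive_schwarz _ _ oU Ux f2) linearB opprD addrACA subrr addr0.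
Qed.

Lemma diff_row m k n (B : 'rV[R]_m -> 'M[R]_(k, n)) x z j :
  differentiable B x ->
  row j ('d B x z) = 'd (fun y => row j (B y)) x z.
Proof.
move=> /differentiableP dB.
pose l := row j : {linear 'M[R]_(k, n) -> 'rV[R]_n}.
have H := is_diffE (is_diff_comp dB (linear_is_diff l (B x))).
exact: (congr1 (fun F : _ -> _ => F z) (esym H)).
Qed.

Lemma smooth_near_family m n k (x : 'rV[R]_m) (f : 'I_k -> 'rV[R]_m -> 'rV[R]_n)
    (N : set 'rV[R]_m) : (forall i, smooth_near x (f i)) -> nbhs x N ->
  exists r, [/\ 0 < r, ball x r `<=` N & forall i, cinfty_on (ball x r) (f i)].
Proof.
move=> fs xN; have /choice[U UP] := fs.
have UN i : \forall y \near x, U i y by have [oU Ux _] := UP i; exact: open_nbhs_nbhs.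
have /nbhs_ballP[r /= r0 rP] : nbhs x (N `&` (fun y => forall i, U i y)).
  by apply: filterI => //; exact: filter_forall UN.
exists r; split=> // [y /rP[]//|i j].
have [_ _ /smooth_onE fU] := UP i.
by apply: ck_sub (fU j) => y /rP[_]; exact.
Qed.

End SecondOrder.

Section FrameIntegrable.
Context {R : realType} {n : nat} (M : manifold R n) (S : tangent_distribution M).

(** [frame_normalize] in the preferred chart at p, for a frame of S whose
brackets lie in S. *)
Lemma frame_integrable k p (W : set 'rV[R]_n) (B : 'rV[R]_n -> 'M[R]_(k, n)) :
  open W -> W (chart_coord p) -> W `<=` chart_cod (chart_at p) -> cinfty_on W B ->
  row_free (B (chart_coord p)) ->
  (forall x, W x -> \dim (chart_dist S (chart_at p) x) = k) ->
  (forall x, W x -> forall i, row i (B x) \in chart_dist S (chart_at p) x) ->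
  (forall x, W x -> forall i j,
     'd (fun y => row j (B y)) x (row i (B x)) - 'd (fun y => row i (B y)) x (row j (B x))
       \in chart_dist S (chart_at p) x) ->
  integrable_at S k p.
Proof.
move=> oW Wp WC Boo Bf dT BT br.
have dB x : W x -> differentiable B x by have [+ _] := Boo 1%N; exact.
have br' x : W x -> forall i j,
     row j ('d B x (row i (B x))) - row i ('d B x (row j (B x)))
       \in chart_dist S (chart_at p) x.
  move=> Wx i j; have H := br x Wx i j; apply: memv_eq H.
  by congr (_ - _); apply: diff_row; exact: dB.
have [V [L [Pm [[oV Vp VW] Loo LP mem comm]]]] := frame_normalize oW Wp Boo Bf dT BT br'.
exists V, L, Pm; split=> //.
by split=> // x /VW; [exact: WC|exact: dT].
Qed.

End FrameIntegrable.

Section SubbundleIntegrable.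
Context {R : realType} {n : nat} (M : manifold R n) (S : tangent_distribution M).

Lemma field_rep_transition (X : vector_field M) p q : chart_dom (chart_at p) q ->
  {near chart_coord q, field_rep X p \o (chart_map (chart_at p) \o chart_inv (chart_at q)) =1
    fun y => 'd (chart_map (chart_at p) \o chart_inv (chart_at q)) y (field_rep X q y)}.
Proof.
move=> pq; have [aq dq] := (chart_at_atlas q, chart_at_dom q).
have ap := chart_at_atlas p.
apply: filterS (near_chart_inv dq (nbhs_chart_dom pq)) => y [cy py] /=.
rewrite /field_rep /=.
set z := chart_inv (chart_at q) y in py *.
have dz : chart_dom (chart_at q) z by exact: chart_inv_dom.
have yE : y = chart_map (chart_at q) z by rewrite /z chart_invK.
rewrite chart_mapK//.
have [az dz'] := (chart_at_atlas z, chart_at_dom z).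
rewrite [X in 'd _ X _ = _](_ : _ = chart_map (chart_at z) z)//.
rewrite [X in _ = 'd _ X _]yE; apply/esym.
exact: transition_diff_comp.
Qed.

Lemma field_rep_at (X : vector_field M) q : field_rep X q (chart_coord q) = X q.
Proof.
have dq := chart_at_dom q.
rewrite /field_rep /chart_coord chart_mapK//.
exact: transition_diff_id.
Qed.

(** The bracket is defined at each point in its own preferred chart. By
[bracket_push] applied to the transition map, it is computed near p in
the single chart at p. *)
Lemma bracket_in_chart (X Y : vector_field M) p q : chart_dom (chart_at p) q ->
  smooth_near (chart_coord q) (field_rep X q) ->
  smooth_near (chart_coord q) (field_rep Y q) ->
  let x := chart_map (chart_at p) q in
  differentiable (field_rep X p) x -> differentiable (field_rep Y p) x ->
  'd (field_rep Y p) x (field_rep X p x) - 'd (field_rep X p) x (field_rep Y p x) =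
  'd (chart_map (chart_at p) \o chart_inv (chart_at q)) (chart_coord q) (lie_bracket X Y q).
Proof.
move=> pq sX sY x dX dY.
have [aq dq] := (chart_at_atlas q, chart_at_dom q); have ap := chart_at_atlas p.
set tau := chart_map (chart_at p) \o chart_inv (chart_at q).
have ts : smooth_near (chart_coord q) tau by exact: transition_smooth.
have tx : x = tau (chart_coord q) by rewrite /tau /= chart_mapK.
have [U [oU Uq /smooth_onE tU]] := ts.
have dtau := smooth_near_diff ts.
have push (Z : vector_field M) : differentiable (field_rep Z p) x ->
    forall w, 'd (field_rep Z p) x ('d tau (chart_coord q) w) =
      'D_w (fun y => 'd tau y (field_rep Z q y)) (chart_coord q).
  move=> dZ w.
  have nE := field_rep_transition Z pq.
  rewrite -(near_eq_derive _ nE).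
  have dd := differentiableP dZ; rewrite tx in dd.
  have dt := differentiableP dtau.
  by rewrite (is_diff_derive _ (is_diff_comp dt dd)) /= -tx.
have valx (Z : vector_field M) : field_rep Z p x = 'd tau (chart_coord q) (Z q).
  have := nbhs_singleton (field_rep_transition Z pq).
  by rewrite /= field_rep_at tx.
have EX := etrans (congr1 ('d (field_rep Y p) x) (valx X)) (push Y dY (X q)).
have EY := etrans (congr1 ('d (field_rep X p) x) (valx Y)) (push X dX (Y q)).
apply: etrans (congr2 (fun a b => a - b) EX EY) _.
have := bracket_push oU Uq (tU 2%N) (smooth_near_diff sX) (smooth_near_diff sY).
rewrite !field_rep_at => P; apply: etrans P _.
apply: (congr1 ('d tau (chart_coord q))).
by rewrite /lie_bracket !deriveE//; exact: smooth_near_diff.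
Qed.

(** Sections through a basis of S p form a frame: they are independent at p, and
the rank is constant. *)
Lemma subbundle_integrable : subbundle S -> involutive_distribution S ->
  forall p, integrable_at S (\dim (S p)) p.
Proof.
move=> [smS [k dimS]] invS p; rewrite dimS.
have [ap dp] := (chart_at_atlas p, chart_at_dom p).
pose b := vbasis (S p).
have /choice[UX UXP] : forall i : 'I_(\dim (S p)), exists UX : set M * vector_field M,
    [/\ open UX.1, UX.1 p, section_on S UX.1 UX.2 & UX.2 p = tnth b i].
  move=> i; have bi : tnth b i \in S p by apply: vbasis_mem; exact: mem_tnth.
  by have [U [X H]] := smS p _ bi; exists (U, X).
pose U i := (UX i).1; pose X i := (UX i).2.
rewrite -(dimS p).
pose B (x : 'rV[R]_n) : 'M[R]_(\dim (S p), n) := \matrix_i field_rep (X i) p x.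
have BE i x : row i (B x) = field_rep (X i) p x by rewrite rowK.
have UN : nbhs p (fun q => forall i, U i q).
  apply: filter_forall => i; have [oU Up _ _] := UXP i.
  exact: open_nbhs_nbhs.
have sX i : smooth_near (chart_coord p) (field_rep (X i) p).
  by have [_ Up [sm _] _] := UXP i; exact: sm.
have [r [r0 rN Xoo]] := smooth_near_family sX (near_chart_inv dp UN).
apply: (@frame_integrable _ _ _ _ _ _ (ball (chart_coord p) r) B).
- exact: ball_open.
- exact: ballxx.
- by move=> x /rN[].
- move=> j; apply: ck_mx => [|i a]; first exact: ball_open.
  have := ck_entry 0 a (@ball_open _ _ (chart_coord p) r) (Xoo i j).
  by apply: ck_ext => [|x _]; [exact: ball_open|rewrite !mxE].
- apply: inj_row_free => w; rewrite mulmx_sum_row => wB.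
  have bf : free b by have := vbasisP (S p); rewrite basisEfree => /andP[].
  have /freeP := bf => /(_ (fun i => w 0 i)) H.
  apply/rowP => i; rewrite mxE; apply: H.
  rewrite -[RHS]wB; apply: eq_bigr => l _; rewrite BE field_rep_at.
  by have [_ _ _ E] := UXP l; rewrite /X E (tnth_nth 0).
- move=> x /rN[cx _]; rewrite -{1}(chart_invK cx) dim_chart_dist ?dimS//.
  exact: chart_inv_dom.
- move=> x xr i; have [cx Ux] := rN x xr; rewrite BE -{2}(chart_invK cx) /field_rep.
  apply: mem_chart_dist_T => //; first exact: chart_inv_dom.
  by have [_ _ [_ +] _] := UXP i; apply; exact: Ux.
- move=> x xr i j; have [cx Ux] := rN x xr.
  have -> : (fun y => row j (B y)) = field_rep (X j) p by apply/funext => y; exact: BE.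
  have -> : (fun y => row i (B y)) = field_rep (X i) p by apply/funext => y; exact: BE.
  rewrite !BE; set q := chart_inv (chart_at p) x.
  have xE : x = chart_map (chart_at p) q by rewrite chart_invK.
  have pq : chart_dom (chart_at p) q by exact: chart_inv_dom.
  have dX l : differentiable (field_rep (X l) p) x by have [+ _] := Xoo l 1%N; exact.
  have sXq l : smooth_near (chart_coord q) (field_rep (X l) q).
    by have [_ _ [sm _] _] := UXP l; apply: sm; exact: Ux.
  rewrite xE in dX *; rewrite (bracket_in_chart pq (sXq i) (sXq j) (dX i) (dX j)).
  apply: mem_chart_dist_T => //.
  apply: (invS (U i `&` U j)).
  + by apply: openI; [have [] := UXP i|have [] := UXP j].
  + have [_ _ [s1 s2] _] := UXP i.
    by split=> z [Uz _]; [exact: s1|exact: s2].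
  + have [_ _ [s1 s2] _] := UXP j.
    by split=> z [_ Uz]; [exact: s1|exact: s2].
  + by split; exact: Ux.
Qed.

End SubbundleIntegrable.

(** * The distribution induced on the base *)

Section Rank.
Context {R : realType}.

(** A compression Q * A x * W to the size of the rank, chosen to be the identity
at x0, remains invertible nearby. *)
Lemma mxrank_lower_semicontinuous m a b (U : set 'rV[R]_m) (A : 'rV[R]_m -> 'M[R]_(a, b)) x0 :
  open U -> U x0 -> ck_on 0 U A ->
  \forall x \near x0, (\rank (A x0) <= \rank (A x))%N.
Proof.
move=> oU Ux0 cA.
have [W WP] := row_freeP (row_base_free (A x0)).
have [Q QP] := row_fullP (col_base_full (A x0)).
pose F x := Q *m A x *m W.
have cF : ck_on 0 U (fun x => \det (F x)).
  have cQA := ck_mulmx oU (ck_cst 0 Q oU) cA.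
  exact: ck_det oU (ck_mulmx oU cQA (ck_cst 0 W oU)).
have QA : Q *m A x0 = row_base (A x0).
  by rewrite -[RHS]mul1mx -QP -mulmxA mulmx_base.
have F0 : \det (F x0) = 1 by rewrite /F QA WP det1.
have detc : {for x0, continuous (fun x => \det (F x))}.
  exact: (ck_continuous cF Ux0).
have /cvgrPdist_lt/(_ 1 ltr01) := detc; rewrite F0; apply: filterS => x h.
have Fu : F x \in unitmx.
  by rewrite unitmxE unitfE; apply: contraTneq h => ->; rewrite subr0 normr1 ltxx.
rewrite -(mxrank_unit Fu); apply: leq_trans (mxrankM_maxl _ _) _.
exact: mxrankM_maxr.
Qed.

Lemma mxrank_idempotentC k (E : 'M[R]_k) : E *m E = E ->
  (\rank (1%:M - E)%R = k - \rank E)%N.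
Proof.
move=> EE; rewrite -mxrank_ker.
have kE : kermx E *m E = 0 by apply/sub_kermxP.
apply/eqP; rewrite eqn_leq !mxrankS//.
  by apply/submxP; exists (kermx E); rewrite mulmxBr mulmx1 kE subr0.
by apply/sub_kermxP; rewrite mulmxBl mul1mx EE subrr.
Qed.

(** The ranks of E and 1 - E add up to k, and both can only increase near x0. *)
Lemma mxrank_idempotent_near m k (U : set 'rV[R]_m) (E : 'rV[R]_m -> 'M[R]_k) x0 :
  open U -> U x0 -> ck_on 0 U E -> (forall x, U x -> E x *m E x = E x) ->
  \forall x \near x0, \rank (E x) = \rank (E x0).
Proof.
move=> oU Ux0 cE EE.
have cE' : ck_on 0 U (fun x => 1%:M - E x).
  have := ckD oU (ck_cst 0 1%:M oU) (ckZ oU (@ck_cst R m R 0 U (-1) oU) cE).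
  by apply: ck_ext => // x _; rewrite scaleN1r.
have l1 := mxrank_lower_semicontinuous oU Ux0 cE.
have l2 := mxrank_lower_semicontinuous oU Ux0 cE'.
apply: filterS2 (filterI l1 l2) (open_nbhs_nbhs (conj oU Ux0)) => x [h1 h2] Ux.
rewrite !mxrank_idempotentC ?EE// in h2.
apply/eqP; rewrite eqn_leq h1 andbT.
by rewrite leq_sub2lE ?rank_leq_row// in h2.
Qed.

(** The rows of A may be replaced by a basis of the row space, for which the map
is injective. *)
Lemma dim_limg_mulmxr k n (A : 'M[R]_(k, n)) :
  \dim (limg (linfun (mulmxr A) : 'Hom('rV[R]_k, 'rV[R]_n))) = \rank A.
Proof.
pose l p (B : 'M[R]_(p, n)) : 'Hom('rV[R]_p, 'rV[R]_n) := linfun (mulmxr B).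
have lE p (B : 'M[R]_(p, n)) c : l p B c = c *m B by rewrite lfunE.
have lS p q (B : 'M[R]_(p, n)) (B' : 'M[R]_(q, n)) : (B <= B')%MS -> (limg (l p B) <= limg (l q B'))%VS.
  move=> BB; apply/subvP => _ /memv_imgP[c _ ->]; rewrite lE.
  have /submxP[D ->] : (c *m B <= B')%MS by exact: submx_trans (submxMl _ _) BB.
  by rewrite -lE; apply: memv_img; exact: memvf.
have /eqP -> : limg (l k A) == limg (l _ (row_base A)).
  by rewrite eqEsubv !lS ?eq_row_base.
rewrite limg_dim_eq ?dimvf ?/dim/= ?mul1n//.
suff /eqP -> : lker (l _ (row_base A)) == 0%VS by rewrite capv0.
apply/lker0P => c1 c2; rewrite !lE; exact/row_free_inj/row_base_free.
Qed.

End Rank.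

Section MapInChart.
Context {R : realType} {m n : nat} (M : manifold R m) (N : manifold R n).

Lemma map_in_chart (f : M -> N) q c c' : smooth f -> atlas c -> atlas c' ->
  chart_dom c q -> chart_dom c' (f q) ->
  smooth_near (chart_map c q) (chart_map c' \o f \o chart_inv c) /\
  forall v, 'd (chart_map c' \o f \o chart_inv c) (chart_map c q) v =
    'd (chart_map c' \o chart_inv (chart_at (f q))) (chart_coord (f q))
      (tangent_map f q ('d (chart_map (chart_at q) \o chart_inv c) (chart_map c q) v)).
Proof.
move=> [fc fs] ac ac' cq c'q.
have fcq : {for q, continuous f} by exact: fc.
have [s1 d1] := local_rep_chart fcq ac cq (fs q).
have [aq dq] := (chart_at_atlas (f q), chart_at_dom (f q)).
pose g := f \o chart_inv c.
have gq : g (chart_map c q) = f q by rewrite /g /= chart_mapK.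
have gc : {for chart_map c q, continuous g}.
  apply: continuous_comp; last exact: fc.
  by apply: chart_inv_continuous; exact: chart_map_cod.
have dq' : chart_dom (chart_at (f q)) (g (chart_map c q)) by rewrite gq.
have c'q' : chart_dom c' (g (chart_map c q)) by rewrite gq.
have [s2 d2] := curve_in_chart aq ac' dq' c'q' gc s1.
split; first exact: s2.
move=> v; apply: etrans (d2 v) _.
have E1 : chart_map (chart_at (f q)) (g (chart_map c q)) = chart_coord (f q).
  by rewrite gq.
rewrite E1; apply: (congr1 ('d (chart_map c' \o chart_inv (chart_at (f q))) (chart_coord (f q)))).
apply: etrans (d1 v) _; exact/esym/linfunE.
Qed.

End MapInChart.

Lemma ck_diff_mx {R : realType} {m n} (U : set 'rV[R]_m) (f : 'rV[R]_m -> 'rV[R]_n) : open U ->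
  cinfty_on U f -> cinfty_on U (fun x => lin1_mx ('d f x)).
Proof.
move=> oU fU j; apply: ck_mx => // a b.
have [df Df] := fU j.+1.
apply: ck_ext (ck_entry 0 b oU (Df 'e_a)) => // x Ux.
rewrite mxE deriveE//; exact: df.
Qed.

(** A distribution T of unknown rank on an open set of R^m, which is the preimage
under e of the span of the commuting frame L, and onto which the left inverse
sigma of e maps that span. *)
Section Retract.
Context {R : realType} {m n k : nat}.

Variables (W : set 'rV[R]_m) (x0 : 'rV[R]_m) (e : 'rV[R]_m -> 'rV[R]_n).
Variables (V : set 'rV[R]_n) (sigma : 'rV[R]_n -> 'rV[R]_m).
Variables (L : 'rV[R]_n -> 'M[R]_(k, n)) (Pm : 'M[R]_(n, k)).
Variable T : 'rV[R]_m -> {vspace 'rV[R]_m}.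
Hypotheses (oW : open W) (Wx0 : W x0) (oV : open V).
Hypotheses (eW : forall x, W x -> V (e x)) (eoo : cinfty_on W e) (soo : cinfty_on V sigma).
Hypothesis se : forall x, W x -> sigma (e x) = x.
Hypothesis Loo : cinfty_on V L.
Hypothesis LP : forall y, V y -> L y *m Pm = 1%:M.
Hypothesis commL : forall y, V y -> forall v w : 'rV[R]_k,
  w *m 'd L y (v *m L y) = v *m 'd L y (w *m L y).
Hypothesis memT : forall x, W x -> forall z,
  z \in T x <-> 'd e x z = 'd e x z *m Pm *m L (e x).
Hypothesis sT : forall x, W x -> forall c : 'rV[R]_k, 'd sigma (e x) (c *m L (e x)) \in T x.

Let De x := lin1_mx ('d e x).
Let Z x := L (e x) *m lin1_mx ('d sigma (e x)).
Let E x := Z x *m De x *m Pm.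

Let DeE x z : z *m De x = 'd e x z.
Proof. exact: mul_rV_lin1. Qed.

Let ZE x c : c *m Z x = 'd sigma (e x) (c *m L (e x)).
Proof. by rewrite mulmxA; exact: mul_rV_lin1. Qed.

Let ZT x c : W x -> c *m Z x \in T x.
Proof. by move=> Wx; apply: memv_eq (sT Wx c); exact: ZE. Qed.

Let de x : W x -> differentiable e x.
Proof. by move=> Wx; have [+ _] := eoo 1%N; exact. Qed.

Let retract x z : W x -> 'd sigma (e x) ('d e x z) = z.
Proof.
move=> Wx.
have ds : differentiable sigma (e x) by have [+ _] := soo 1%N; apply; exact: eW.
have nE : {near x, sigma \o e =1 id}.
  by apply: filterS (open_nbhs_nbhs (conj oW Wx)) => y Wy /=; exact: se.
have E1 := diff_comp_near erefl (de Wx) ds nE z.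
have /is_diffE E2 := @is_diff_id R _ x.
exact: etrans (esym E1) (congr1 (fun F : _ -> _ => F z) E2).
Qed.

(** The identity z = 'd sigma ('d e z) recovers z from the coordinates of
'd e z in the frame L. *)
Let TZ x z : W x -> z \in T x -> z = z *m De x *m Pm *m Z x.
Proof.
move=> Wx /(memT Wx) zE; rewrite ZE DeE.
apply: etrans (esym (retract z Wx)) _; exact: congr1 zE.
Qed.

Let TE x : W x -> T x = limg (linfun (mulmxr (Z x)) : 'Hom('rV[R]_k, 'rV[R]_m)).
Proof.
move=> Wx; apply/vspaceP => z; apply/idP/idP => [zT|/memv_imgP[c _ ->]].
  by rewrite (TZ Wx zT); apply/memv_imgP; exists (z *m De x *m Pm); rewrite ?memvf ?lfunE.
by rewrite lfunE; exact: ZT.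
Qed.

Let EZ x : W x -> E x *m Z x = Z x.
Proof.
move=> Wx; apply/row_matrixP => i; rewrite [RHS]rowE.
rewrite [RHS](TZ Wx (ZT _ Wx)) row_mul; congr (_ *m _).
by rewrite rowE /E !mulmxA.
Qed.

Let EE x : W x -> E x *m E x = E x.
Proof. by move=> Wx; rewrite -[X in _ *m X]/(Z x *m De x *m Pm) 2!mulmxA (EZ Wx). Qed.

Let rankE x : W x -> \rank (E x) = \rank (Z x).
Proof.
move=> Wx; apply/eqP; rewrite eqn_leq {1}/E -mulmxA mxrankM_maxl /=.
by rewrite -{1}(EZ Wx) mxrankM_maxl.
Qed.

Let Zoo : cinfty_on W Z.
Proof.
move=> j; have ej := eoo j.
have c1 := ck_comp oW eW ej (Loo j).
have c2 := ck_comp oW eW ej (ck_diff_mx oV soo j).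
exact: ck_mulmx oW c1 c2.
Qed.

Let Eoo : cinfty_on W E.
Proof.
move=> j; have c1 := ck_mulmx oW (Zoo j) (ck_diff_mx oW eoo j).
exact: ck_mulmx oW c1 (ck_cst j Pm oW).
Qed.

(** By [bracket_push] it suffices to differentiate 'd e y (c * Z y), which
is c * E y * L (e y). The terms that differentiate L cancel by commutation, and
the others lie in the span of L (e x). *)
Let bracketT x (c c' : 'rV[R]_k) : W x ->
  'd (fun y => c' *m Z y) x (c *m Z x) - 'd (fun y => c *m Z y) x (c' *m Z x) \in T x.
Proof.
move=> Wx.
have dZ (c1 : 'rV[R]_k) : differentiable (fun y => c1 *m Z y) x.
  have [+ _] := ck_mulmx oW (ck_cst 1 c1 oW) (Zoo 1); exact.
have dE z : is_derive x z E ('d E x z).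
  have dE : differentiable E x by have [+ _] := Eoo 1%N; exact.
  by apply: DeriveDef; [exact: diff_derivable|rewrite deriveE].
have dLe z : is_derive x z (L \o e) ('d L (e x) ('d e x z)).
  have dL : differentiable L (e x) by have [+ _] := Loo 1%N; apply; exact: eW.
  have H : is_diff x (L \o e) ('d L (e x) \o 'd e x).
    have H1 := differentiableP (de Wx); have H2 := differentiableP dL.
    exact: is_diff_comp H1 H2.
  apply: DeriveDef; first by have [Hd _] := H; exact: diff_derivable.
  exact: is_diff_derive z H.
have push (a b : 'rV[R]_k) : 'D_(a *m Z x) (fun y => 'd e y (b *m Z y)) x =
    b *m 'd E x (a *m Z x) *m L (e x) + b *m E x *m 'd L (e x) ('d e x (a *m Z x)).
  have nE : {near x, (fun y => b *m E y *m (L \o e) y) =1 (fun y => 'd e y (b *m Z y))}.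
    apply: filterS (open_nbhs_nbhs (conj oW Wx)) => y Wy.
    have /(memT Wy) H := ZT b Wy.
    by apply: etrans (esym H); rewrite -DeE /E !mulmxA.
  rewrite -(near_eq_derive _ nE).
  have bE := is_derive_mulmx2 (is_derive_cst b x (a *m Z x)) (dE (a *m Z x)).
  rewrite mul0mx add0r in bE.
  by have [_ ->] := is_derive_mulmx2 bE (dLe (a *m Z x)).
have val (a : 'rV[R]_k) : 'd e x (a *m Z x) = a *m E x *m L (e x).
  have /(memT Wx) H := ZT a Wx.
  by apply: etrans H _; rewrite -DeE /E !mulmxA.
apply/(memT Wx).
have := bracket_push oW Wx (eoo 2) (dZ c) (dZ c').
rewrite !push !val (commL (eW Wx) (c *m E x) (c' *m E x)) opprD addrACA subrr addr0.
rewrite -mulmxBl => <-.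
by rewrite -[_ *m L _ *m Pm]mulmxA LP ?mulmx1//; exact: eW.
Qed.

(** E has the rank of Z and is idempotent, so the rank of Z is constant near x0;
a basis C * Z x0 of the row space then extends to the frame C * Z. *)
Lemma retract_frame : exists (W' : set 'rV[R]_m) (B : 'rV[R]_m -> 'M[R]_(\dim (T x0), m)),
  [/\ [/\ open W', W' x0 & W' `<=` W], cinfty_on W' B /\ row_free (B x0),
      (forall x, W' x -> \dim (T x) = \dim (T x0)),
      (forall x, W' x -> forall i, row i (B x) \in T x) &
      (forall x, W' x -> forall i j,
         'd (fun y => row j (B y)) x (row i (B x)) - 'd (fun y => row i (B y)) x (row j (B x))
           \in T x)].
Proof.
have dimT x : W x -> \dim (T x) = \rank (Z x) by move=> Wx; rewrite TE// dim_limg_mulmxr.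
have : \forall x \near x0, W x /\ \rank (Z x) = \rank (Z x0).
  apply: filterS2 (open_nbhs_nbhs (conj oW Wx0)) (mxrank_idempotent_near oW Wx0 (Eoo 0) EE).
  move=> x Wx h; split; first exact: Wx.
  exact: etrans (esym (rankE Wx)) (etrans h (rankE Wx0)).
move=> /nbhs_ballP[r /= r0 rP].
have /submxP[C CE] : (row_base (Z x0) <= Z x0)%MS by rewrite eq_row_base.
have Wr x : ball x0 r x -> W x by move=> /rP[].
rewrite dimT//; exists (ball x0 r), (fun x => C *m Z x); split.
- by split=> //; [exact: ball_open|exact: ballxx].
- split; last by rewrite -CE row_base_free.
  move=> j; have oB := @ball_open _ _ x0 r.
  by have := ck_mulmx oB (ck_cst j C oB) (ck_sub Wr (Zoo j)).
- by move=> x /rP[Wx <-]; exact: dimT.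
- by move=> x /Wr Wx i; rewrite row_mul; exact: ZT.
move=> x /Wr Wx i j.
have rE l : (fun y => row l (C *m Z y)) = (fun y => row l C *m Z y).
  by apply/funext => y; exact: row_mul.
have dE l l' := congr2 (fun F v => 'd F x v) (rE l) (row_mul l' C (Z x)).
apply: memv_eq (congr2 (fun a b => a - b) (dE j i) (dE i j)) _.
exact: bracketT.
Qed.

End Retract.

Section BaseIntegrable.
Context {R : realType} {n m : nat} (G : manifold R n) (P : manifold R m).
Variables (GG : lie_groupoid G P) (S : tangent_distribution G).
Hypothesis integS : forall g, integrable_at S (\dim (S g)) g.
Hypothesis unit_src : forall g v, v \in S g ->
  tangent_map (gpd_unit GG) (gpd_src GG g) (tangent_map (gpd_src GG) g v)
    \in S (gpd_unit GG (gpd_src GG g)).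

Let eps := gpd_unit GG.
Let src := gpd_src GG.
Let S0 := base_distribution GG S.

Let epsc : continuous eps := (gpd_unit_smooth GG).1.

Lemma mem_chart_base c0 c q z : atlas c0 -> atlas c -> chart_dom c0 q -> chart_dom c (eps q) ->
  z \in chart_dist S0 c0 (chart_map c0 q) <->
  'd (chart_map c \o eps \o chart_inv c0) (chart_map c0 q) z
    \in chart_dist S c (chart_map c (eps q)).
Proof.
move=> a0 ac d0 dc.
have [_ dE] := map_in_chart (gpd_unit_smooth GG) a0 ac d0 dc.
have [ae de] := (chart_at_atlas (eps q), chart_at_dom (eps q)).
split=> [/(mem_chart_dist _ _ a0 d0) | /(mem_chart_dist _ _ ac dc)] H.
  apply: memv_eq (dE z) _; apply: mem_chart_dist_T => //.
  by move: H; rewrite /S0 /base_distribution -memv_preim.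
apply/(mem_chart_dist _ _ a0 d0); rewrite /S0 /base_distribution -memv_preim.
apply: memv_eq H; apply/esym.
apply: etrans (congr1 ('d (chart_map (chart_at (eps q)) \o chart_inv c) _) (dE z)) _.
exact: transition_diffK.
Qed.

(** The tangent map of the unit sends Ts v to a vector of S, by multiplicativity,
which is the definition of Ts v being in S0. *)
Lemma diff_src_chart_base c0 c q v : atlas c0 -> atlas c -> chart_dom c0 q ->
  chart_dom c (eps q) -> v \in chart_dist S c (chart_map c (eps q)) ->
  'd (chart_map c0 \o src \o chart_inv c) (chart_map c (eps q)) v
    \in chart_dist S0 c0 (chart_map c0 q).
Proof.
move=> a0 ac d0 dc /(mem_chart_dist _ _ ac dc) H.
have sq : src (eps q) = q by exact: gpd_src_unit.
have d0' : chart_dom c0 (src (eps q)) by rewrite sq.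
have [_ dE] := map_in_chart (gpd_src_smooth GG) ac a0 dc d0'.
apply: memv_eq (dE v) _; have := unit_src H.
set v' := 'd _ _ _; rewrite -/src -/(eps) sq => H'.
rewrite -{4}sq; apply: mem_chart_dist_T => //; rewrite sq.
by rewrite /S0 /base_distribution -memv_preim.
Qed.

(** [retract_frame] for the representations e of the unit and sigma of the
source in the preferred charts at p and at its unit. *)
Lemma base_integrable p : integrable_at S0 (\dim (S0 p)) p.
Proof.
have [V [L [Pm [[oV Vx VC dV] Loo LP memS commL]]]] := integS (eps p).
set c0 := chart_at p; set c := chart_at (eps p).
have [a0 d0] : atlas c0 /\ chart_dom c0 p by split; [exact: chart_at_atlas|exact: chart_at_dom].
have [ac dc] : atlas c /\ chart_dom c (eps p).
  by split; [exact: chart_at_atlas|exact: chart_at_dom].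
pose e := chart_map c \o eps \o chart_inv c0.
pose sigma := chart_map c0 \o src \o chart_inv c.
have sp : src (eps p) = p by exact: gpd_src_unit.
have d0' : chart_dom c0 (src (eps p)) by rewrite sp.
have [se _] := map_in_chart (gpd_unit_smooth GG) a0 ac d0 dc.
have [ss _] := map_in_chart (gpd_src_smooth GG) ac a0 dc d0'.
have VN : nbhs (chart_map c (eps p)) V by exact: open_nbhs_nbhs.
have [r1 [r10 r1V soo]] := smooth_nearP ss VN.
set V1 := ball _ r1 in r1V soo.
have epsN : nbhs p (fun q => chart_dom c0 q /\ chart_dom c (eps q)).
  apply: filterI; first exact: nbhs_chart_dom.
  by apply: epsc; exact: nbhs_chart_dom.
have eN : nbhs (chart_map c0 p) (e @^-1` V1).
  have ce : {for chart_map c0 p, continuous e} by exact/differentiable_continuous/smooth_near_diff.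
  apply: ce; have -> : e (chart_map c0 p) = chart_map c (eps p) by rewrite /e /= chart_mapK.
  by apply: nbhsx_ballx.
have [r [r0 rN eoo]] := smooth_nearP se (filterI eN (near_chart_inv d0 epsN)).
have oV1 : open V1 by exact: ball_open.
set W := ball _ r in rN eoo.
have oW : open W by exact: ball_open.
have Wp : W (chart_map c0 p) by exact: ballxx.
have eE x : W x -> e x = chart_map c (eps (chart_inv c0 x)) by [].
have Wdom x : W x -> [/\ chart_cod c0 x, chart_dom c0 (chart_inv c0 x) &
    chart_dom c (eps (chart_inv c0 x))].
  by move=> /rN[_ [H1 [H2 H3]]].
have eW x : W x -> V1 (e x) by move=> /rN[].
have se' x : W x -> sigma (e x) = x.
  move=> Wx; have [H1 H2 H3] := Wdom x Wx.
  by rewrite /sigma /e /= chart_mapK// /src /eps gpd_src_unit chart_invK.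
have memT x : W x -> forall z, z \in chart_dist S0 c0 x <-> 'd e x z = 'd e x z *m Pm *m L (e x).
  move=> Wx z; have [H1 H2 H3] := Wdom x Wx.
  have := mem_chart_base z a0 ac H2 H3; rewrite chart_invK// -(eE x Wx) => ->.
  by apply: memS; exact/r1V/eW.
have sT x : W x -> forall v, 'd sigma (e x) (v *m L (e x)) \in chart_dist S0 c0 x.
  move=> Wx v; have [H1 H2 H3] := Wdom x Wx.
  have Ve : V (e x) by exact/r1V/eW.
  have : v *m L (e x) \in chart_dist S c (e x).
    by apply/(memS _ Ve); rewrite -[_ *m Pm]mulmxA LP ?mulmx1.
  move=> /(diff_src_chart_base a0 ac H2 H3).
  by rewrite chart_invK.
have [W' [B [[oW' W'p W'W] [Boo Bf] dT BT br]]] :=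
  retract_frame oW Wp oV1 eW eoo soo se' (fun j => ck_sub r1V (Loo j))
    (fun y H => LP y (r1V y H)) (fun y H => commL y (r1V y H)) memT sT.
have dE : \dim (chart_dist S0 c0 (chart_map c0 p)) = \dim (S0 p) by rewrite dim_chart_dist.
rewrite -dE; apply: (frame_integrable oW' W'p _ Boo Bf dT BT br).
by move=> x /W'W/Wdom[].
Qed.

End BaseIntegrable.

(** * The maps induced by the structure maps *)

Theorem theorem3p12 (R : realType) (n m : nat) (G : manifold R n)
    (P : manifold R m) (GG : lie_groupoid G P) (S : tangent_distribution G)
    (S_subbundle : subbundle S) (S_involutive : involutive_distribution S)
    (S_multiplicative : multiplicative GG S) :
  let S0 := base_distribution GG S in
  [/\ (forall p q : P,
         same_leaf S0 p q -> same_leaf S (gpd_unit GG p) (gpd_unit GG q)) /\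
      (exists! e : leaf_space S0 -> leaf_space S,
         leaf_proj S \o gpd_unit GG = e \o leaf_proj S0),
      (forall g h : G, same_leaf S g h ->
         same_leaf S0 (gpd_src GG g) (gpd_src GG h) /\
         same_leaf S0 (gpd_tgt GG g) (gpd_tgt GG h)) /\
      ((exists! s : leaf_space S -> leaf_space S0,
          s \o leaf_proj S = leaf_proj S0 \o gpd_src GG) /\
       (exists! t : leaf_space S -> leaf_space S0,
          t \o leaf_proj S = leaf_proj S0 \o gpd_tgt GG))
    & (forall g h : G,
         same_leaf S g h -> same_leaf S (gpd_inv GG g) (gpd_inv GG h)) /\
      (exists! i : leaf_space S -> leaf_space S,
         i \o leaf_proj S = leaf_proj S \o gpd_inv GG)].
Proof.
move=> S0; have [Ssrc Stgt Sinv _] := S_multiplicative.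
have integS := subbundle_integrable S_subbundle S_involutive.
have integS0 : forall p, integrable_at S0 (\dim (S0 p)) p := base_integrable integS Ssrc.
have unitS p v : v \in S0 p -> tangent_map (gpd_unit GG) p v \in S (gpd_unit GG p).
  by rewrite /S0 /base_distribution -memv_preim.
have srcS g v : v \in S g -> tangent_map (gpd_src GG) g v \in S0 (gpd_src GG g).
  by move=> /Ssrc; rewrite /S0 /base_distribution -memv_preim.
have tgtS g v : v \in S g -> tangent_map (gpd_tgt GG) g v \in S0 (gpd_tgt GG g).
  by move=> /Stgt; rewrite /S0 /base_distribution -memv_preim.
split; split.
- exact: same_leaf_map (gpd_unit_smooth GG) unitS integS0 integS.
- have [e [eE eU]] := induced_map_exists_unique (gpd_unit_smooth GG) unitS integS0 integS.
  by exists e; split=> // e' /esym; exact: eU.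
- move=> g h gh; split.
    exact: same_leaf_map (gpd_src_smooth GG) srcS integS integS0 _ _ gh.
  exact: same_leaf_map (gpd_tgt_smooth GG) tgtS integS integS0 _ _ gh.
- split.
    exact: induced_map_exists_unique (gpd_src_smooth GG) srcS integS integS0.
  exact: induced_map_exists_unique (gpd_tgt_smooth GG) tgtS integS integS0.
- exact: (same_leaf_map (gpd_inv_smooth GG) Sinv integS integS).
- exact: (induced_map_exists_unique (gpd_inv_smooth GG) Sinv integS integS).
Qed.
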